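(* Let $a$ be a bounded (measurable) function on $[0,\infty)$ and consider $$m(\lambda)=\lambda^{1/2}\int_0^\infty e^{-s\lambda^{1/2}}a(s)\,ds,\qquad\lambda>0.$$ Then, for every $\alpha>0$, the multiplier operator of Laplace transform type $m(\mathcal{L})$ (respectively $m(\mathcal{H})$) is bounded from $\Lambda^\alpha_{\mathcal{L}}$ (respectively $\Lambda^\alpha_{\mathcal{H}}$) into itself.
   Context: Fix $n\ge1$. Let $\mathcal{H}=-\Delta_x+|x|^2$ on $\mathbb{R}^n$ and $\mathcal{L}=\partial_t-\Delta_x+|x|^2$ on $\mathbb{R}^{n+1}\ni(t,x)$. Functions are identified when equal almost everywhere. For $y>0$, $f\in L^\infty(\mathbb{R}^{n+1})$, $g\in L^\infty(\mathbb{R}^n)$, the Poisson semigroups $\mathcal{P}_y=e^{-y\mathcal{L}^{1/2}}$ and $P_y=e^{-y\mathcal{H}^{1/2}}$ are $$\mathcal{P}_yf(t,x)=\frac{y}{2\sqrt\pi}\int_0^\infty\int_{\mathbb{R}^n}e^{-\frac{y^2}{4\tau}}\,\frac{e^{-\frac{|x-z|^2}{4}\coth\tau}\,e^{-\frac{|x+z|^2}{4}\tanh\tau}}{(2\pi\sinh2\tau)^{n/2}}\,f(t-\tau,z)\,dz\,\frac{d\tau}{\tau^{3/2}},$$ and $P_yg(x)$ is given by the same formula with $f(t-\tau,z)$ replaced by $g(z)$. For $\alpha>0$, with $k=[\alpha]+1$ ($[\cdot]$ the integer part), $\Lambda^\alpha_{\mathcal{L}}$ is the set of $f\in L^\infty(\mathbb{R}^{n+1})$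 for which there is $C_k$ with $\|\partial_y^k\mathcal{P}_yf\|_{L^\infty(\mathbb{R}^{n+1})}\le C_ky^{-k+\alpha}$ for all $y>0$; its norm is $\|f\|_\infty+C$ with $C$ the infimum of such $C_k$. The space $\Lambda^\alpha_{\mathcal{H}}$ and its norm are defined identically for $g\in L^\infty(\mathbb{R}^n)$ with $P_y$ in place of $\mathcal{P}_y$ and $L^\infty(\mathbb{R}^n)$ in place of $L^\infty(\mathbb{R}^{n+1})$. The operator $\mathcal{L}^{1/2}$ is $\mathcal{L}^{1/2}u=\frac1{c_1}\int_0^\infty(\mathcal{P}_\tau-I)^2u\,\frac{d\tau}{\tau^2}$ with $c_1=\int_0^\infty(e^{-\tau}-1)^2\frac{d\tau}{\tau^2}$ (pointwise integral), and $\mathcal{H}^{1/2}$ is defined in the same way with $P_\tau$. The operator $m(\mathcal{L})$ is $$m(\mathcal{L})f=\mathcal{L}^{1/2}\Big(\int_0^\infty\mathcal{P}_sf\,a(s)\,ds\Big),\qquad f\in\Lambda^\alpha_{\mathcal{L}},$$ and similarly $m(\mathcal{H})g=\mathcal{H}^{1/2}\big(\int_0^\infty P_sg\,a(s)\,ds\big)$, $g\in\Lambda^\alpha_{\mathcal{H}}$. *)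

(* Defs.v *)
From HB Require Import structures.
From mathcomp Require Import all_boot all_order all_algebra.
From mathcomp Require Import all_classical all_reals all_analysis.

Set Implicit Arguments.
Unset Strict Implicit.
Unset Printing Implicit Defensive.

Import Order.TTheory GRing.Theory Num.Def Num.Theory.
Import numFieldNormedType.Exports.

Local Open Scope classical_set_scope.
Local Open Scope ring_scope.

(* Functions are real-valued; a class of functions
   modulo almost everywhere equality is handled through Borel representatives.
   R^(n+1) is R * R^n, with the time variable first. *)
Notation space R n := (n.-tuple (measurableTypeR R)).
Notation spacetime R n := (measurableTypeR R * space R n)%type.

Section LebesgueTupleStep.
Context {R : realType} (n : nat).
Variable mu : {sigma_finite_measure set (space R n) -> \bar R}.

Definition tuple_cons (p : spacetime R n) : space R n.+1 :=
  [tuple of p.1 :: p.2].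

Lemma measurable_tuple_cons : measurable_fun setT tuple_cons.
Proof. by apply: measurable_cons. Qed.

HB.instance Definition _ := isMeasurableFun.Build _ _ _ _ tuple_cons
  measurable_tuple_cons.

Definition lebesgue_tuple_step : set (space R n.+1) -> \bar R :=
  pushforward (@lebesgue_measure R \x mu)%E tuple_cons.

Let step0 : lebesgue_tuple_step set0 = 0%E.
Proof. exact: measure0. Qed.

Let step_ge0 A : (0 <= lebesgue_tuple_step A)%E.
Proof. exact: measure_ge0. Qed.

Let step_sigma_additive : semi_sigma_additive lebesgue_tuple_step.
Proof. exact: measure_semi_sigma_additive. Qed.

HB.instance Definition _ := isMeasure.Build _ _ _ lebesgue_tuple_step
  step0 step_ge0 step_sigma_additive.

Let sigma_finite_step : sigma_finite setT lebesgue_tuple_step.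
Proof.
have /sigma_finiteP[F [UF ndF Ffin]] := sigma_finiteT (@lebesgue_measure R).
have /sigma_finiteP[G [UG ndG Gfin]] := sigma_finiteT mu.
pose unc (x : space R n.+1) : spacetime R n := (thead x, [tuple of behead x]).
have consK : cancel tuple_cons unc.
  by move=> [t x]; rewrite /unc /= theadE; congr pair; apply: val_inj.
have uncm : measurable_fun setT unc.
  apply/measurable_fun_pair; last exact: measurable_behead.
  exact: (@measurable_tnth _ _ _ ord0).
exists (fun i => unc @^-1` (F i `*` G i)).
  apply/esym; rewrite -subTset => x _.
  have [i _ Fi] : (\bigcup_i F i) (thead x) by rewrite -UF.
  have [j _ Gj] : (\bigcup_j G j) [tuple of behead x] by rewrite -UG.
  exists (maxn i j) => //; split => /=.
    by move: (thead x) Fi; exact/subsetPset/ndF/leq_maxl.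
  by move: [tuple of behead x] Gj; exact/subsetPset/ndG/leq_maxr.
move=> i; have [mF Foo] := Ffin i; have [mG Goo] := Gfin i.
have mFG : measurable (F i `*` G i) by exact: measurableX.
split; first by rewrite -[X in measurable X]setTI; exact: uncm.
rewrite /lebesgue_tuple_step /pushforward -comp_preimage.
rewrite (_ : unc \o tuple_cons = id); last by apply/funext => p /=; rewrite consK.
by rewrite preimage_id product_measure1E// lte_mul_pinfty// ge0_fin_numE.
Qed.

HB.instance Definition _ := Measure_isSigmaFinite.Build _ _ _
  lebesgue_tuple_step sigma_finite_step.

End LebesgueTupleStep.

Fixpoint lebesgue_tuple (R : realType) (n : nat) :
    {sigma_finite_measure set (space R n) -> \bar R} :=
  match n with
  | 0 => dirac [tuple] : {sigma_finite_measure set (space R 0) -> \bar R}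
  | m.+1 => lebesgue_tuple_step (lebesgue_tuple R m)
  end.

Section Kernel.
Context {R : realType} (n : nat).
Implicit Types (x z : space R n) (y tau : R).

Definition sinh (r : R) : R := (expR r - expR (- r)) / 2.
Definition cosh (r : R) : R := (expR r + expR (- r)) / 2.
Definition tanh (r : R) : R := sinh r / cosh r.
Definition coth (r : R) : R := cosh r / sinh r.

Definition sqdist x z : R := \sum_(i < n) ((tnth x i : R) - tnth z i) ^+ 2.
Definition sqsum x z : R := \sum_(i < n) ((tnth x i : R) + tnth z i) ^+ 2.

(* Mehler kernel of the heat semigroup e^(- tau H), H = - Delta + |x|^2. *)
Definition mehler tau x z : R :=
  expR (- (sqdist x z / 4) * coth tau) * expR (- (sqsum x z / 4) * tanh tau)
  / (2 * pi * sinh (2 * tau)) `^ (n%:R / 2).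

Definition poisson_integral y x (h : R -> space R n -> R) : R :=
  y / (2 * Num.sqrt pi) *
  \int[@lebesgue_measure R]_(tau in `]0, +oo[)
    ((\int[lebesgue_tuple R n]_z
        (expR (- (y ^+ 2 / (4 * tau))) * mehler tau x z * h tau z))
     / tau `^ (3 / 2)).

(* Poisson semigroup of L = d/dt - Delta + |x|^2, then that of H. *)
Definition poissonL y (f : spacetime R n -> R) (p : spacetime R n) : R :=
  poisson_integral y p.2 (fun tau z => f ((p.1 : R) - tau, z)).

Definition poissonH y (g : space R n -> R) x : R :=
  poisson_integral y x (fun _ z => g z).

Definition spacetime_measure : {measure set (spacetime R n) -> \bar R} :=
  product_measure1 (@lebesgue_measure R) (lebesgue_tuple R n).

End Kernel.

(* The spaces and operators attached to L and to H are the instances of the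
   following with mu Lebesgue measure and P the Poisson semigroup of L or H. *)
Section Multiplier.
Context {R : realType} {d : measure_display} {X : measurableType d}.
Variables (mu : {measure set X -> \bar R}) (P : R -> (X -> R) -> X -> R).
Implicit Types (f u : X -> R) (a : R -> R) (alpha C tau : R).

Definition order_of alpha : nat := (Num.truncn alpha).+1.

(* For an essentially bounded f and y > 0 the derivative in y always exists, so
   that the total operator ^`(k) is the genuine k-th derivative. *)
Definition Lambda_bound alpha f C : Prop :=
  forall y : R, 0 < y ->
    ('N[mu]_(+oo)[(fun x =>
        (derive1n (order_of alpha) (fun s : R => P s f x : R^o) y)%:E)]
     <= (C * y `^ (- (order_of alpha)%:R + alpha))%:E)%E.

Definition Lambda alpha : set (X -> R) :=
  [set f | f \in Lfun mu +oo /\ exists C, Lambda_bound alpha f C].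

Definition Lambda_norm alpha f : \bar R :=
  ('N[mu]_(+oo)[EFin \o f]
   + ereal_inf [set C%:E | C in [set C | Lambda_bound alpha f C]])%E.

Definition P_sub_I tau u : X -> R := fun x => P tau u x - u x.

Definition sqrt_integrand u (x : X) (tau : R) : R :=
  P_sub_I tau (P_sub_I tau u) x / tau ^+ 2.

Definition c1 : R :=
  \int[@lebesgue_measure R]_(tau in `]0, +oo[)
    ((expR (- tau) - 1) ^+ 2 / tau ^+ 2).

Definition sqrt_op u : X -> R := fun x =>
  c1^-1 * \int[@lebesgue_measure R]_(tau in `]0, +oo[) sqrt_integrand u x tau.

Definition laplace_avg a f : X -> R := fun x =>
  \int[@lebesgue_measure R]_(s in `]0, +oo[) (P s f x * a s).

(* The operator m(L), resp. m(H), with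
   m(lambda) = lambda^(1/2) \int_0^oo e^(- s lambda^(1/2)) a(s) ds. *)
Definition multiplier a f : X -> R := sqrt_op (laplace_avg a f).

(* Integrals are total: convergence of those defining [multiplier a f] has to
   be stated separately. *)
Definition multiplier_defined a f : Prop :=
  [/\ {ae mu, forall x, (@lebesgue_measure R).-integrable `]0, +oo[
         (fun s => (P s f x * a s)%:E)},
      laplace_avg a f \in Lfun mu +oo
    & {ae mu, forall x, (@lebesgue_measure R).-integrable `]0, +oo[
         (fun tau => (sqrt_integrand (laplace_avg a f) x tau)%:E)}].

Definition multiplier_bounded a alpha : Prop :=
  (forall f, Lambda alpha f -> multiplier_defined a f) /\
  exists K : R, forall f, Lambda alpha f ->
    Lambda alpha (multiplier a f) /\
    (Lambda_norm alpha (multiplier a f) <= K%:E * Lambda_norm alpha f)%E.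

End Multiplier.

(* Main.v *)
Require Import Defs.
From HB Require Import structures.
From mathcomp Require Import all_boot all_order all_algebra.
From mathcomp Require Import all_classical all_reals all_analysis.
From mathcomp Require Import measurable_realfun ess_sup_inf lebesgue_integral_under.
From mathcomp Require Import ring lra.

Set Implicit Arguments.
Unset Strict Implicit.
Unset Printing Implicit Defensive.

Import Order.TTheory GRing.Theory Num.Def Num.Theory.
Import numFieldNormedType.Exports.

Local Open Scope classical_set_scope.
Local Open Scope ring_scope.

(** The theorem is deduced from a statement about an abstract semigroup
   P_y f (p) = \int K_y(p, q) f(q) dq whose kernel K >= 0 satisfies, for some
   constant c (record [smoothing_kernel]): Chapman-Kolmogorov,
   \int K_y(p, q) dq <= min(c, c / y^2), |d/dy K_y| <= (c / y) K_(y/2), and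
   K_s <= c K_(y/2) for y/2 < s < 2 y.

   Abstract part. Put phi_j(y) = d^j/dy^j P_y f. By the semigroup law,
   d/dy P_y = K'_(y/2) P_(y/2), where K' is the derivative of the kernel, and
   so each derivative of P_y costs a factor y^-1 in the sup norm. Since
   (P_tau - I)^2 P_s is a second difference in s, the operator to bound is
     T f = c1^-1 \int_0^oo \int_0^oo
             a(s) tau^-2 (phi_0(s + 2 tau) - 2 phi_0(s + tau) + phi_0(s)) ds dtau
   and, because everything commutes with P_y,
     d^k/dy^k P_y (T f) = c1^-1 \int_0^oo \int_0^oo
             a(s) tau^-2 (second difference of phi_k at y + s, step tau) ds dtau.
   A second difference of h with step tau is at most tau^2 sup |h''| and at
   most 4 sup |h|. Using the first bound for tau <= T and the second one for
   tau > T, the integral in tau is at most T sup |h''| + 4 sup |h| / T, where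
   T > 0 may depend on s ([integral_min_le]). It remains to choose T.
   - For d^k/dy^k P_y (T f), the hypothesis |phi_k(r)| <= C r^(alpha - k) gives
     |phi_(k+2)(r)| <= C' r^(alpha - k - 2) ([dP_growth]). With T = y + s the
     integrand in s is a multiple of C (y + s)^(alpha - k - 1), which is
     integrable on (0, oo) because k > alpha, with integral of order
     y^(alpha - k): this is the estimate that defines the space.
   - For T f itself, |phi_0(s)| <= c ||f|| min(1, s^-2), and up to a constant
     phi_2 is bounded by s^(b - 2) for s <= 1 with b = min(alpha, 1/2), and by
     s^-2 for s >= 1 ([near0_bound2]). With T = s^(1 - b/2) for s <= 1 and T = 1 for s > 1 the
     integrand in s is s^(b/2 - 1) near 0 and s^-2 at infinity, so that all
     integrals converge absolutely and T f is bounded.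
   These bounds are [multiplier_estimatesP], from which
   [smoothing_multiplier_bounded] follows.

   Concrete part. On space-time, the Poisson semigroup of the parabolic operator
   has the kernel levy_y(t - t') M_(t - t')(x, z) for t' < t, where M is the
   Mehler kernel and levy_y the one-sided stable density of index 1/2. The
   semigroup law follows from that of M, a Gaussian integral in each coordinate,
   and from levy_y * levy_s = levy_(y + s), for which an explicit primitive of
   levy_y(t) levy_s(b - t) is available ([levy_convolution]). The mass decays
   like y^-2 because levy_y(t) <= 12 / y^2 and, in dimension at least 1, M_t has
   mass at most sqrt(2) e^-t.

   Finally, the Poisson semigroup of the elliptic operator is the restriction
   of that of the parabolic one to functions that do not depend on time, and
   such functions have the same norms on both sides
   ([multiplier_bounded_lift]). *)

(** * Integral operators on a sigma-finite space *)
Section RintegralTools.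
Context d (T : measurableType d) (R : realType).
Variable mu : {measure set T -> \bar R}.

Lemma norm_Rintegral_le (D : set T) (f : T -> R) (c : R) :
  measurable D -> measurable_fun D f ->
  (\int[mu]_(x in D) `|f x|%:E <= c%:E)%E -> `|\int[mu]_(x in D) f x| <= c.
Proof.
move=> mD mf fc.
have intf : mu.-integrable D (EFin \o f).
  apply/integrableP; split; first exact/measurable_EFinP.
  by rewrite (le_lt_trans fc) ?ltry.
rewrite -lee_fin EFin_normr_Rintegral//.
apply: le_trans fc; apply: le_trans (le_abse_integral mu mD _) _ => //.
exact/measurable_EFinP.
Qed.

Lemma le_integral_integrable (D : set T) (f g : T -> R) (c : R) :
  measurable D -> measurable_fun D f -> measurable_fun D g ->
  (forall x, D x -> `|f x| <= g x) ->
  (\int[mu]_(x in D) (g x)%:E <= c%:E)%E -> mu.-integrable D (EFin \o f).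
Proof.
move=> mD mf mg fg gc; apply/integrableP; split; first exact/measurable_EFinP.
apply: (@le_lt_trans _ _ c%:E); last by rewrite ltry.
apply: le_trans gc; apply: ge0_le_integral => //=.
- by do 2 apply: measurableT_comp => //; exact/measurable_EFinP.
- exact/measurable_EFinP.
Qed.

End RintegralTools.

Section ProductSigmaFinite.
Context d1 d2 (T1 : measurableType d1) (T2 : measurableType d2) (R : realType).
Variables (m1 : {sigma_finite_measure set T1 -> \bar R})
          (m2 : {sigma_finite_measure set T2 -> \bar R}).

(** The product measure under a name of its own, so that it can carry the
   structure of a sigma-finite measure and be a factor in Fubini's theorem
   again. *)
Definition sigma_finite_prod : set (T1 * T2) -> \bar R := (m1 \x m2)%E.

HB.instance Definition _ := Measure.copy sigma_finite_prod (m1 \x m2)%E.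

Let sigma_finite_prodT : sigma_finite setT sigma_finite_prod.
Proof.
have /sigma_finiteP[F [TF ndF Foo]] := sigma_finiteT m1.
have /sigma_finiteP[G [TG ndG Goo]] := sigma_finiteT m2.
exists (fun n => F n `*` G n).
  apply/esym; rewrite -subTset => -[x y] _.
  have [n _ Fnx] : (\bigcup_i F i) x by rewrite -TF.
  have [k _ Gky] : (\bigcup_i G i) y by rewrite -TG.
  exists (maxn n k) => //; split => /=.
    by move: x Fnx; exact/subsetPset/ndF/leq_maxl.
  by move: y Gky; exact/subsetPset/ndG/leq_maxr.
move=> k; have [mF Fk] := Foo k; have [mG Gk] := Goo k.
split; first exact: measurableX.
by rewrite /sigma_finite_prod product_measure1E// lte_mul_pinfty// ge0_fin_numE.
Qed.

HB.instance Definition _ := Measure_isSigmaFinite.Build _ _ _ sigma_finite_prod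
  sigma_finite_prodT.

End ProductSigmaFinite.

Section RFubini.
Context d1 d2 (T1 : measurableType d1) (T2 : measurableType d2) (R : realType).
Variables (m1 : {sigma_finite_measure set T1 -> \bar R})
          (m2 : {sigma_finite_measure set T2 -> \bar R}).
Implicit Types F : T1 * T2 -> R.

(** Sections may fail to be integrable: the inner integral is then a junk value, but
   it is still a measurable function of the integrals of the positive and
   negative parts. *)
Lemma measurable_Rintegral F : measurable_fun setT F ->
  measurable_fun setT (fun x => \int[m2]_y F (x, y)).
Proof.
move=> mF; rewrite /Rintegral.
have mEF : measurable_fun setT (EFin \o F) by exact/measurable_EFinP.
rewrite [X in measurable_fun _ X](_ : _ = fine \o (fun x =>
   (fubini_F m2 (EFin \o F)^\+%E x - fubini_F m2 (EFin \o F)^\-%E x)%E)).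
  apply: measurableT_comp; first exact: fine_measurable.
  apply: emeasurable_funB.
    apply: (@measurable_fun_fubini_tonelli_F _ _ _ _ _ m2 (EFin \o F)^\+%E) => //.
    exact: measurable_funepos.
  apply: (@measurable_fun_fubini_tonelli_F _ _ _ _ _ m2 (EFin \o F)^\-%E) => //.
  exact: measurable_funeneg.
apply/funext => x /=; rewrite integralE /fubini_F.
by congr (fine (_ - _)%E); apply: eq_integral => y _; rewrite ?funeposE ?funenegE.
Qed.

Variables (F : T1 * T2 -> R).
Hypothesis intF : (m1 \x m2)%E.-integrable setT (EFin \o F).

(** The real-valued inner integrals may be junk on a null set of sections. *)
Lemma Rintegral12 :
  \int[m1]_x (\int[m2]_y F (x, y)) = \int[(m1 \x m2)%E]_z F z.
Proof.
rewrite /Rintegral; congr fine.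
rewrite -[RHS](integral12_prod_meas1 intF).
have mF : measurable_fun setT F by apply/measurable_EFinP; exact: measurable_int intF.
apply: ae_eq_integral => //.
- by apply/measurable_EFinP; exact: measurable_Rintegral.
- exact: (measurable_fubini_F intF).
- have := ae_integrable1 intF; apply: filterS => x ix _ /=.
  rewrite /Rintegral fineK//; exact: integrable_fin_num ix.
Qed.

End RFubini.

Section RFubini2.
Context d1 d2 (T1 : measurableType d1) (T2 : measurableType d2) (R : realType).
Variables (m1 : {sigma_finite_measure set T1 -> \bar R})
          (m2 : {sigma_finite_measure set T2 -> \bar R}).
Variables (F : T1 * T2 -> R).
Hypothesis intF : (m1 \x m2)%E.-integrable setT (EFin \o F).

Lemma Rintegral21 :
  \int[m2]_y (\int[m1]_x F (x, y)) = \int[(m1 \x m2)%E]_z F z.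
Proof.
rewrite /Rintegral; congr fine.
rewrite -[RHS](integral21_prod_meas1 intF).
have mF : measurable_fun setT F by apply/measurable_EFinP; exact: measurable_int intF.
apply: ae_eq_integral => //.
- apply/measurable_EFinP; apply: (@measurable_Rintegral _ _ _ _ _ m1 (fun z : T2 * T1 => F (z.2, z.1))).
  apply: measurableT_comp mF _; apply/measurable_fun_pair.
  exact: measurable_snd.
  exact: measurable_fst.
- exact: (measurable_fubini_G intF).
- have := ae_integrable2 intF; apply: filterS => x ix _ /=.
  rewrite /Rintegral fineK//; exact: integrable_fin_num ix.
Qed.

Lemma Rintegral_fubini :
  \int[m1]_x (\int[m2]_y F (x, y)) = \int[m2]_y (\int[m1]_x F (x, y)).
Proof. by rewrite Rintegral12// Rintegral21. Qed.

Lemma integrable_Rintegral2 :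
  m2.-integrable setT (EFin \o (fun y => \int[m1]_x F (x, y))).
Proof.
have mF : measurable_fun setT F by apply/measurable_EFinP; exact: measurable_int intF.
have mG := measurable_fubini_G intF.
have : m2.-integrable setT (fubini_G m1 (EFin \o F)).
  apply/integrableP; split => //.
  have [_] := integrableP _ _ _ (integrable_abse intF).
  rewrite (_ : (fun x => _) = abse \o (EFin \o F)); last first.
    by apply/funext => x/=; rewrite normr_id.
  rewrite fubini_tonelli2//; last by apply: measurableT_comp => //; exact/measurable_EFinP.
  apply: le_lt_trans; apply: ge0_le_integral => //.
  - exact: measurableT_comp.
  - apply: (@measurable_fun_fubini_tonelli_G _ _ _ _ _ m1 (abse \o (EFin \o F))) => [|z /=].
      by apply: measurableT_comp => //; exact/measurable_EFinP.
    by rewrite lee_fin.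
  - move=> y _; apply: le_abse_integral => //.
    by apply/measurable_EFinP; exact: measurableT_comp mF _.
apply: le_integrable => //.
  apply/measurable_EFinP; apply: (@measurable_Rintegral _ _ _ _ _ m1 (fun z : T2 * T1 => F (z.2, z.1))).
  apply: measurableT_comp mF _; apply/measurable_fun_pair.
  exact: measurable_snd.
  exact: measurable_fst.
move=> y _ /=; rewrite /fubini_G /Rintegral.
case: (\int[m1]_x _)%E => //=.
  by rewrite leey.
by rewrite leey.
Qed.

End RFubini2.

Section OperatorDefinitions.
Context d (X : measurableType d) (R : realType).
Variable mu : {measure set X -> \bar R}.
Implicit Types (k l : X -> X -> R) (f g : X -> R).

Definition kernel_op k f (p : X) : R := \int[mu]_q (k p q * f q).

(** The operator with kernel k is then bounded with norm at most c on
   essentially bounded functions, and the bound holds at every point p, not only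
   almost everywhere. *)
Definition kernel_le k (c : R) : Prop :=
  measurable_fun setT (fun z : X * X => k z.1 z.2) /\
  forall p, (\int[mu]_q `|k p q|%:E <= c%:E)%E.

Definition ess_bounded f (M : R) : Prop :=
  measurable_fun setT f /\ {ae mu, forall q, `|f q| <= M}.

End OperatorDefinitions.

Section Operators.
Context d (X : measurableType d) (R : realType).
Variable mu : {sigma_finite_measure set X -> \bar R}.
Implicit Types (k l : X -> X -> R) (f g : X -> R).

Lemma ess_boundedT f M : measurable_fun setT f -> (forall q, `|f q| <= M) ->
  ess_bounded mu f M.
Proof. by move=> mf fM; split => //; exact: aeW. Qed.

Lemma kernel_le_section k c p : kernel_le mu k c -> measurable_fun setT (k p).
Proof.
move=> [mk _].
have := measurableT_comp mk (@measurable_pair1 _ _ X X p).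
exact.
Qed.

Lemma kernel_le_integral k c f M p : kernel_le mu k c -> ess_bounded mu f M ->
  0 <= M -> (\int[mu]_q `|k p q * f q|%:E <= (c * M)%:E)%E.
Proof.
move=> kc [mf fM] M0; have [_ /(_ p) kp] := kc.
have mk := kernel_le_section p kc.
have mnk : measurable_fun setT (fun q => `|k p q|%:E).
  by apply/measurable_EFinP; exact: measurableT_comp.
apply: (@le_trans _ _ (\int[mu]_q (`|k p q|%:E * M%:E))%E); last first.
  by rewrite ge0_integralZr ?lee_fin// EFinM lee_wpmul2r ?lee_fin.
apply: ae_ge0_le_integral => //=.
- by apply/measurable_EFinP; apply: measurableT_comp => //; exact: measurable_funM.
- by move=> q _; rewrite mule_ge0 ?lee_fin.
- by apply: emeasurable_funM => //; exact: measurable_cst.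
- by apply: filterS fM => q fq _; rewrite -EFinM lee_fin normrM ler_wpM2l.
Qed.

Lemma kernel_le_integrable k c f M p : kernel_le mu k c -> ess_bounded mu f M ->
  0 <= M -> mu.-integrable setT (EFin \o (fun q => k p q * f q)).
Proof.
move=> kc fM M0; apply/integrableP; split.
  apply/measurable_EFinP; apply: measurable_funM; last by case: fM.
  exact: kernel_le_section kc.
by apply: le_lt_trans (kernel_le_integral p kc fM M0) _; rewrite ltry.
Qed.

Lemma op_bound k c f M p : kernel_le mu k c -> ess_bounded mu f M -> 0 <= M ->
  `|kernel_op mu k f p| <= c * M.
Proof.
move=> kc fM M0; apply: norm_Rintegral_le => //.
  by apply: measurable_funM; [exact: kernel_le_section kc|case: fM].
exact: kernel_le_integral.
Qed.

Lemma measurable_op d' (W : measurableType d') (k : W -> X -> X -> R)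
    (f : W -> X -> R) :
  measurable_fun setT (fun z : W * (X * X) => k z.1 z.2.1 z.2.2) ->
  measurable_fun setT (fun z : W * X => f z.1 z.2) ->
  measurable_fun setT (fun z : W * X => kernel_op mu (k z.1) (f z.1) z.2).
Proof.
move=> mk mf.
apply: (@measurable_Rintegral _ _ _ _ _ mu
  (fun z : (W * X) * X => k z.1.1 z.1.2 z.2 * f z.1.1 z.2)).
apply: measurable_funM.
  apply: (measurableT_comp mk (g := fun z : (W * X) * X => (z.1.1, (z.1.2, z.2)))).
  by do !apply/measurable_fun_pair => /=; do ?apply: measurableT_comp.
apply: (measurableT_comp mf (g := fun z : (W * X) * X => (z.1.1, z.2))).
by do !apply/measurable_fun_pair => /=; do ?apply: measurableT_comp.
Qed.

Lemma opD k c f M g N p (r : R) : kernel_le mu k c -> ess_bounded mu f M -> 0 <= M ->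
  ess_bounded mu g N -> 0 <= N ->
  kernel_op mu k (fun q => f q + r * g q) p = kernel_op mu k f p + r * kernel_op mu k g p.
Proof.
move=> kc fM M0 gN N0.
have intf := kernel_le_integrable p kc fM M0.
have intg := kernel_le_integrable p kc gN N0.
rewrite /kernel_op -RintegralZl// -RintegralD//.
  by apply: eq_Rintegral => q _; rewrite mulrDr mulrCA.
by have := integrableZl measurableT r intg.
Qed.

(** Fubini: the kernel has finite mass and G is dominated by an integrable
   function of the parameter alone. *)
Lemma op_integral d' (W : measurableType d')
    (nu : {sigma_finite_measure set W -> \bar R}) k c (G : W -> X -> R)
    (g : W -> R) p :
  kernel_le mu k c -> measurable_fun setT (fun z : W * X => G z.1 z.2) ->
  (forall w q, `|G w q| <= g w) -> nu.-integrable setT (EFin \o g) ->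
  kernel_op mu k (fun q => \int[nu]_w G w q) p = \int[nu]_w kernel_op mu k (G w) p.
Proof.
move=> kc mG Gg ig.
have mk := kernel_le_section p kc.
have mg : measurable_fun setT g by apply/measurable_EFinP; exact: measurable_int ig.
have g0 w : 0 <= g w by rewrite (le_trans _ (Gg w p)).
have mkG : measurable_fun setT (fun z : W * X => k p z.2 * G z.1 z.2).
  by apply: measurable_funM => //; exact: (measurableT_comp mk (g := snd)).
have int : (nu \x mu)%E.-integrable setT
    (EFin \o (fun z : W * X => k p z.2 * G z.1 z.2)).
  apply/integrable12ltyP; first exact/measurable_EFinP.
  apply: (@le_lt_trans _ _ (\int[nu]_w (c * g w)%:E)%E); last first.
    by apply: integrable_lty => //; have := integrableZl measurableT c ig.
  apply: ge0_le_integral => //.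
  - by move=> w _; exact: integral_ge0.
  - apply: (@measurable_fun_fubini_tonelli_F _ _ _ _ _ mu
      (fun z : W * X => `|k p z.2 * G z.1 z.2|%:E)) => //.
    by apply/measurable_EFinP; exact: measurableT_comp.
  - by apply/measurable_EFinP; exact: measurable_funM.
  - move=> w _; apply: (kernel_le_integral p kc) => //.
    apply: ess_boundedT; last exact: Gg.
    exact: (measurableT_comp mG (measurable_pair1 w)).
rewrite /kernel_op (Rintegral_fubini int)/=.
apply: eq_Rintegral => q _; rewrite RintegralZl//.
apply: (le_integrable measurableT _ _ ig) => /=.
  by apply/measurable_EFinP; exact: (measurableT_comp mG (measurable_pair2 q)).
by move=> w _; rewrite lee_fin (ger0_norm (g0 w)).
Qed.

(** Fubini's theorem; the double integral converges absolutely because both kernels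
   have bounded mass. *)
Lemma op_comp k c l c' m f M p : kernel_le mu k c -> kernel_le mu l c' ->
  (forall q, 0 <= k p q) -> (forall q r, 0 <= l q r) ->
  (forall r, \int[mu]_q (k p q * l q r)%:E = (m r)%:E)%E ->
  ess_bounded mu f M -> 0 <= M ->
  kernel_op mu k (kernel_op mu l f) p = \int[mu]_r (m r * f r).
Proof.
move=> kc lc' k0 l0 klm fM M0.
have mk := kernel_le_section p kc; have [ml _] := lc'; have [mf _] := fM.
have mF : measurable_fun setT (fun z : X * X => k p z.1 * (l z.1 z.2 * f z.2)).
  apply: measurable_funM; first exact: (measurableT_comp mk (g := fst)).
  by apply: measurable_funM => //; exact: (measurableT_comp mf (g := snd)).
have c'0 : 0 <= c'.
  by have [_ /(_ p)] := lc'; rewrite -lee_fin; apply: le_trans; exact: integral_ge0.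
have int : (mu \x mu)%E.-integrable setT
    (EFin \o (fun z : X * X => k p z.1 * (l z.1 z.2 * f z.2))).
  apply/integrable12ltyP; first exact/measurable_EFinP.
  have cM := @kernel_le_integrable k c (cst (c' * M)) (c' * M) p kc.
  apply: (@le_lt_trans _ _ (\int[mu]_q (k p q * (c' * M))%:E)%E); last first.
    apply: integrable_lty => //; apply: cM; last by rewrite mulr_ge0.
    by apply: ess_boundedT => // q; rewrite ger0_norm// mulr_ge0.
  apply: ge0_le_integral => //.
  - by move=> w _; exact: integral_ge0.
  - apply: (@measurable_fun_fubini_tonelli_F _ _ _ _ _ mu
      (fun z : X * X => `|k p z.1 * (l z.1 z.2 * f z.2)|%:E)) => //.
    by apply/measurable_EFinP; exact: measurableT_comp.
  - by apply/measurable_EFinP; exact: measurable_funM.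
  - move=> q _ /=; under eq_integral do rewrite normrM EFinM.
    rewrite ge0_integralZl//=; last first.
      apply/measurable_EFinP; apply: measurableT_comp => //.
      by apply: measurable_funM => //; exact: kernel_le_section lc'.
    rewrite EFinM (ger0_norm (k0 q)) lee_wpmul2l ?lee_fin//.
    exact: kernel_le_integral.
transitivity (\int[mu]_q \int[mu]_r (k p q * (l q r * f r))).
  apply: eq_Rintegral => q _; rewrite RintegralZl//.
  exact: (kernel_le_integrable q lc' fM M0).
rewrite (Rintegral_fubini int)/=; apply: eq_Rintegral => r _.
under eq_Rintegral do rewrite mulrA.
rewrite RintegralZr//; first by rewrite /Rintegral klm.
apply/integrableP; split.
  apply/measurable_EFinP; apply: measurable_funM => //.
  exact: (measurableT_comp ml (measurable_pair2 r)).
rewrite /=; under eq_integral do rewrite ger0_norm ?mulr_ge0//.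
by rewrite klm ltry.
Qed.

End Operators.

(** * Semigroups given by smoothing kernels *)
(** Differentiation under the integral sign, localized on the neighbourhood
   (y/2, 2y) on which the kernels below are comparable. *)
Lemma is_derive_Rintegral d (X : measurableType d) (R : realType)
    (mu : {measure set X -> \bar R}) (F F' : R -> X -> R) (G : X -> R) (y : R) :
  0 < y ->
  (forall t, y / 2 < t < 2 * y -> mu.-integrable setT (EFin \o F t)) ->
  (forall (t : R) q, y / 2 < t < 2 * y -> is_derive t 1 (F ^~ q : R -> R^o) (F' t q)) ->
  mu.-integrable setT (EFin \o G) ->
  (forall t q, y / 2 < t < 2 * y -> `|F' t q| <= G q) ->
  is_derive y 1 (fun t => \int[mu]_q F t q : R^o) (\int[mu]_q F' y q).
Proof.
move=> y0 iF dF iG FG.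
have yI : y / 2 < y < 2 * y by apply/andP; split; lra.
have Iy : `](y / 2), (2 * y)[%classic y by rewrite /= in_itv/=.
have G0 q : 0 <= G q by exact: le_trans (FG y q yI).
have iF' t : `](y / 2), (2 * y)[%classic t -> mu.-integrable setT (EFin \o F t).
  by rewrite /= in_itv/=; exact: iF.
have dF1 t q : `](y / 2), (2 * y)[%classic t -> setT q -> derivable (F ^~ q) t 1.
  by rewrite /= in_itv/= => tI _; have [] := dF t q tI.
have dF2 t q : `](y / 2), (2 * y)[%classic t -> setT q -> `|partial1of2 F t q| <= G q.
  rewrite /= in_itv/= => tI _.
  by rewrite partial1of2E (@derive_val _ _ _ _ _ _ _ (dF t q tI)) FG.
apply: DeriveDef.
  exact: (derivable_under_integral measurableT Iy iF' dF1 G0 iG dF2).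
rewrite -derive1E (differentiation_under_integral measurableT Iy iF' dF1 G0 iG dF2).
by apply: eq_Rintegral => q _; rewrite partial1of2E (@derive_val _ _ _ _ _ _ _ (dF y q yI)).
Qed.

(** Used to differentiate an identity between functions of y > 0: the two sides
   are differentiated separately and the derivatives agree. *)
Lemma is_derive_unique_gt0 (R : realType) (F G : R -> R) (y a b : R) : 0 < y ->
  (forall t, 0 < t -> F t = G t) ->
  is_derive y 1 (F : R -> R^o) a -> is_derive y 1 (G : R -> R^o) b -> a = b.
Proof.
move=> y0 FG dF dG.
have : is_derive y 1 (G : R -> R^o) a.
  apply: near_eq_is_derive dF; near=> t; apply: FG; near: t; exact: lt_nbhsr.
by move=> /@derive_val <-; rewrite derive_val.
Unshelve. all: by end_near. Qed.

Lemma is_derive_comp_addr (R : realType) (F : R -> R) (y s a : R) :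
  is_derive (y + s) 1 (F : R -> R^o) a -> is_derive y 1 (fun t => F (t + s) : R^o) a.
Proof.
move=> dF.
have dsh : is_derive y 1 (fun t : R => t + s : R^o) 1.
  by rewrite -[X in is_derive _ _ _ X]addr0; apply: is_deriveD.
by have := @is_derive1_comp _ F (fun t => t + s) y a 1 dF dsh; rewrite mulr1.
Qed.

(** The properties of a Poisson kernel used by the abstract argument. K' is the
   derivative of K in y. The decay y^-2 makes \int P_s f a(s) ds converge at
   infinity, [sk_derive_le] makes derivatives of P_y bounded operators, and
   [sk_harnack] dominates K_s near s = y, for differentiation under the integral
   sign. *)
Record smoothing_kernel d (X : measurableType d) (R : realType)
    (mu : {measure set X -> \bar R}) (K K' : R -> X -> X -> R) (c : R) : Prop :=
  SmoothingKernel {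
  sk_cst : 0 <= c ;
  sk_meas : measurable_fun setT (fun z : R * (X * X) => K z.1 z.2.1 z.2.2) ;
  sk_meas' : measurable_fun setT (fun z : R * (X * X) => K' z.1 z.2.1 z.2.2) ;
  sk_ge0 : forall (y : R) (p q : X), 0 < y -> 0 <= K y p q ;
  sk_mass : forall (y : R) (p : X), 0 < y -> (\int[mu]_q (K y p q)%:E <= c%:E)%E ;
  sk_decay : forall (y : R) (p : X), 0 < y -> (\int[mu]_q (K y p q)%:E <= (c / y ^+ 2)%:E)%E ;
  sk_semigroup : forall (y s : R) (p r : X), 0 < y -> 0 < s ->
    (\int[mu]_q (K y p q * K s q r)%:E = (K (y + s) p r)%:E)%E ;
  sk_derive : forall (y : R) (p q : X), 0 < y -> is_derive y 1 (fun t => K t p q) (K' y p q) ;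
  sk_derive_le : forall (y : R) (p q : X), 0 < y -> `|K' y p q| <= c / y * K (y / 2) p q ;
  sk_harnack : forall (y s : R) (p q : X), 0 < y -> y / 2 < s < 2 * y ->
    K s p q <= c * K (y / 2) p q }.

Section SmoothingSemigroup.
Context d (X : measurableType d) (R : realType).
Variable mu : {sigma_finite_measure set X -> \bar R}.
Variables (K K' : R -> X -> X -> R) (c : R).
Hypothesis HK : smoothing_kernel mu K K' c.
Implicit Types (f g : X -> R) (y s t M : R) (p q : X).

Local Notation opK y := (kernel_op mu (K y)).
Local Notation opK' y := (kernel_op mu (K' y)).

Let c0 : 0 <= c. Proof. exact: sk_cst HK. Qed.

Lemma sk_meas_section y : measurable_fun setT (fun z : X * X => K y z.1 z.2).
Proof. exact: (measurableT_comp (sk_meas HK) (measurable_pair1 y)). Qed.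

Lemma sk_meas'_section y : measurable_fun setT (fun z : X * X => K' y z.1 z.2).
Proof. exact: (measurableT_comp (sk_meas' HK) (measurable_pair1 y)). Qed.

Lemma kernel_le_mass y : 0 < y -> kernel_le mu (K y) c.
Proof.
move=> y0; split; first exact: sk_meas_section.
move=> p; under eq_integral do rewrite ger0_norm ?(sk_ge0 HK)//.
exact: sk_mass HK _ _ _.
Qed.

Lemma kernel_le_decay y : 0 < y -> kernel_le mu (K y) (c / y ^+ 2).
Proof.
move=> y0; split; first exact: sk_meas_section.
move=> p; under eq_integral do rewrite ger0_norm ?(sk_ge0 HK)//.
exact: sk_decay HK _ _ _.
Qed.

Lemma kernel_le_derive y : 0 < y -> kernel_le mu (K' y) (c / y * c).
Proof.
move=> y0; split; first exact: sk_meas'_section.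
move=> p; have y20 : 0 < y / 2 by rewrite divr_gt0.
have mK := kernel_le_section p (kernel_le_mass y20).
have K0 q : 0 <= K (y / 2) p q by exact: sk_ge0 HK _ _ _ _.
have cy0 : 0 <= c / y by rewrite divr_ge0 ?(ltW y0).
apply: (@le_trans _ _ (\int[mu]_q ((c / y)%:E * (K (y / 2) p q)%:E))%E).
  apply: ge0_le_integral => //=.
  - apply/measurable_EFinP; apply: measurableT_comp => //.
    exact: (measurableT_comp (sk_meas'_section y) (measurable_pair1 p)).
  - by apply: emeasurable_funM => //; exact/measurable_EFinP.
  - by move=> q _; rewrite -EFinM lee_fin; exact: sk_derive_le HK _ _ _ _.
rewrite ge0_integralZl ?lee_fin//.
- by rewrite (EFinM (c / y)) lee_wpmul2l ?lee_fin//; exact: sk_mass HK _ _ _.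
- exact/measurable_EFinP.
- by move=> q _; rewrite lee_fin.
Qed.

Lemma op_semigroup y s f M p : 0 < y -> 0 < s -> ess_bounded mu f M -> 0 <= M ->
  opK y (opK s f) p = opK (y + s) f p.
Proof.
move=> y0 s0 fM M0.
rewrite (@op_comp _ _ _ mu (K y) c (K s) c (K (y + s) p) f M)//.
- exact: kernel_le_mass.
- exact: kernel_le_mass.
- by move=> q; exact: sk_ge0 HK _ _ _ _.
- by move=> q r; exact: sk_ge0 HK _ _ _ _.
- by move=> r; exact: sk_semigroup HK _ _ _ _ _ _.
Qed.

(** The domination near y is by the kernel at y/4: [sk_derive_le] passes from t
   to t/2, and [sk_harnack] from t/2 to y/4. *)
Lemma is_derive_op f M y p : ess_bounded mu f M -> 0 <= M -> 0 < y ->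
  is_derive y 1 (fun t => opK t f p) (opK' y f p).
Proof.
move=> fM M0 y0.
pose F t q := K t p q * f q.
have dF t q : 0 < t -> is_derive t 1 (F ^~ q) (K' t p q * f q).
  move=> t0; rewrite (_ : F ^~ q = f q \*: (fun s : R => K s p q : R^o)).
    by rewrite mulrC; exact: is_deriveZ (sk_derive HK p q t0).
  by apply/funext => s; rewrite /F /= mulrC.
have y40 : 0 < y / 2 / 2 by rewrite !divr_gt0.
have It t : y / 2 < t < 2 * y -> 0 < t.
  by move=> /andP[+ _]; apply: lt_trans; rewrite divr_gt0.
apply: (@is_derive_Rintegral _ _ _ mu F (fun t q => K' t p q * f q)
  (fun q => 2 * c / y * c * `|K (y / 2 / 2) p q * f q|)) => //.
- move=> t /It t0; exact: (kernel_le_integrable p (kernel_le_mass t0) fM M0).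
- by move=> t q /It; exact: dF.
- have := integrable_norm (kernel_le_integrable p (kernel_le_mass y40) fM M0).
  by move=> /(integrableZl measurableT (2 * c / y * c)).
move=> t q tI; have t0 := It _ tI; have /andP[ty yt] := tI.
rewrite !normrM mulrA ler_wpM2r// (ger0_norm (sk_ge0 HK p q y40)).
have ty2 : y / 2 / 2 < t / 2 < 2 * (y / 2) by apply/andP; split; lra.
apply: le_trans (sk_derive_le HK p q t0) _.
have t20 : 0 < t / 2 by rewrite divr_gt0.
have K0 := sk_ge0 HK p q t20.
have Kle := sk_harnack HK p q (divr_gt0 y0 (ltr0n _ 2)) ty2.
apply: (@le_trans _ _ (2 * c / y * K (t / 2) p q)).
  rewrite ler_wpM2r// (mulrC 2) -mulrA ler_wpM2l// ler_pdivlMr// mulrC.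
  by rewrite ler_pdivrMr//; lra.
by rewrite -[leRHS]mulrA ler_wpM2l// divr_ge0 ?(ltW y0)// mulr_ge0.
Qed.

(** The j-th derivative of P_y f in y, written with bounded operators only: as
   P_y = P_(y/2) P_(y/2), differentiating the first factor and iterating on the
   second one gives d^(j+1) P_y = K'_(y/2) d^j P_(y/2). That this is indeed the
   derivative is proved in [is_derive_dP] and [derive1n_dP]. In this form
   bounds, measurability, linearity and Fubini are proved by induction on j,
   without differentiating under an integral sign each time. *)
Fixpoint dP (j : nat) (y : R) f : X -> R :=
  if j is i.+1 then opK' (y / 2) (dP i (y / 2) f) else opK y f.

(** Joint measurability in the point, in y and in a parameter of the function,
   as required by Fubini when the function is itself an integral. *)
Lemma measurable_dP_param d' (W : measurableType d') (G : W -> X -> R) j :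
  measurable_fun setT (fun z : W * X => G z.1 z.2) ->
  measurable_fun setT (fun z : (W * R) * X => dP j z.1.2 (G z.1.1) z.2).
Proof.
move=> mG; elim: j => [|j IH] /=.
  apply: (@measurable_op _ _ _ mu _ (W * R)%type
    (fun w => K w.2) (fun w => G w.1)).
    apply: (measurableT_comp (sk_meas HK)
      (g := fun z : (W * R) * (X * X) => (z.1.2, (z.2.1, z.2.2)))).
    by do !apply/measurable_fun_pair => /=; do ?apply: measurableT_comp.
  apply: (measurableT_comp mG (g := fun z : (W * R) * X => (z.1.1, z.2))).
  by do !apply/measurable_fun_pair => /=; do ?apply: measurableT_comp.
apply: (@measurable_op _ _ _ mu _ (W * R)%type
    (fun w => K' (w.2 / 2)) (fun w => dP j (w.2 / 2) (G w.1))).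
  apply: (measurableT_comp (sk_meas' HK)
    (g := fun z : (W * R) * (X * X) => (z.1.2 / 2, (z.2.1, z.2.2)))).
  do !apply/measurable_fun_pair => /=; do ?apply: measurableT_comp => //.
  apply: measurable_funM => //; exact: (measurableT_comp (f := snd) (g := fst)).
apply: (measurableT_comp IH
  (g := fun z : (W * R) * X => ((z.1.1, z.1.2 / 2), z.2))).
do !apply/measurable_fun_pair => /=; do ?apply: measurableT_comp => //.
apply: measurable_funM => //; exact: (measurableT_comp (f := snd) (g := fst)).
exact: measurable_snd.
Qed.

Lemma measurable_dP j y f : measurable_fun setT f -> measurable_fun setT (dP j y f).
Proof.
move=> mf; have := @measurable_dP_param _ R (fun=> f) j.
have mf' : measurable_fun setT (fun z : R * X => f z.2).
  exact: (measurableT_comp mf (g := snd)).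
move=> /(_ mf') h.
by have := measurableT_comp h (@measurable_pair1 _ _ (R * R)%type X (0, y)).
Qed.

(** Each derivative costs the norm (c / (y/2)) c of the operator with kernel
   K'_(y/2). *)
Lemma dP_bound j : exists2 A : R, 0 <= A & forall y f M p, 0 < y ->
  ess_bounded mu f M -> 0 <= M -> `|dP j y f p| <= A / y ^+ j * M.
Proof.
elim: j => [|j [A A0 IH]].
  exists c => // y f M p y0 fM M0; rewrite expr0 divr1.
  exact: op_bound (kernel_le_mass y0) fM M0.
exists (c * c * A * 2 ^+ j.+1); first by rewrite !mulr_ge0 ?exprn_ge0.
move=> y f M p y0 fM M0 /=.
have y20 : 0 < y / 2 by rewrite divr_gt0.
apply: le_trans (op_bound p (kernel_le_derive y20) (M := A / (y / 2) ^+ j * M) _ _) _.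
- apply: ess_boundedT; first by apply: measurable_dP; case: fM.
  by move=> q; exact: IH.
- by rewrite mulr_ge0// divr_ge0// exprn_ge0// ltW.
- rewrite le_eqVlt; apply/orP; left; apply/eqP.
  rewrite exprMn !exprS exprVn invfM !invrK; field.
  by rewrite !expf_neq0 ?gt_eqF.
Qed.

Lemma ess_bounded_dP j y f M : 0 < y -> ess_bounded mu f M -> 0 <= M ->
  exists2 N, 0 <= N & ess_bounded mu (dP j y f) N.
Proof.
move=> y0 fM M0; have [A A0 AP] := dP_bound j; exists (A / y ^+ j * M).
  by rewrite mulr_ge0// divr_ge0// exprn_ge0// ltW.
apply: ess_boundedT => [|q]; first by apply: measurable_dP; case: fM.
exact: AP.
Qed.

Lemma is_derive_op_under k c' (h h' : R -> X -> R) s N p : kernel_le mu k c' ->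
  0 < s -> 0 <= N ->
  (forall t, 0 < t -> exists2 N', 0 <= N' & ess_bounded mu (h t) N') ->
  (forall t q, 0 < t -> is_derive t 1 (h ^~ q : R -> R^o) (h' t q)) ->
  (forall t q, s / 2 < t -> `|h' t q| <= N) ->
  is_derive s 1 (fun t => kernel_op mu k (h t) p : R^o) (kernel_op mu k (h' s) p).
Proof.
move=> kc s0 N0 bh dh hN.
have It t : s / 2 < t < 2 * s -> 0 < t.
  by move=> /andP[+ _]; apply: lt_trans; rewrite divr_gt0.
apply: (@is_derive_Rintegral _ _ _ mu (fun t q => k p q * h t q)
  (fun t q => k p q * h' t q) (fun q => `|k p q * N|)) => //.
- by move=> t /It/bh[N' N'0 b]; exact: (kernel_le_integrable p kc b N'0).
- move=> t q /It t0; have := is_deriveZ (k p q) (dh t q t0); exact.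
- apply: integrable_norm; apply: (kernel_le_integrable p kc _ N0).
  by apply: ess_boundedT => // q; rewrite ger0_norm.
- by move=> t q /andP[st _]; rewrite !normrM ler_wpM2l// (ger0_norm N0) hN.
Qed.

(** If the semigroup law d^j P_(y+s) = P_y d^j P_s holds at order j, then near y
   the function d^j P_t f equals P_(t - y/2) (d^j P_(y/2) f), whose derivative
   is known from [is_derive_op]. This lets [dP_add] and [is_derive_dP] be proved
   by a single induction. *)
Let is_derive_dP_step j :
  (forall y s f M p, 0 < y -> 0 < s -> ess_bounded mu f M -> 0 <= M ->
    dP j (y + s) f p = opK y (dP j s f) p) ->
  forall y f M p, 0 < y -> ess_bounded mu f M -> 0 <= M ->
    is_derive y 1 (fun t => dP j t f p : R^o) (dP j.+1 y f p).
Proof.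
move=> H y f M p y0 fM M0 /=.
have y20 : 0 < y / 2 by rewrite divr_gt0.
have [N N0 gN] := ess_bounded_dP j y20 fM M0.
(* Near y, d^j P_t f = P_(t - y/2) (d^j P_(y/2) f). *)
have e : y + (- (y / 2)) = y / 2 by field.
have := is_derive_op p gN N0 y20; rewrite -{1}e => /is_derive_comp_addr.
apply: near_eq_is_derive.
near=> t; rewrite -(H _ _ _ M)//; first by rewrite subrK.
rewrite subr_gt0; near: t; apply: lt_nbhsr.
by rewrite ltr_pdivrMr// ltr_pMr// ltr1n.
Unshelve. all: by end_near. Qed.

(** By induction on j, differentiating in s the identity of order j: on the
   right the derivative passes under the operator P_y, since the derivatives of
   d^j P_t f are bounded for t > s/2. *)
Lemma dP_add j y s f M p : 0 < y -> 0 < s -> ess_bounded mu f M -> 0 <= M ->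
  dP j (y + s) f p = opK y (dP j s f) p.
Proof.
elim: j y s f M p => [|j IH] y s f M p y0 s0 fM M0.
  by rewrite /= (op_semigroup _ _ _ fM).
have [A A0 AP] := dP_bound j.+1.
have dIH := is_derive_dP_step IH.
have s2 : 0 < s / 2 by rewrite divr_gt0.
apply: (@is_derive_unique_gt0 _ (fun t => dP j (t + y) f p)
  (fun t => opK y (dP j t f) p) s) => //.
- by move=> t t0; rewrite addrC; apply: (IH _ _ _ M).
- apply: (@is_derive_comp_addr _ (fun t => dP j t f p)); rewrite addrC.
  by apply: (dIH _ _ M) => //; rewrite addr_gt0.
- apply: (@is_derive_op_under (K y) c (fun t => dP j t f) (fun t => dP j.+1 t f)
    s (A / (s / 2) ^+ j.+1 * M)) => //.
  + exact: kernel_le_mass.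
  + by rewrite mulr_ge0// divr_ge0// exprn_ge0// ltW.
  + by move=> t t0; exact: ess_bounded_dP fM M0.
  + by move=> t q t0; apply: (dIH _ _ M).
  + move=> t q st; have t0 : 0 < t by exact: lt_trans st.
    apply: le_trans (AP t f M q t0 fM M0) _.
    rewrite ler_wpM2r// ler_wpM2l// lef_pV2 ?posrE ?exprn_gt0//.
    by rewrite lerXn2r ?nnegrE ?ltW.
Qed.

Lemma is_derive_dP j y f M p : 0 < y -> ess_bounded mu f M -> 0 <= M ->
  is_derive y 1 (fun t => dP j t f p : R^o) (dP j.+1 y f p).
Proof.
apply: is_derive_dP_step => {}y s {}f {}M {}p y0 s0 fM M0.
by apply: (@dP_add _ _ _ _ M).
Qed.

(** By induction on j, differentiating in y the identity of order j. *)
Lemma dP_op j y s f M p : 0 < y -> 0 < s -> ess_bounded mu f M -> 0 <= M ->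
  dP j y (opK s f) p = dP j (y + s) f p.
Proof.
elim: j y s f M p => [|j IH] y s f M p y0 s0 fM M0.
  by rewrite /= (op_semigroup _ _ _ fM).
have [N N0 gN] : exists2 N, 0 <= N & ess_bounded mu (opK s f) N.
  exact: (@ess_bounded_dP 0 s f M).
apply: (@is_derive_unique_gt0 _ (fun t => dP j t (opK s f) p)
  (fun t => dP j (t + s) f p) y) => //.
- by move=> t t0; apply: (IH _ _ _ M).
- exact: is_derive_dP gN N0.
- apply: (@is_derive_comp_addr _ (fun t => dP j t f p)); apply: (@is_derive_dP _ _ _ M) => //.
  by rewrite addr_gt0.
Qed.

(** F is left free at t <= 0 because P_t is given by the kernel for t > 0 only;
   iterated derivatives at y > 0 are local. *)
Lemma derive1n_dP (F : R -> R^o) f M p j y : 0 < y -> ess_bounded mu f M ->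
  0 <= M -> (forall t, 0 < t -> F t = opK t f p) ->
  derive1n j F y = dP j y f p.
Proof.
move=> y0 fM M0 Ff; elim: j y y0 => [|j IH] y y0; first by rewrite derive1n0 Ff.
rewrite derive1nS derive1E.
apply: derive_val; apply: near_eq_is_derive (is_derive_dP j p y0 fM M0).
near=> t; rewrite IH//; near: t; exact: lt_nbhsr.
Unshelve. all: by end_near. Qed.

Lemma dPD j y f M g N p r : 0 < y -> ess_bounded mu f M -> 0 <= M ->
  ess_bounded mu g N -> 0 <= N ->
  dP j y (fun q => f q + r * g q) p = dP j y f p + r * dP j y g p.
Proof.
move=> + fM M0 gN N0; elim: j y p => [|j IH] y p y0 /=.
  exact: opD (kernel_le_mass y0) fM M0 gN N0.
have y20 : 0 < y / 2 by rewrite divr_gt0.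
have [M' M'0 fM'] := ess_bounded_dP j y20 fM M0.
have [N' N'0 gN'] := ess_bounded_dP j y20 gN N0.
rewrite -(opD _ _ (kernel_le_derive y20) fM' M'0 gN' N'0).
by congr kernel_op; apply/funext => q; rewrite IH.
Qed.

Lemma dP_integral d' (W : measurableType d')
    (nu : {sigma_finite_measure set W -> \bar R}) (G : W -> X -> R)
    (g : W -> R) j y p : 0 < y ->
  measurable_fun setT (fun z : W * X => G z.1 z.2) ->
  (forall w q, `|G w q| <= g w) -> nu.-integrable setT (EFin \o g) ->
  dP j y (fun q => \int[nu]_w G w q) p = \int[nu]_w dP j y (G w) p.
Proof.
move=> + mG Gg ig; elim: j y p => [|j IH] y p y0 /=.
  exact: op_integral (kernel_le_mass y0) mG Gg ig.
have y20 : 0 < y / 2 by rewrite divr_gt0.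
have [A A0 AP] := dP_bound j.
have bG w : ess_bounded mu (G w) (g w).
  by apply: ess_boundedT => //; exact: (measurableT_comp mG (measurable_pair1 w)).
have g0 w : 0 <= g w by exact: le_trans (Gg w p).
rewrite -(op_integral p (kernel_le_derive y20) _
  (g := fun w => A / (y / 2) ^+ j * g w)).
- by congr kernel_op; apply/funext => q; rewrite IH.
- apply: (measurableT_comp (measurable_dP_param j mG)
    (g := fun z : W * X => ((z.1, y / 2), z.2))).
  apply/measurable_fun_pair; last exact: measurable_snd.
  by apply/measurable_fun_pair; [exact: measurable_fst|exact: measurable_cst].
- by move=> w q; exact: AP.
- by have := integrableZl measurableT (A / (y / 2) ^+ j) ig.
Qed.

End SmoothingSemigroup.

(** * Improper integrals computed from a primitive *)
Section ImproperFTC.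
Context (R : realType).
Local Notation mu := (@lebesgue_measure R).

(** Monotone convergence along an increasing sequence of compact intervals, on
   each of which the fundamental theorem of calculus applies. *)
Lemma ge0_integral_exhaust (D : set R) (f F : R -> R) (u v : nat -> R) (l : R) :
  (forall n, u n < v n) -> nonincreasing_seq u -> nondecreasing_seq v ->
  D = \bigcup_n `[u n, v n]%classic ->
  (forall x, D x -> 0 <= f x) ->
  (forall x, D x -> {for x, continuous f}) ->
  (forall x : R, D x -> is_derive x 1 (F : R -> R^o) (f x)) ->
  F (v n) - F (u n) @[n --> \oo] --> l ->
  (\int[mu]_(x in D) (f x)%:E = l%:E)%E.
Proof.
move=> uv du iv DE f0 cf dF Fl.
have sub n : `[u n, v n]%classic `<=` D by rewrite DE => x xn; exists n.
have cfn n : {within `[u n, v n], continuous f}.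
  by apply: continuous_in_subspaceT => x; rewrite inE => xn; exact/cf/(sub n).
have mfn n : measurable_fun `[u n, v n] f.
  by apply: subspace_continuous_measurable_fun => //; exact: cfn.
have FTC n : (\int[mu]_(x in `[u n, v n]) (f x)%:E = (F (v n))%:E - (F (u n))%:E)%E.
  apply: continuous_FTC2 => //.
  - split.
    + by move=> x xn; have [] := dF x (sub n _ (subset_itv_oo_cc xn)).
    + apply: cvg_at_right_filter; apply: differentiable_continuous.
      apply/derivable1_diffP; have [] := dF (u n) => //.
      by apply: (sub n); rewrite /= in_itv/= lexx ltW.
    + apply: cvg_at_left_filter; apply: differentiable_continuous.
      apply/derivable1_diffP; have [] := dF (v n) => //.
      by apply: (sub n); rewrite /= in_itv/= lexx ltW.
  - move=> x xn; rewrite derive1E.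
    by have [_] := dF x (sub n _ (subset_itv_oo_cc xn)).
have := @ge0_nondecreasing_set_cvg_integral _ (measurableTypeR R) R
  (fun n => `[u n, v n]%classic) (EFin \o f) mu.
rewrite -DE => cv; apply: (@cvg_unique _ _ _ _ _ _ (cv _ _ _ _)) => //=.
- apply/nondecreasing_seqP => n; rewrite subsetEset; apply: subset_itv.
    by rewrite bnd_simp; exact: du.
  by rewrite bnd_simp; exact: iv.
- by move=> n; apply/measurable_EFinP; exact: mfn.
- by move=> n x xn; rewrite lee_fin; exact/f0/(sub n).
- under eq_fun do rewrite FTC -EFinB.
  by apply: cvg_EFin; [exact: nearW|exact: Fl].
Qed.

Lemma ge0_integral_oo (f F : R -> R) (a b A B : R) : a < b ->
  (forall x, a < x < b -> 0 <= f x) ->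
  (forall x, a < x < b -> {for x, continuous f}) ->
  (forall x : R, a < x < b -> is_derive x 1 (F : R -> R^o) (f x)) ->
  F x @[x --> a^'+] --> A -> F x @[x --> b^'-] --> B ->
  (\int[mu]_(x in `]a, b[) (f x)%:E = (B - A)%:E)%E.
Proof.
move=> ab f0 cf dF FA FB.
have inab x : `]a, b[%classic x -> a < x < b by rewrite /= in_itv.
pose w (n : nat) := (b - a) / 2 * harmonic n.+1.
have w0 n : 0 < w n by rewrite /w mulr_gt0// ?harmonic_gt0// divr_gt0// subr_gt0.
have wE n : w n < (b - a) / 2.
  rewrite /w gtr_pMr ?divr_gt0 ?subr_gt0//.
  by rewrite /harmonic/= invf_lt1// ltr1n.
have dw n : w n.+1 <= w n.
  rewrite ler_wpM2l// ?divr_ge0 ?subr_ge0 ?(ltW ab)//.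
  by rewrite /harmonic/= lef_pV2 ?posrE// ler_nat.
have w_cvg : w n @[n --> \oo] --> 0.
  rewrite -(mulr0 ((b - a) / 2)); apply: cvgM; first exact: cvg_cst.
  by have := @cvg_harmonic R; rewrite -cvg_shiftS.
apply: (@ge0_integral_exhaust _ _ F (fun n => a + w n) (fun n => b - w n)).
- by move=> n; have := wE n; lra.
- by apply/nonincreasing_seqP => n; rewrite lerD2l.
- by apply/nondecreasing_seqP => n; rewrite lerD2l lerN2.
- apply/seteqP; split=> [x|x [n _]] /=; rewrite !in_itv/=; last first.
    by have := w0 n; move=> ? /andP[? ?]; apply/andP; split; lra.
  move=> /andP[ax xb].
  have m0 : 0 < Num.min (x - a) (b - x) by rewrite lt_min !subr_gt0 ax.
  have [N _ NP] : \forall n \near \oo, w n <= Num.min (x - a) (b - x).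
    have /cvgrPdist_le/(_ _ m0) := w_cvg; apply: filterS => n.
    by rewrite sub0r normrN ger0_norm// ltW.
  exists N => //=; have /= := NP N (leqnn N); rewrite le_min in_itv/=.
  by move=> /andP[? ?]; apply/andP; split; lra.
- by move=> x xab; exact: (f0 _ (inab _ xab)).
- by move=> x xab; exact: (cf _ (inab _ xab)).
- apply: cvgB.
    move/cvg_at_leftP : FB; apply; split => [n|]; first by rewrite ltrBlDr ltrDl.
    by rewrite -[X in _ --> X]subr0; apply: cvgB => //; exact: cvg_cst.
  move/cvg_at_rightP : FA; apply; split => [n|]; first by rewrite ltrDl.
  by rewrite -[X in _ --> X]addr0; apply: cvgD => //; exact: cvg_cst.
Qed.

Lemma ge0_integral_oy (f F : R -> R) (a A B : R) :
  (forall x, a < x -> 0 <= f x) ->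
  (forall x, a < x -> {for x, continuous f}) ->
  (forall x : R, a < x -> is_derive x 1 (F : R -> R^o) (f x)) ->
  F x @[x --> a^'+] --> A -> F x @[x --> +oo] --> B ->
  (\int[mu]_(x in `]a, +oo[) (f x)%:E = (B - A)%:E)%E.
Proof.
move=> f0 cf dF FA FB.
have inab x : `]a, +oo[%classic x -> a < x by rewrite /= in_itv/= andbT.
pose h (n : nat) : R := harmonic n.
have h0 n : 0 < h n by exact: harmonic_gt0.
have h1 n : h n <= 1 by rewrite /h/= invf_le1// ler1n.
have h_cvg : h n @[n --> \oo] --> 0 by exact: cvg_harmonic.
apply: (@ge0_integral_exhaust _ _ F (fun n => a + h n) (fun n => a + n.+2%:R)).
- move=> n; rewrite ltrD2l (le_lt_trans (h1 n))// ltr1n//.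
- by apply/nonincreasing_seqP => n; rewrite lerD2l /h/= lef_pV2 ?posrE// ler_nat.
- by apply/nondecreasing_seqP => n; rewrite lerD2l ler_nat.
- apply/seteqP; split=> [x|x [n _]] /=; rewrite !in_itv/= andbT; last first.
    by have := h0 n; move=> ? /andP[? ?]; lra.
  move=> ax; have m0 : 0 < x - a by rewrite subr_gt0.
  have [N _ NP] : \forall n \near \oo, h n <= x - a.
    have /cvgrPdist_le/(_ _ m0) := h_cvg; apply: filterS => n.
    by rewrite sub0r normrN ger0_norm// ltW.
  have [N' _ N'P] : \forall n \near \oo, x - a <= n%:R by exact: nbhs_infty_ger.
  exists (maxn N N') => //=; rewrite in_itv/=.
  have /= := NP (maxn N N') (leq_maxl _ _); have /= := N'P (maxn N N') (leq_maxr _ _).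
  move=> h2 h3; apply/andP; split; first lra.
  by rewrite -lerBlDl (le_trans h2)// ler_nat ltnW// ltnW.
- by move=> x xab; exact: (f0 _ (inab _ xab)).
- by move=> x xab; exact: (cf _ (inab _ xab)).
- by move=> x xab; exact: (dF _ (inab _ xab)).
- apply: cvgB.
    have /cvg_pinftyP FB' := FB; apply: (FB' (fun n => a + n.+2%:R)).
    apply/cvgryPge => r; near=> n; rewrite -lerBlDl.
    apply: (@le_trans _ _ n%:R); last by rewrite ler_nat ltnW// ltnW.
    by near: n; exact: nbhs_infty_ger.
  move/cvg_at_rightP : FA; apply; split => [n|]; first by rewrite ltrDl.
  rewrite -[X in _ --> X]addr0; by apply: cvgD => //; exact: cvg_cst.
Unshelve. all: by end_near. Qed.

End ImproperFTC.

Section PowerIntegrals.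
Context (R : realType).
Local Notation mu := (@lebesgue_measure R).

Lemma cvg_powRN_y (g : R) : 0 < g -> x `^ (- g) @[x --> +oo] --> (0 : R).
Proof.
move=> g0; apply/cvgrPdist_le => e e0; near=> x.
have x0 : 0 < x by near: x; exact: nbhs_pinfty_gt.
have ex : e^-1 `^ g^-1 <= x by near: x; exact: nbhs_pinfty_ge.
rewrite sub0r normrN ger0_norm ?powR_ge0// powRN invf_ple ?posrE ?powR_gt0//.
have := ge0_ler_powR (ltW g0) _ _ ex; rewrite !nnegrE powR_ge0 (ltW x0) => /(_ isT isT).
by rewrite -powRrM mulVf ?gt_eqF// powRr1// invr_ge0 ltW.
Unshelve. all: by end_near. Qed.

Lemma cvg_invr_y : x^-1 @[x --> +oo] --> (0 : R).
Proof.
apply: cvg_trans (cvg_powRN_y ltr01); apply: near_eq_cvg; near=> x.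
by rewrite powR_inv1//; near: x; exact: nbhs_pinfty_ge.
Unshelve. all: by end_near. Qed.

Lemma is_derive_continuous (F : R -> R) (x a : R) :
  is_derive x 1 (F : R -> R^o) a -> {for x, continuous F}.
Proof.
by move=> dF; apply: differentiable_continuous; apply/derivable1_diffP; case: dF.
Qed.

Lemma is_derive_powR_addr (y g x : R) : 0 < x + y ->
  is_derive x 1 (fun t : R => (t + y) `^ g : R^o) (g * (x + y) `^ (g - 1)).
Proof.
move=> xy.
have := @is_derive_comp_addr R (fun t => t `^ g) x y _ (is_derive1_powR g xy); exact.
Qed.

Lemma continuous_powR_addr (y g x : R) : 0 < x + y ->
  {for x, continuous (fun t : R => (t + y) `^ g)}.
Proof.
by move=> xy; exact: is_derive_continuous (is_derive_powR_addr g xy).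
Qed.

Lemma integral_powR01 (g : R) : 0 < g ->
  (\int[mu]_(x in `]0%R, 1%R[) (x `^ (g - 1))%:E = (g^-1)%:E)%E.
Proof.
move=> g0; rewrite (_ : g^-1 = g^-1 - 0); last by rewrite subr0.
apply: (@ge0_integral_oo _ _ (fun x => g^-1 * x `^ g)).
- exact: ltr01.
- by move=> x _; exact: powR_ge0.
- move=> x /andP[x0 _]; exact: is_derive_continuous (is_derive1_powR (g - 1) x0).
- move=> x /andP[x0 _].
  have := is_deriveZ g^-1 (is_derive1_powR g x0).
  by rewrite /GRing.scale/= mulrA mulVf ?gt_eqF// mul1r; exact.
- rewrite -[X in _ --> X](mulr0 g^-1); apply: cvgM; first exact: cvg_cst.
  exact: powR_cvg0.
- rewrite -[X in _ --> X]mulr1; apply: cvgM; first exact: cvg_cst.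
  rewrite -[X in _ --> X](_ : 1 `^ g = 1); last by rewrite powR1.
  apply: cvg_at_left_filter.
  exact: is_derive_continuous (is_derive1_powR g ltr01).
Qed.

Lemma integral_powR_addr (y g : R) : 0 < g -> 0 < y ->
  (\int[mu]_(x in `]0%R, +oo[) ((x + y) `^ (- g - 1))%:E = (y `^ (- g) / g)%:E)%E.
Proof.
move=> g0 y0.
pose F x : R := - (g^-1 * (x + y) `^ (- g)).
rewrite (_ : _ / g = 0 - F 0); last by rewrite sub0r opprK add0r mulrC.
apply: (@ge0_integral_oy _ _ F).
- by move=> x _; exact: powR_ge0.
- by move=> x x0; apply: continuous_powR_addr; rewrite addr_gt0.
- move=> x x0.
  have xy : 0 < x + y by rewrite addr_gt0.
  have := is_deriveN (is_deriveZ g^-1 (is_derive_powR_addr (- g) xy)).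
  by rewrite /GRing.scale/= mulNr mulrN opprK mulrA mulVf ?gt_eqF// mul1r; exact.
- apply: cvg_at_right_filter; apply: cvgN; apply: cvgM; first exact: cvg_cst.
  by apply: continuous_powR_addr; rewrite add0r.
- rewrite -[X in _ --> X]oppr0 -[X in _ --> - X](mulr0 g^-1).
  apply: cvgN; apply: cvgM; first exact: cvg_cst.
  apply: (@cvg_comp _ _ _ (fun x : R => x + y) (fun x => x `^ (- g)) _ (@pinfty_nbhs R)).
    exact: cvg_addrr.
  exact: cvg_powRN_y.
Qed.

Lemma integral_sqrV_tail (T : R) : 0 < T ->
  (\int[mu]_(x in `]T, +oo[) ((x ^+ 2)^-1)%:E = (T^-1)%:E)%E.
Proof.
move=> T0; pose F (x : R) : R := - x^-1.
rewrite (_ : T^-1 = 0 - F T); last by rewrite /F sub0r opprK.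
have dV (x : R) : 0 < x -> is_derive x 1 (fun t : R => t^-1 : R^o) (- (x ^+ 2)^-1).
  move=> x0; have := @is_deriveV _ id x 1 1 _ (is_derive_id _ _).
  by rewrite /= /GRing.scale/= mulr1; apply; exact: lt0r_neq0.
have dF (x : R) : 0 < x -> is_derive x 1 (F : R -> R^o) (x ^+ 2)^-1.
  by move=> x0; have := is_deriveN (dV x x0); rewrite opprK; exact.
apply: (@ge0_integral_oy _ _ F).
- by move=> x _; rewrite invr_ge0 sqr_ge0.
- move=> x Tx; have x0 := lt_trans T0 Tx.
  apply: cvgV; first by rewrite expf_neq0// gt_eqF.
  exact: exprn_continuous.
- by move=> x Tx; apply: dF; exact: lt_trans Tx.
- apply: cvg_at_right_filter; exact: is_derive_continuous (dF T T0).
- by rewrite -[X in _ --> X]oppr0; apply: cvgN; exact: cvg_invr_y.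
Qed.

End PowerIntegrals.

(** * Second differences *)
Section SecondDifference.
Context (R : realType).
Implicit Types (h : R -> R) (s t M : R).
Local Notation leb := (@lebesgue_measure R).

Lemma measurable_invr : measurable_fun setT (fun x : R => x^-1).
Proof.
rewrite (_ : (fun x : R => x^-1) = fun x => x * (x ^+ 2) `^ (-1)).
  apply: measurable_funM => //.
  apply: (measurableT_comp (@measurable_powR R (-1)) (g := fun x : R => x ^+ 2)).
  exact: measurable_funX.
apply/funext => x; rewrite powR_inv1 ?sqr_ge0//.
have [->|x0] := eqVneq x 0; first by rewrite invr0 mul0r.
by rewrite expr2 invfM mulrA divff// mul1r.
Qed.

Definition diff2 h s t : R := h (s + 2 * t) - 2 * h (s + t) + h s.

(** Mean value inequality. *)
Lemma is_derive_lipschitz (h h' : R -> R) a b M : a <= b ->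
  (forall x : R, a <= x <= b -> is_derive x 1 (h : R -> R^o) (h' x)) ->
  (forall x, a <= x <= b -> `|h' x| <= M) -> `|h b - h a| <= M * (b - a).
Proof.
rewrite le_eqVlt => /predU1P[<- _ _|ab dh hM].
  by rewrite !subrr normr0 mulr0.
have dho (x : R) : x \in `]a, b[%R -> is_derive x 1 (h : R -> R^o) (h' x).
  by rewrite in_itv/= => /andP[ax xb]; apply: dh; rewrite !ltW.
have ch : {within `[a, b], continuous h}.
  apply: continuous_in_subspaceT => x; rewrite inE/= in_itv/= => xab.
  exact: is_derive_continuous (dh x xab).
have [x xab ->] := MVT ab dho ch.
rewrite normrM (gtr0_norm (_ : 0 < b - a)) ?subr_gt0// ler_wpM2r ?subr_ge0 ?(ltW ab)//.
by apply: hM; move: xab; rewrite in_itv/= => /andP[ax xb]; rewrite !ltW.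
Qed.

(** The second difference is the increment over [s, s + t] of r |-> h(r + t) - h(r),
   whose derivative is an increment of h'; the mean value inequality is applied
   twice. *)
Lemma norm_diff2_le (h h' h'' : R -> R) s t M : 0 <= t ->
  (forall x : R, s <= x -> is_derive x 1 (h : R -> R^o) (h' x)) ->
  (forall x : R, s <= x -> is_derive x 1 (h' : R -> R^o) (h'' x)) ->
  (forall x, s <= x -> `|h'' x| <= M) -> `|diff2 h s t| <= M * t ^+ 2.
Proof.
move=> t0 dh dh' hM.
have -> : diff2 h s t = (h (s + t + t) - h (s + t)) - (h (s + t) - h s).
  by rewrite /diff2 (_ : s + 2 * t = s + t + t); ring.
have := @is_derive_lipschitz (fun r => h (r + t) - h r)
  (fun r => h' (r + t) - h' r) s (s + t) (M * t).
rewrite /= (_ : M * t * _ = M * t ^+ 2); last by ring.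
apply; first by rewrite lerDl.
  move=> x /andP[sx _].
  have sxt : s <= x + t by rewrite ler_wpDr.
  exact: (is_deriveB (is_derive_comp_addr (dh _ sxt)) (dh x sx)).
move=> x /andP[sx _]; have := @is_derive_lipschitz h' h'' x (x + t) M.
rewrite (_ : x + t - x = t); last by ring.
apply; first by rewrite lerDl.
  by move=> z /andP[xz _]; apply: dh'; exact: le_trans xz.
by move=> z /andP[xz _]; apply: hM; exact: le_trans xz.
Qed.

Lemma norm_diff2_le4 h s t M : 0 <= t ->
  (forall x, s <= x -> `|h x| <= M) -> `|diff2 h s t| <= 4 * M.
Proof.
move=> t0 hM; have h1 := hM s (lexx s).
have h2 : `|h (s + t)| <= M by apply: hM; rewrite lerDl.
have h3 : `|h (s + 2 * t)| <= M by apply: hM; rewrite lerDl mulr_ge0.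
rewrite /diff2 (le_trans (ler_normD _ _))//.
rewrite (le_trans (lerD (ler_normB _ _) (lexx _)))//.
rewrite normrM (ger0_norm (ler0n _ 2)); lra.
Qed.

(** The integral over (0, T] is at most T M2 and the one over (T, oo) at most
   4 M0 \int_T^oo t^-2 dt. The parameter T is chosen later, as a function of s;
   the optimal choice is of order sqrt(M0 / M2). *)
Lemma integral_min_le M2 M0 (T : R) : 0 <= M2 -> 0 <= M0 -> 0 < T ->
  (\int[leb]_(t in `]0%R, +oo[) (Num.min M2 (4 * M0 * (t ^+ 2)^-1))%:E
    <= (T * M2 + 4 * M0 / T)%:E)%E.
Proof.
move=> M20 M00 T0.
pose m t := Num.min M2 (4 * M0 * (t ^+ 2)^-1).
have mV : measurable_fun setT (fun t : R => (t ^+ 2)^-1).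
  apply: (measurableT_comp measurable_invr (g := fun t : R => t ^+ 2)).
  exact: measurable_funX.
have m4 : measurable_fun setT (fun t : R => 4 * M0 * (t ^+ 2)^-1).
  exact: measurable_funM.
have mm : measurable_fun setT m by exact: measurable_minr.
have m0 t : 0 <= m t.
  by rewrite /m le_min M20/= mulr_ge0 ?invr_ge0 ?sqr_ge0// mulr_ge0.
rewrite (@itv_bndbnd_setU _ _ _ (BRight T)) ?bnd_simp ?(ltW T0)//.
rewrite ge0_integral_setU//=; last 3 first.
- by apply/measurable_EFinP; exact: measurable_funTS.
- by move=> t _; rewrite lee_fin; exact: m0.
- rewrite disj_set2E; apply/eqP/seteqP; split => // t /= [].
  by rewrite !in_itv/= => /andP[_ tT] /andP[+ _]; rewrite ltNge tT.
rewrite EFinD; apply: leeD.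
  apply: (@le_trans _ _ (\int[leb]_(t in `]0%R, T]) M2%:E)%E).
    apply: ge0_le_integral => //=.
    - by move=> t _; rewrite lee_fin; exact: m0.
    - by apply/measurable_EFinP; exact: measurable_funTS.
    - by move=> t _; rewrite lee_fin /m ge_min lexx.
  rewrite integral_cst//= lebesgue_measure_itv/= lte_fin T0 -EFinD -EFinM subr0.
  by rewrite mulrC.
apply: (@le_trans _ _ (\int[leb]_(t in `]T, +oo[) ((4 * M0)%:E * ((t ^+ 2)^-1)%:E))%E).
  apply: ge0_le_integral => //=.
  - by move=> t _; rewrite lee_fin; exact: m0.
  - by apply/measurable_EFinP; exact: measurable_funTS.
  - by apply/measurable_EFinP; exact: measurable_funTS.
  - by move=> t _; rewrite -EFinM lee_fin /m ge_min lexx orbT.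
rewrite ge0_integralZl//=; last 3 first.
- by apply/measurable_EFinP; exact: measurable_funTS.
- by move=> t _; rewrite lee_fin invr_ge0 sqr_ge0.
- by rewrite lee_fin mulr_ge0.
by rewrite integral_sqrV_tail.
Qed.

End SecondDifference.

(** * The multiplier as a double integral *)
Section Decay.
Context (R : realType).
Local Notation leb := (@lebesgue_measure R).

(** The bound min(1, s^-2) for P_s. *)
Definition decay (s : R) : R := if s <= 1 then 1 else (s ^+ 2)^-1.

Lemma decay_ge0 s : 0 <= decay s.
Proof. by rewrite /decay; case: ifP => // _; rewrite invr_ge0 sqr_ge0. Qed.

Lemma decay_le1 s : decay s <= 1.
Proof.
rewrite /decay; case: ifPn => //; rewrite -ltNge => s1.
by rewrite invf_le1 ?exprn_gt0 ?(lt_trans ltr01)// exprn_ege1// ltW.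
Qed.

Lemma decay_le s t : s <= t -> decay t <= decay s.
Proof.
move=> st; rewrite {2}/decay; case: ifPn => s1; first exact: decay_le1.
move: s1; rewrite -ltNge => s1.
rewrite /decay [t <= 1]leNgt (lt_le_trans s1 st) /=; have s0 : 0 < s by rewrite (lt_trans ltr01).
rewrite lef_pV2 ?posrE ?exprn_gt0// ?(lt_le_trans s0)//.
by rewrite lerXn2r// nnegrE ltW// (lt_le_trans s0).
Qed.

Lemma measurable_decay : measurable_fun setT decay.
Proof.
apply: measurable_fun_ifT => //.
  by apply: measurable_fun_ler.
apply: (measurableT_comp (@measurable_invr R) (g := fun t : R => t ^+ 2)).
exact: measurable_funX.
Qed.

Lemma integral_split1 (h1 h2 : R -> R) (I1 I2 : R) :
  measurable_fun setT h1 -> measurable_fun setT h2 ->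
  (forall s, 0 <= h1 s) -> (forall s, 0 <= h2 s) ->
  (\int[leb]_(s in `]0%R, 1%R[) (h1 s)%:E <= I1%:E)%E ->
  (\int[leb]_(s in `]1%R, +oo[) (h2 s)%:E <= I2%:E)%E ->
  (\int[leb]_(s in `]0%R, +oo[) (if s <= 1 then h1 s else h2 s)%:E
     <= (I1 + I2)%:E)%E.
Proof.
move=> mh1 mh2 h10 h20 hI1 hI2.
pose h s := if s <= 1 then h1 s else h2 s.
have mh : measurable_fun setT h.
  by apply: measurable_fun_ifT => //; exact: measurable_fun_ler.
have h0 s : 0 <= h s by rewrite /h; case: ifP.
rewrite (@itv_bndbnd_setU _ _ _ (BRight 1)) ?bnd_simp//.
rewrite ge0_integral_setU//=; last 3 first.
- by apply/measurable_EFinP; exact: measurable_funTS.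
- by move=> t _; rewrite lee_fin; exact: h0.
- rewrite disj_set2E; apply/eqP/seteqP; split => // t /= [].
  by rewrite !in_itv/= => /andP[_ tT] /andP[+ _]; rewrite ltNge tT.
rewrite EFinD; apply: leeD.
  rewrite -integral_itv_bndo_bndc; last first.
    by apply/measurable_EFinP; exact: measurable_funTS.
  apply: le_trans hI1; rewrite le_eqVlt; apply/orP; left; apply/eqP.
  apply: eq_integral => s; rewrite inE/= in_itv/= => /andP[_ s1].
  by rewrite ltW.
apply: le_trans hI2; rewrite le_eqVlt; apply/orP; left; apply/eqP.
apply: eq_integral => s; rewrite inE/= in_itv/= => /andP[s1 _].
by rewrite leNgt s1.
Qed.

Lemma integral_decay : (\int[leb]_(s in `]0%R, +oo[) (decay s)%:E <= 2%:E)%E.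
Proof.
rewrite (_ : 2 = 1 + 1 :> R)//; apply: (@integral_split1 (fun=> 1) (fun s => (s ^+ 2)^-1)) => //.
- apply: (measurableT_comp (@measurable_invr R) (g := fun t : R => t ^+ 2)).
  exact: measurable_funX.
- by move=> s; rewrite invr_ge0 sqr_ge0.
- by rewrite integral_cst//= lebesgue_measure_itv/= lte_fin ltr01 mul1e sube0.
- by rewrite integral_sqrV_tail// invr1.
Qed.

End Decay.
Arguments decay {R} s.

Section MultiplierFormula.
Context d (X : measurableType d) (R : realType).
Variable mu : {sigma_finite_measure set X -> \bar R}.
Variables (K K' : R -> X -> X -> R) (c : R).
Hypothesis HK : smoothing_kernel mu K K' c.
Variable P : R -> (X -> R) -> X -> R.
Hypothesis PE : forall (y : R) f M p, 0 < y -> ess_bounded mu f M -> 0 <= M ->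
  P y f p = kernel_op mu (K y) f p.
Variables (a : R -> R) (Ma : R).
Hypothesis ma : measurable_fun (`[0, +oo[ : set R) a.
Hypothesis a_le : forall s, 0 <= s -> `|a s| <= Ma.
Variables (f : X -> R) (F : R).
Hypothesis fF : ess_bounded mu f F.
Hypothesis F0 : 0 <= F.
Implicit Types (s t y : R) (p : X) (j : nat).
Local Notation leb := (@lebesgue_measure R).
Local Notation phi j y := (dP mu K K' j y f).
Local Notation u := (laplace_avg P a f).

Let c0 : 0 <= c. Proof. exact: sk_cst HK. Qed.
Let Ma0 : 0 <= Ma. Proof. exact: le_trans (a_le (lexx 0)). Qed.
Let mf : measurable_fun setT f. Proof. by case: fF. Qed.

Definition cutoff (g : R -> R) : R -> R := g \_ `]0, +oo[%classic.

Lemma cutoff_gt0 g s : 0 < s -> cutoff g s = g s.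
Proof. by move=> s0; rewrite /cutoff patchE mem_set//= in_itv/= s0. Qed.

Lemma cutoff_le0 g s : s <= 0 -> cutoff g s = 0.
Proof.
move=> s0; rewrite /cutoff patchE memNset//= in_itv/= andbT.
by apply/negP; rewrite -leNgt.
Qed.

Lemma measurable_cutoff (g : R -> R) :
  measurable_fun (`]0, +oo[%classic : set R) g ->
  measurable_fun setT (cutoff g).
Proof. by move=> mg; rewrite /cutoff; apply: (measurable_restrictT g _).1. Qed.

Lemma measurable_cutoff_a : measurable_fun setT (cutoff a).
Proof.
apply: measurable_cutoff; apply: measurable_funS ma => //.
by move=> x /=; rewrite !in_itv/= !andbT; exact: ltW.
Qed.

Lemma cutoff_a_le s : `|cutoff a s| <= Ma.
Proof.
have [s0|s0] := leP s 0; first by rewrite cutoff_le0 ?normr0.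
by rewrite cutoff_gt0// a_le// ltW.
Qed.

Lemma measurable_phi j (g : X -> R) : measurable_fun setT g ->
  measurable_fun setT (fun z : R * X => dP mu K K' j z.1 g z.2).
Proof.
move=> mg; have mg' : measurable_fun setT (fun z : R * X => g z.2).
  exact: (measurableT_comp mg (g := snd)).
have mz : measurable_fun setT (fun z : R * X => ((0 : R, z.1), z.2)).
  apply: measurable_fun_pair; last exact: measurable_snd.
  by apply: measurable_fun_pair; [exact: measurable_cst|exact: measurable_fst].
by have := measurableT_comp (measurable_dP_param HK (W := R) (G := fun=> g) j mg') mz.
Qed.

Lemma phi0_decay s p : 0 < s -> `|phi 0 s p| <= c * F * decay s.
Proof.
move=> s0; rewrite /decay; case: ifPn => _.
  by rewrite mulr1; exact: op_bound (kernel_le_mass HK s0) fF F0.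
by rewrite mulrAC; exact: op_bound (kernel_le_decay HK s0) fF F0.
Qed.

Definition avg_majorant s : R := Ma * (c * F) * cutoff decay s.

Lemma avg_majorant_ge0 s : 0 <= avg_majorant s.
Proof.
rewrite /avg_majorant mulr_ge0 ?mulr_ge0//.
have [s0|s0] := leP s 0; first by rewrite cutoff_le0.
by rewrite cutoff_gt0// decay_ge0.
Qed.

Lemma measurable_cutoff_decay : measurable_fun setT (cutoff decay).
Proof. by apply: measurable_cutoff; apply: measurable_funTS; exact: measurable_decay. Qed.

Lemma integral_avg_majorant : (\int[leb]_s (avg_majorant s)%:E <= (Ma * (c * F) * 2)%:E)%E.
Proof.
rewrite /avg_majorant; under eq_integral do rewrite EFinM.
rewrite ge0_integralZl//=; last 3 first.
- by apply/measurable_EFinP; exact: measurable_cutoff_decay.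
- move=> s _; rewrite lee_fin; have [s0|s0] := leP s 0; first by rewrite cutoff_le0.
  by rewrite cutoff_gt0// decay_ge0.
- by rewrite lee_fin !mulr_ge0.
rewrite (EFinM (Ma * _)) lee_wpmul2l ?lee_fin ?mulr_ge0//.
by apply: le_trans (@integral_decay R); rewrite [leRHS]integral_mkcond restrict_EFin.
Qed.

Lemma integrable_avg_majorant : leb.-integrable setT (EFin \o avg_majorant).
Proof.
apply: (le_integral_integrable measurableT _ _ _ integral_avg_majorant).
- by apply: measurable_funM => //; exact: measurable_cutoff_decay.
- by apply: measurable_funM => //; exact: measurable_cutoff_decay.
- by move=> s _; rewrite ger0_norm// avg_majorant_ge0.
Qed.

Lemma avg_le y s p : 0 <= y -> `|cutoff a s * phi 0 (y + s) p| <= avg_majorant s.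
Proof.
move=> y0; have [s0|s0] := leP s 0.
  by rewrite (cutoff_le0 a)// mul0r normr0 avg_majorant_ge0.
rewrite normrM /avg_majorant -mulrA (cutoff_gt0 decay)//.
apply: ler_pM => //; first exact: cutoff_a_le.
apply: le_trans (phi0_decay p _) _; first by rewrite ltr_wpDl.
by rewrite ler_wpM2l ?mulr_ge0// decay_le// lerDr.
Qed.

Lemma measurable_avg y p : measurable_fun setT (fun s => cutoff a s * phi 0 (y + s) p).
Proof.
apply: measurable_funM; first exact: measurable_cutoff_a.
apply: (measurableT_comp (measurable_phi 0 mf) (g := fun s : R => (y + s, p))).
by apply: measurable_fun_pair => //; exact: measurable_funD.
Qed.

Lemma integrable_avg y p : 0 <= y ->
  leb.-integrable setT (EFin \o (fun s => cutoff a s * phi 0 (y + s) p)).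
Proof.
move=> y0; apply: (le_integrable measurableT _ _ integrable_avg_majorant) => /=.
  by apply/measurable_EFinP; exact: measurable_avg.
move=> s _; rewrite lee_fin (ger0_norm (avg_majorant_ge0 s)); exact: avg_le.
Qed.

(** The integrals over (0, oo) are replaced by integrals over the whole line of
   functions cut off at 0, to which Fubini's theorem is applied. *)
Lemma laplace_avgE p : u p = \int[leb]_s (cutoff a s * phi 0 (0 + s) p).
Proof.
rewrite /laplace_avg Rintegral_mkcond; apply: eq_Rintegral => s _; rewrite patchE.
case: ifPn => [|/negP]; rewrite ?inE/= in_itv/= andbT => s0.
  by rewrite cutoff_gt0// add0r (PE _ s0 fF F0) mulrC.
by rewrite cutoff_le0 ?mul0r// leNgt; exact/negP.
Qed.

Lemma laplace_avg_le p : `|u p| <= Ma * (c * F) * 2.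
Proof.
rewrite laplace_avgE; apply: norm_Rintegral_le => //; first exact: measurable_avg.
apply: le_trans integral_avg_majorant; apply: ge0_le_integral => //=.
- by do 2 apply: measurableT_comp => //; exact: measurable_avg.
- exact: (measurable_int _ integrable_avg_majorant).
- by move=> s _; rewrite lee_fin; exact: avg_le.
Qed.

Lemma measurable_avg2 : measurable_fun setT
  (fun z : R * X => cutoff a z.1 * phi 0 (0 + z.1) z.2).
Proof.
apply: measurable_funM.
  exact: (measurableT_comp measurable_cutoff_a (g := fst)).
apply: (measurableT_comp (measurable_phi 0 mf)
  (g := fun z : R * X => (0 + z.1, z.2))).
apply: measurable_fun_pair; last exact: measurable_snd.
by apply: measurable_funD => //; exact: measurable_fst.
Qed.

Lemma measurable_laplace_avg : measurable_fun setT u.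
Proof.
rewrite (_ : laplace_avg P a f =
  fun p => \int[leb]_s (cutoff a s * phi 0 (0 + s) p)).
  apply: (@measurable_Rintegral _ _ X _ _ leb
    (fun z : X * R => cutoff a z.2 * phi 0 (0 + z.2) z.1)).
  apply: (measurableT_comp measurable_avg2 (g := fun z : X * R => (z.2, z.1))).
  by apply: measurable_fun_pair; [exact: measurable_snd|exact: measurable_fst].
by apply/funext => p; rewrite laplace_avgE.
Qed.

Lemma ess_bounded_laplace_avg : ess_bounded mu u (Ma * (c * F) * 2).
Proof. exact: ess_boundedT measurable_laplace_avg laplace_avg_le. Qed.

Lemma dPZ j y (g : X -> R) N r p : 0 < y -> ess_bounded mu g N -> 0 <= N ->
  dP mu K K' j y (fun q => r * g q) p = r * dP mu K K' j y g p.
Proof.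
move=> y0 gN N0; have z0 : ess_bounded mu (cst 0 : X -> R) 0.
  by apply: ess_boundedT => // q; rewrite normr0.
have := dPD HK j p r y0 z0 (lexx 0) gN N0.
have [A A0 /(_ y _ _ p y0 z0 (lexx 0))] := dP_bound HK j.
rewrite mulr0 normr_le0 => /eqP ->; rewrite add0r => <-.
by congr dP; apply/funext => q; rewrite add0r.
Qed.

(** The derivatives of P_y commute with the integral in s, and the semigroup law
   gives d^j P_y P_s = d^j P_(y+s). *)
Lemma dP_laplace_avg j y p : 0 < y ->
  dP mu K K' j y u p = \int[leb]_s (cutoff a s * phi j (y + s) p).
Proof.
move=> y0; rewrite (_ : laplace_avg P a f =
  fun p => \int[leb]_s (cutoff a s * phi 0 (0 + s) p)); last first.
  by apply/funext => q; rewrite laplace_avgE.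
rewrite (dP_integral (nu := leb) HK (G := fun s q => cutoff a s * phi 0 (0 + s) q)
  j p y0 measurable_avg2 (g := avg_majorant)).
- apply: eq_Rintegral => s _; have [s0|s0] := leP s 0.
    rewrite (cutoff_le0 a)// mul0r.
    have z0 : ess_bounded mu (cst 0 : X -> R) 0.
      by apply: ess_boundedT => // q; rewrite normr0.
    rewrite (_ : (fun q => _) = (fun q => 0 * (cst 0 q))).
      by rewrite (dPZ _ _ _ y0 z0)// mul0r.
    by apply/funext => q; rewrite !mul0r.
  have [N N0 gN] := ess_bounded_dP HK 0 s0 fF F0.
  rewrite add0r (dPZ _ _ _ y0 gN)//; congr (_ * _).
  by rewrite (dP_op HK _ _ _ _ fF).
- by move=> s q; exact: avg_le.
- exact: integrable_avg_majorant.
Qed.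

(** The semigroup law: (P_t - I)^2 P_s = P_(s+2t) - 2 P_(s+t) + P_s. *)
Lemma sqrt_integrandE p t : 0 < t ->
  sqrt_integrand P u p t =
  \int[leb]_s (cutoff a s * (t ^+ 2)^-1 * diff2 (fun r => phi 0 r p) (0 + s) t).
Proof.
move=> t0; have uN := ess_bounded_laplace_avg.
have N0 : 0 <= Ma * (c * F) * 2 by rewrite !mulr_ge0.
have [N' N'0 gN'] := ess_bounded_dP HK 0 t0 uN N0.
rewrite /sqrt_integrand /P_sub_I.
rewrite (_ : (fun x => P t u x - u x) = (fun x => dP mu K K' 0 t u x + (-1) * u x)); last first.
  by apply/funext => q; rewrite (PE _ t0 uN N0) mulN1r.
have mB : ess_bounded mu (fun x => dP mu K K' 0 t u x + (-1) * u x)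
    (N' + Ma * (c * F) * 2).
  have [m1 n1] := gN'; have [m2 n2] := uN; split.
    by apply: measurable_funD => //; exact: measurable_funM.
  apply: filterS2 n1 n2 => q h1 h2; rewrite mulN1r.
  by rewrite (le_trans (ler_normB _ _))// lerD.
rewrite (PE p t0 uN N0) (PE _ t0 mB) ?addr_ge0// (opD _ _ (kernel_le_mass HK t0) gN' N'0 uN N0).
have -> : kernel_op mu (K t) (dP mu K K' 0 t u) p = dP mu K K' 0 (t + t) u p.
  by rewrite (op_semigroup HK _ _ _ uN).
have -> : kernel_op mu (K t) u p = dP mu K K' 0 t u p by [].
rewrite (dP_laplace_avg 0 p t0) dP_laplace_avg ?addr_gt0// laplace_avgE.
have i0 := integrable_avg p (lexx 0).
have i1 := integrable_avg p (ltW t0).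
have i2 := integrable_avg p (ltW (addr_gt0 t0 t0)).
have i1' : leb.-integrable setT (EFin \o (fun s => (-2) * (cutoff a s * phi 0 (t + s) p))).
  by have := integrableZl measurableT (-2) i1.
have i12 : leb.-integrable setT (EFin \o (fun s =>
    cutoff a s * phi 0 (t + t + s) p + (-2) * (cutoff a s * phi 0 (t + s) p))).
  by have := integrableD measurableT i2 i1'.
transitivity ((\int[leb]_s (cutoff a s * phi 0 (t + t + s) p
    + (-2) * (cutoff a s * phi 0 (t + s) p) + cutoff a s * phi 0 (0 + s) p)) / t ^+ 2).
  rewrite RintegralD// RintegralD// RintegralZl//; congr (_ / _).
  have E (x y z : R) : x + -1 * y - (y - z) = x + -2 * y + z by ring.
  exact: E.
rewrite -RintegralZr//; last by have := integrableD measurableT i12 i0.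
apply: eq_Rintegral => s _; rewrite /diff2 (_ : t + t + s = 0 + s + 2 * t); last by ring.
by rewrite (addrC t s) add0r; ring.
Qed.

Local Notation leb2 := (leb \x leb)%E.
Local Notation R2 := (measurableTypeR R * measurableTypeR R)%type.

Definition invsq (t : R) : R := (t ^+ 2)^-1.

Lemma measurable_invsq : measurable_fun setT invsq.
Proof.
apply: (measurableT_comp (@measurable_invr R) (g := fun t : R => t ^+ 2)).
exact: measurable_funX.
Qed.

(** The integrand in (s, tau) of the double integral that gives, up to the factor
   c1^-1, the j-th derivative of P_y applied to the multiplier. *)
Definition diffq j y p (w : R * R) : R :=
  cutoff a w.1 * cutoff invsq w.2 * diff2 (fun r => phi j r p) (y + w.1) w.2.

(** The majorant of [diffq] obtained from a bound M0 of phi_j and a bound M2 of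
   phi_(j+2) on [y + s, oo), by the two estimates of a second difference. *)
Definition diffq_majorant (M0 M2 : R -> R) (w : R * R) : R :=
  Ma * (cutoff (fun=> 1) w.1 *
    cutoff (fun t => Num.min (M2 w.1) (4 * M0 w.1 * invsq t)) w.2).

Lemma measurable_diffq j y : measurable_fun setT
  (fun z : R2 * X => diffq j y z.2 z.1).
Proof.
have m1 : measurable_fun setT (fun z : R2 * X => z.1.1).
  exact: (measurableT_comp (f := fst) (g := fst)).
have m2 : measurable_fun setT (fun z : R2 * X => z.1.2).
  exact: (measurableT_comp (f := snd) (g := fst)).
have mp : measurable_fun setT (fun z : R2 * X => z.2).
  exact: measurable_snd.
have mphi (h : R2 * X -> R) : measurable_fun setT h ->
    measurable_fun setT (fun z : R2 * X => phi j (h z) z.2).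
  move=> mh; apply: (measurableT_comp (measurable_phi j mf)
    (g := fun z : R2 * X => (h z, z.2))).
  exact: measurable_fun_pair.
have mys : measurable_fun setT (fun z : R2 * X => y + z.1.1).
  exact: measurable_funD.
apply: measurable_funM.
  apply: measurable_funM.
    exact: (measurableT_comp measurable_cutoff_a m1).
  apply: (measurableT_comp _ m2); apply: measurable_cutoff.
  by apply: measurable_funTS; exact: measurable_invsq.
apply: measurable_funD; last exact: mphi.
apply: measurable_funB.
  by apply: mphi; apply: measurable_funD => //; exact: measurable_funM.
by apply: measurable_funM => //; apply: mphi; exact: measurable_funD.
Qed.

Lemma diffq_le j y p (M0 M2 : R -> R) w : 0 <= y ->
  (forall s r, 0 < s -> y + s <= r -> `|phi j r p| <= M0 s) ->
  (forall s r, 0 < s -> y + s <= r -> `|phi j.+2 r p| <= M2 s) ->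
  `|diffq j y p w| <= diffq_majorant M0 M2 w.
Proof.
move=> y0 hM0 hM2; case: w => s t; rewrite /diffq /diffq_majorant /=.
have [s0|s0] := leP s 0; first by rewrite !(cutoff_le0 _ s0) !mul0r mulr0 normr0.
have [t0|t0] := leP t 0.
  by rewrite !(cutoff_le0 _ t0) !mulr0 mul0r normr0.
rewrite !(cutoff_gt0 _ s0) !(cutoff_gt0 _ t0) mul1r !normrM -mulrA.
apply: ler_pM => //.
  by apply: a_le; exact: ltW.
have i0 : 0 < invsq t by rewrite /invsq invr_gt0 exprn_gt0.
have ys x : y + s <= x -> 0 < x by apply: lt_le_trans; rewrite ltr_wpDl.
rewrite (gtr0_norm i0) le_min; apply/andP; split; last first.
  rewrite mulrC ler_pM2r//; apply: norm_diff2_le4; first exact: ltW.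
  by move=> x; exact: hM0.
have -> : M2 s = invsq t * (M2 s * t ^+ 2).
  by rewrite mulrCA mulVf ?mulr1// expf_neq0// gt_eqF.
rewrite ler_pM2l//; apply: (@norm_diff2_le _ _ (fun r => phi j.+1 r p)
  (fun r => phi j.+2 r p)); first exact: ltW.
- move=> x xs; apply: (is_derive_dP HK j p _ fF F0); exact: ys.
- move=> x xs; apply: (is_derive_dP HK j.+1 p _ fF F0); exact: ys.
- by move=> x; exact: hM2.
Qed.

Section MajorantIntegral.
Variables (M0 M2 T N : R -> R) (I : R).
Hypothesis mM0 : measurable_fun setT M0.
Hypothesis mM2 : measurable_fun setT M2.
Hypothesis mN : measurable_fun setT N.
Hypothesis M00 : forall s, 0 <= M0 s.
Hypothesis M20 : forall s, 0 <= M2 s.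
Hypothesis T0 : forall s, 0 < s -> 0 < T s.
Hypothesis TN : forall s, 0 < s -> T s * M2 s + 4 * M0 s / T s <= N s.
Hypothesis NI : (\int[leb]_(s in `]0%R, +oo[) (N s)%:E <= I%:E)%E.

Lemma diffq_majorant_ge0 w : 0 <= diffq_majorant M0 M2 w.
Proof.
case: w => s t; rewrite /diffq_majorant mulr_ge0//=.
have [s0|s0] := leP s 0; first by rewrite !(cutoff_le0 _ s0) !mul0r.
have [t0|t0] := leP t 0; first by rewrite !(cutoff_le0 _ t0) !mulr0.
rewrite !(cutoff_gt0 _ s0) !(cutoff_gt0 _ t0) mul1r le_min M20/=.
by rewrite mulr_ge0 ?mulr_ge0// /invsq invr_ge0 sqr_ge0.
Qed.

Lemma measurable_diffq_majorant : measurable_fun setT (diffq_majorant M0 M2 : R2 -> R).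
Proof.
pose pos := cutoff (fun=> 1).
have mpos : measurable_fun setT pos by apply: measurable_cutoff.
have majE : (diffq_majorant M0 M2 : R2 -> R) = fun w : R2 => Ma * (pos w.1 *
    (pos w.2 * Num.min (M2 w.1) (4 * M0 w.1 * invsq w.2))).
  apply/funext => -[s t]; rewrite /diffq_majorant /pos/=; congr (_ * (_ * _)).
  have [t0|t0] := leP t 0; first by rewrite !(cutoff_le0 _ t0) mul0r.
  by rewrite !(cutoff_gt0 _ t0) mul1r.
rewrite majE; apply: measurable_funM => //; apply: measurable_funM.
  exact: (measurableT_comp mpos (g := fst)).
apply: measurable_funM; first exact: (measurableT_comp mpos (g := snd)).
apply: measurable_minr; first exact: (measurableT_comp mM2 (g := fst)).
apply: measurable_funM.
  apply: measurable_funM => //; exact: (measurableT_comp mM0 (g := fst)).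
exact: (measurableT_comp measurable_invsq (g := snd)).
Qed.

(** The integral in t is done by [integral_min_le] with T = T(s); only the
   integral in s of the resulting N(s) remains. *)
Lemma integral_diffq_majorant : (\int[leb2]_w (diffq_majorant M0 M2 w)%:E <= (Ma * I)%:E)%E.
Proof.
rewrite [leLHS](@fubini_tonelli1 _ _ _ _ _ leb leb (EFin \o diffq_majorant M0 M2)); last 2 first.
- by apply/measurable_EFinP; exact: measurable_diffq_majorant.
- by move=> w; rewrite lee_fin; exact: diffq_majorant_ge0.
rewrite /fubini_F /=.
have N0 s : 0 < s -> 0 <= N s.
  move=> s0; apply: le_trans (TN s0); rewrite addr_ge0 ?mulr_ge0 ?(ltW (T0 s0))//.
  by rewrite invr_ge0 ltW// T0.
have cN0 s : 0 <= cutoff N s.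
  have [s0|s0] := leP s 0; first by rewrite cutoff_le0.
  by rewrite cutoff_gt0// N0.
have mcN : measurable_fun setT (cutoff N).
  by apply: measurable_cutoff; exact: measurable_funTS.
apply: (@le_trans _ _ (\int[leb]_s (Ma%:E * (cutoff N s)%:E))%E).
  apply: ge0_le_integral => //=.
  - by move=> s _; apply: integral_ge0 => t _; rewrite lee_fin diffq_majorant_ge0.
  - apply: (@measurable_fun_fubini_tonelli_F _ _ _ _ _ leb (EFin \o diffq_majorant M0 M2)).
      by apply/measurable_EFinP; exact: measurable_diffq_majorant.
    by move=> w; rewrite lee_fin; exact: diffq_majorant_ge0.
  - by apply/measurable_EFinP; exact: measurable_funM.
  move=> s _; have [s0|s0] := leP s 0.
    rewrite /diffq_majorant /= !(cutoff_le0 _ s0) mule0.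
    by under eq_integral do rewrite mul0r mulr0; rewrite integral0.
  rewrite /diffq_majorant/= !(cutoff_gt0 _ s0).
  under eq_integral do rewrite mul1r EFinM.
  rewrite ge0_integralZl_EFin//; last 2 first.
  - move=> t _; rewrite lee_fin; have [t0|t0] := leP t 0; first by rewrite cutoff_le0.
    rewrite cutoff_gt0// le_min M20/= mulr_ge0 ?mulr_ge0//.
    by rewrite /invsq invr_ge0 sqr_ge0.
  - apply/measurable_EFinP; apply: measurable_cutoff; apply: measurable_funTS.
    apply: measurable_minr => //; apply: measurable_funM => //.
    exact: measurable_invsq.
  rewrite lee_wpmul2l ?lee_fin//.
  have h := @integral_min_le R (M2 s) (M0 s) (T s) (M20 s) (M00 s) (T0 s0).
  rewrite integral_mkcond restrict_EFin in h; apply: le_trans h _.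
  by rewrite lee_fin; exact: TN.
rewrite ge0_integralZl_EFin//=; last 2 first.
- by move=> s _; rewrite lee_fin.
- exact/measurable_EFinP.
rewrite EFinM lee_wpmul2l ?lee_fin//.
by move: NI; rewrite [X in (X <= _)%E -> _]integral_mkcond restrict_EFin.
Qed.

Lemma integrable_diffq_majorant : leb2.-integrable setT (EFin \o diffq_majorant M0 M2).
Proof.
apply: (le_integral_integrable measurableT _ _ _ integral_diffq_majorant).
- exact: measurable_diffq_majorant.
- exact: measurable_diffq_majorant.
- by move=> s _; rewrite ger0_norm// diffq_majorant_ge0.
Qed.

Lemma integrable_diffq j y p : (forall w, `|diffq j y p w| <= diffq_majorant M0 M2 w) ->
  leb2.-integrable setT (EFin \o diffq j y p).
Proof.
move=> hd; apply: (le_integral_integrable measurableT _ _ _ integral_diffq_majorant).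
- exact: (measurableT_comp (measurable_diffq j y) (measurable_pair2 p)).
- exact: measurable_diffq_majorant.
- by move=> w _; exact: hd.
Qed.

Lemma Rintegral_diffq_le j y p : (forall w, `|diffq j y p w| <= diffq_majorant M0 M2 w) ->
  `|\int[leb2]_w diffq j y p w| <= Ma * I.
Proof.
move=> hd; have mq : measurable_fun setT (diffq j y p).
  exact: (measurableT_comp (measurable_diffq j y) (measurable_pair2 p)).
apply: norm_Rintegral_le => //; apply: le_trans integral_diffq_majorant.
apply: ge0_le_integral => //=.
- by apply/measurable_EFinP; exact: measurableT_comp.
- by apply/measurable_EFinP; exact: measurable_diffq_majorant.
- by move=> w _; rewrite lee_fin hd.
Qed.

Hypothesis Qdom : forall p w, `|diffq 0 0 p w| <= diffq_majorant M0 M2 w.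

Lemma sqrt_integrand_cutoff p :
  (sqrt_integrand P u p) \_ `]0, +oo[%classic =
  fun t => \int[leb]_s diffq 0 0 p (s, t).
Proof.
apply/funext => t; rewrite -/(cutoff _ t); have [t0|t0] := leP t 0.
  rewrite cutoff_le0// /diffq/=.
  under eq_Rintegral do rewrite (cutoff_le0 _ t0) mulr0 mul0r.
  by rewrite /Rintegral integral0.
rewrite cutoff_gt0// sqrt_integrandE//; apply: eq_Rintegral => s _.
by rewrite /diffq/= (cutoff_gt0 _ t0).
Qed.

Lemma integrable_sqrt_integrand p : leb.-integrable `]0%R, +oo[
  (fun t => (sqrt_integrand P u p t)%:E).
Proof.
apply/integrable_mkcond => //.
have := integrable_Rintegral2 (integrable_diffq (Qdom p)).
rewrite -sqrt_integrand_cutoff; congr (_.-integrable _ _).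
by rewrite -restrict_EFin.
Qed.

(** Exchanges the integrals in s and in t, which is possible once the double
   integral converges absolutely. *)
Lemma sqrt_opE p : sqrt_op P u p = (@c1 R)^-1 * \int[leb2]_w diffq 0 0 p w.
Proof.
rewrite /sqrt_op; congr (_ * _).
rewrite -(Rintegral21 (integrable_diffq (Qdom p))) Rintegral_mkcond.
by rewrite -sqrt_integrand_cutoff.
Qed.

Lemma measurable_Rintegral_diffq : measurable_fun setT
  (fun p => \int[leb2]_w diffq 0 0 p w).
Proof.
have m : measurable_fun setT
    (fun z : X * R2 => diffq 0 0 z.1 z.2).
  apply: (measurableT_comp (measurable_diffq 0 0)
    (g := fun z : X * R2 => (z.2, z.1))).
  by apply: measurable_fun_pair; [exact: measurable_snd|exact: measurable_fst].
exact: (@measurable_Rintegral _ _ _ _ _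
  (sigma_finite_prod leb leb : {sigma_finite_measure set R2 -> \bar R}) _ m).
Qed.

Lemma measurable_sqrt_op : measurable_fun setT (sqrt_op P u).
Proof.
rewrite (_ : sqrt_op P u = fun p => (@c1 R)^-1 * \int[leb2]_w diffq 0 0 p w).
  by apply: measurable_funM => //; exact: measurable_Rintegral_diffq.
by apply/funext => p; exact: sqrt_opE.
Qed.

(** For fixed (s, t), [diffq] is a linear combination of P_(s+2t) f, P_(s+t) f
   and P_s f, and d^j P_y acts on each by the semigroup law. *)
Lemma dP_diffq j y w p : 0 < y ->
  dP mu K K' j y (fun q => diffq 0 0 q w) p = diffq j y p w.
Proof.
move=> y0; have z0 : ess_bounded mu (cst 0 : X -> R) 0.
  by apply: ess_boundedT => // q; rewrite normr0.
have dP0 : dP mu K K' j y (cst 0) p = 0.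
  have := dPZ j 0 p y0 z0 (lexx 0); rewrite mul0r => e0.
  by rewrite -[RHS]e0; congr dP; apply/funext => q; rewrite mul0r.
case: w => s t; have [s0|s0] := leP s 0.
  rewrite {2}/diffq /= (cutoff_le0 _ s0) !mul0r -[RHS]dP0; congr dP.
  by apply/funext => q; rewrite /diffq/= (cutoff_le0 _ s0) !mul0r.
have [t0|t0] := leP t 0.
  rewrite {2}/diffq /= (cutoff_le0 _ t0) mulr0 mul0r -[RHS]dP0; congr dP.
  by apply/funext => q; rewrite /diffq/= (cutoff_le0 _ t0) mulr0 mul0r.
have s2t : 0 < s + 2 * t by rewrite addr_gt0 ?mulr_gt0.
have st : 0 < s + t by rewrite addr_gt0.
have [N1 N10 g1] := ess_bounded_dP HK 0 s2t fF F0.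
have [N2 N20 g2] := ess_bounded_dP HK 0 st fF F0.
have [N3 N30 g3] := ess_bounded_dP HK 0 s0 fF F0.
pose e := cutoff a s * cutoff invsq t.
have b12 : ess_bounded mu (fun q => phi 0 (s + 2 * t) q + (-2) * phi 0 (s + t) q)
    (N1 + 2 * N2).
  have [m1 n1] := g1; have [m2 n2] := g2; split.
    by apply: measurable_funD => //; exact: measurable_funM.
  apply: filterS2 n1 n2 => q h1 h2.
  rewrite (le_trans (ler_normD _ _))// lerD// normrM normrN.
  by rewrite (ger0_norm (ler0n _ 2)) ler_wpM2l.
have N120 : 0 <= N1 + 2 * N2 by rewrite addr_ge0// mulr_ge0.
have b3 : ess_bounded mu (fun q => (phi 0 (s + 2 * t) q + (-2) * phi 0 (s + t) q)
    + 1 * phi 0 s q) (N1 + 2 * N2 + N3).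
  have [m1 n1] := b12; have [m2 n2] := g3; split.
    by apply: measurable_funD => //; exact: measurable_funM.
  apply: filterS2 n1 n2 => q h1 h2.
  by rewrite mul1r (le_trans (ler_normD _ _))// lerD.
transitivity (dP mu K K' j y (fun q => e *
  ((phi 0 (s + 2 * t) q + (-2) * phi 0 (s + t) q) + 1 * phi 0 s q)) p).
  congr dP; apply/funext => q; rewrite /diffq /diff2 /e /= add0r; congr (_ * _).
  by rewrite mul1r mulNr.
rewrite (dPZ _ _ _ y0 b3); last by rewrite addr_ge0.
rewrite (dPD HK _ _ _ y0 b12 N120 g3 N30) (dPD HK _ _ _ y0 g1 N10 g2 N20).
rewrite !(dP_op HK _ _ y0 _ fF F0)// mul1r /diffq /diff2/= /e; congr (_ * _).
by rewrite mulNr !addrA.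
Qed.

Lemma dP_sqrt_op j y p : 0 < y ->
  dP mu K K' j y (sqrt_op P u) p = (@c1 R)^-1 * \int[leb2]_w diffq j y p w.
Proof.
move=> y0; rewrite (_ : sqrt_op P u = fun p => (@c1 R)^-1 * \int[leb2]_w diffq 0 0 p w);
  last by apply/funext => q; exact: sqrt_opE.
have bI : ess_bounded mu (fun q => \int[leb2]_w diffq 0 0 q w) `|Ma * I|.
  apply: ess_boundedT; first exact: measurable_Rintegral_diffq.
  by move=> q; apply: le_trans (ler_norm _); apply: Rintegral_diffq_le => w; exact: Qdom.
rewrite (dPZ _ _ _ y0 bI)//; congr (_ * _).
have := @dP_integral _ _ _ _ _ _ _ HK _ _
  (sigma_finite_prod leb leb : {sigma_finite_measure set R2 -> \bar R})
  (fun w q => diffq 0 0 q w) (diffq_majorant M0 M2) j y p y0 (measurable_diffq 0 0).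
move=> ->.
- by apply: eq_Rintegral => w _; exact: dP_diffq.
- by move=> w q; exact: Qdom.
- exact: integrable_diffq_majorant.
Qed.

Lemma sqrt_op_le p : `|sqrt_op P u p| <= `|(@c1 R)^-1| * (Ma * I).
Proof.
by rewrite sqrt_opE normrM ler_wpM2l// Rintegral_diffq_le.
Qed.

End MajorantIntegral.

End MultiplierFormula.

(** * Growth of the derivatives of a Lipschitz function *)
Section DerivativeGrowth.
Context d (X : measurableType d) (R : realType).
Variable mu : {sigma_finite_measure set X -> \bar R}.
Variables (K K' : R -> X -> X -> R) (c : R).
Hypothesis HK : smoothing_kernel mu K K' c.
Implicit Types (s t y : R) (p : X) (j : nat) (f : X -> R).
Local Notation dP := (dP mu K K').

Let c0 : 0 <= c. Proof. exact: sk_cst HK. Qed.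

Lemma powR_le_neg (e s r : R) : e <= 0 -> 0 < s -> s <= r -> r `^ e <= s `^ e.
Proof.
move=> e0 s0 sr; have r0 : 0 < r by exact: lt_le_trans sr.
rewrite -[e]opprK !(powRN _ (- e)) lef_pV2 ?posrE ?powR_gt0//.
by apply: ge0_ler_powR => //; rewrite ?oppr_ge0// nnegrE ltW.
Qed.

Lemma powR_half (e y : R) : 0 < y -> (y / 2) `^ e = 2^-1 `^ e * y `^ e.
Proof. by move=> y0; rewrite mulrC powRM// ?invr_ge0// ltW. Qed.

Lemma powR_pred (e y : R) : 0 < y -> y^-1 * y `^ e = y `^ (e - 1).
Proof.
move=> y0; rewrite powRB; last by rewrite [y == 0]gt_eqF// implybT.
by rewrite powRr1 ?ltW// mulrC.
Qed.

(** The bound which defines the space, stated for the everywhere defined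
   derivative [dP]. *)
Definition ae_growth k (e : R) f C : Prop :=
  forall y, 0 < y -> {ae mu, forall p, `|dP k y f p| <= C * y `^ e}.

(** Going up in the order of the derivative: P_(y/2) turns the bound almost
   everywhere at y/2 into a bound everywhere at y, and every further derivative
   costs a factor y^-1. *)
Lemma dP_growth k e i : exists2 A, 0 <= A & forall f F C,
  ess_bounded mu f F -> 0 <= F -> 0 <= C -> ae_growth k e f C ->
  forall y p, 0 < y -> `|dP (i + k) y f p| <= A * C * y `^ (e - i%:R).
Proof.
elim: i => [|i [A A0 IH]].
  exists (c * 2^-1 `^ e); first by rewrite mulr_ge0 ?powR_ge0.
  move=> f F C fF F0 C0 H y p y0; rewrite add0n subr0.
  have y20 : 0 < y / 2 by rewrite divr_gt0.
  rewrite (_ : y = y / 2 + y / 2); last by field.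
  rewrite (dP_add HK _ _ y20 y20 fF F0).
  rewrite (_ : y / 2 + y / 2 = y); last by field.
  have b : ess_bounded mu (dP k (y / 2) f) (C * (y / 2) `^ e).
    split; last exact: H.
    by apply: (measurable_dP HK); case: fF.
  apply: le_trans (op_bound p (kernel_le_mass HK y20) b _) _.
    by rewrite mulr_ge0 ?powR_ge0.
  by rewrite powR_half// le_eqVlt; apply/orP; left; apply/eqP; ring.
exists (2 * c * c * A * 2^-1 `^ (e - i%:R)); first by rewrite !mulr_ge0 ?powR_ge0.
move=> f F C fF F0 C0 H y p y0; rewrite addSn /=.
have y20 : 0 < y / 2 by rewrite divr_gt0.
have b : ess_bounded mu (dP (i + k) (y / 2) f) (A * C * (y / 2) `^ (e - i%:R)).
  apply: ess_boundedT; last by move=> q; exact: IH fF F0 C0 H _ _ _.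
  by apply: (measurable_dP HK); case: fF.
apply: le_trans (op_bound p (kernel_le_derive HK y20) b _) _.
  by rewrite !mulr_ge0 ?powR_ge0.
rewrite powR_half// -[i.+1%:R]natr1 opprD addrA -powR_pred// invfM invrK.
by rewrite le_eqVlt; apply/orP; left; apply/eqP; ring.
Qed.

(** The constant A depends neither on f nor on y. Only the behaviour at y = 0 is
   in question: for y >= 1 the sup norm of f alone gives enough decay. *)
Definition near0_bound k (e e' : R) j : Prop := exists2 A, 0 <= A & forall f F C,
  ess_bounded mu f F -> 0 <= F -> 0 <= C -> ae_growth k e f C ->
  forall y p, 0 < y <= 1 -> `|dP j y f p| <= A * (F + C) * y `^ e'.

(** Going down in the order of the derivative, by the mean value inequality on
   [y, 1]: since the exponent e' is nonpositive, the bound at y dominates on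
   [y, 1], and the length of the interval is at most 1. No power of y is gained. *)
Lemma near0_bound_pred k e e' j : e' <= 0 ->
  near0_bound k e e' j.+1 -> near0_bound k e e' j.
Proof.
move=> e0 [A A0 H]; have [B B0 HB] := dP_bound HK j.
exists (A + B); first by rewrite addr_ge0.
move=> f F C fF F0 C0 Hf y p /andP[y0 y1].
have h1 : 1 <= y `^ e' by have := powR_le_neg e0 y0 y1; rewrite powR1.
have FC : 0 <= F + C by rewrite addr_ge0.
have e1 : `|dP j 1 f p| <= B * (F + C) * y `^ e'.
  have := HB 1 f F p ltr01 fF F0; rewrite expr1n divr1 => h; apply: le_trans h _.
  apply: (@le_trans _ _ (B * (F + C) * 1)); last by rewrite ler_wpM2l// mulr_ge0.
  by rewrite mulr1 ler_wpM2l// lerDl.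
have e2 : `|dP j 1 f p - dP j y f p| <= A * (F + C) * y `^ e'.
  have := @is_derive_lipschitz R (fun t => dP j t f p) (fun t => dP j.+1 t f p)
    y 1 (A * (F + C) * y `^ e') y1.
  move=> h; apply: le_trans (h _ _) _.
  - move=> x /andP[yx _]; apply: (is_derive_dP HK j p _ fF F0).
    exact: lt_le_trans yx.
  - move=> x /andP[yx x1]; apply: le_trans (H _ _ _ fF F0 C0 Hf _ _ _) _.
      by rewrite (lt_le_trans y0 yx).
    by rewrite ler_wpM2l ?mulr_ge0// powR_le_neg.
  - rewrite ler_piMr ?mulr_ge0 ?powR_ge0//; lra.
have -> : dP j y f p = dP j 1 f p - (dP j 1 f p - dP j y f p) by ring.
apply: le_trans (ler_normB _ _) _; rewrite addrC !mulrDl.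
move: e1 e2; rewrite !mulrDr !mulrDl; lra.
Qed.

Lemma near0_bound_le k e e' i j : e' <= 0 ->
  near0_bound k e e' (i + j) -> near0_bound k e e' j.
Proof.
by move=> e0; elim: i => // i IH /near0_bound_pred h; apply: IH; exact: h.
Qed.

(** Second derivatives are integrable against s^(1 - b/2) at 0. If k >= 2 the
   bound of order k is better than required, as alpha - k >= -1, and one
   goes down to order 2; if k = 1 one goes up by one order. *)
Lemma near0_bound2 (alpha : R) : 0 < alpha ->
  near0_bound (order_of alpha) (- (order_of alpha)%:R + alpha)
    (Num.min alpha 2^-1 - 2) 2.
Proof.
move=> a0; set k := order_of alpha; set b := Num.min alpha 2^-1.
have ba : b <= alpha by rewrite /b ge_min lexx.
have b2 : b <= 2^-1 by rewrite /b ge_min lexx orbT.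
(* k is the integer part of alpha, plus one. *)
have kle : k%:R <= alpha + 1 :> R.
  by rewrite /k /order_of -[_.+1%:R]natr1 lerD2r truncn_le// ltW.
have e0 : b - 2 <= 0 by lra.
have top i : b - 2 <= - k%:R + alpha - i%:R ->
    near0_bound k (- k%:R + alpha) (b - 2) (i + k).
  move=> he; have [A A0 H] := dP_growth k (- k%:R + alpha) i.
  exists A => // f F C fF F0 C0 Hf y p /andP[y0 y1].
  apply: le_trans (H _ _ _ fF F0 C0 Hf _ _ y0) _.
  apply: ler_pM; rewrite ?powR_ge0 ?mulr_ge0//.
    by rewrite ler_wpM2l// lerDr.
  by apply: ger_powR => //; rewrite y0.
have [k1|k2] : k = 1%N \/ exists i, k = (i + 2)%N.
  rewrite /k /order_of; case: (Num.truncn alpha) => [|i]; first by left.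
  by right; exists i; rewrite addn2.
  by rewrite -/k; have := top 1%N; rewrite k1 => h; apply: h; lra.
case: k2 => i ki; apply: (@near0_bound_le _ _ _ i) => //.
by have := top 0%N; rewrite add0n -ki; apply; lra.
Qed.

End DerivativeGrowth.

(** * Boundedness of the multiplier for a smoothing kernel *)
Section EssentialBounds.
Context d (X : measurableType d) (R : realType).
Variable mu : {measure set X -> \bar R}.

(** If mu is zero the norm is 0 by convention, and the right-hand side holds
   trivially. *)
Lemma Lnorm_leP (f : X -> R) (C : R) : 0 <= C ->
  ('N[mu]_(+oo)[EFin \o f] <= C%:E)%E <-> {ae mu, forall x, `|f x| <= C}.
Proof.
move=> C0; rewrite unlock /=; case: ifPn => [mu0|].
  split=> [/ess_supP|h]; last apply/ess_supP.
    by apply: filterS => x /=; rewrite lee_fin.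
  by apply: filterS h => x /=; rewrite lee_fin.
rewrite -leNgt measure_le0 => /eqP mu0; split => // _.
by exists setT; split => //; exact: subsetT.
Qed.

Lemma Lfun_ess_bounded (f : X -> R) : f \in Lfun mu +oo ->
  ess_bounded mu f (fine 'N[mu]_(+oo)[EFin \o f]).
Proof.
rewrite inE => /andP[]; rewrite !inE /= => mf.
rewrite /finLfun /= /finite_norm => Nf; split; first exact: mf.
have N0 : (0 <= 'N[mu]_(+oo)[EFin \o f])%E by exact: Lnorm_ge0.
by apply: (Lnorm_leP f (fine_ge0 N0)).1; rewrite fineK// ge0_fin_numE.
Qed.

Lemma ess_bounded_Lfun (f : X -> R) M : 0 <= M -> ess_bounded mu f M ->
  f \in Lfun mu +oo.
Proof.
move=> M0 [mf fM]; rewrite inE; apply/andP; split; rewrite inE//=.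
rewrite /finLfun /= /finite_norm; apply: (@le_lt_trans _ _ M%:E); last by rewrite ltry.
exact/Lnorm_leP.
Qed.

End EssentialBounds.

Section SecondDerivativeDomination.
Context (R : realType).
Local Notation leb := (@lebesgue_measure R).
Variables (b B D : R).
Hypothesis b0 : 0 < b.
Hypothesis b1 : b <= 1.
Hypothesis B0 : 0 <= B.
Hypothesis D0 : 0 <= D.

Definition deriv2_majorant (s : R) : R := B * (if s <= 1 then s `^ (b - 2) else invsq s).
(** The radius T(s) at which the integral in t is cut: it
   balances the bounds 1 of phi_0 and s^(b - 2) of phi_2 near s = 0. *)
Definition cut_radius (s : R) : R := if s <= 1 then s `^ (1 - b / 2) else 1.
Definition cut_total (s : R) : R := (B + 4 * D) * (if s <= 1 then s `^ (b / 2 - 1) else invsq s).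

Lemma invsq_ge0 (s : R) : 0 <= invsq s.
Proof. by rewrite /invsq invr_ge0 sqr_ge0. Qed.

Lemma measurable_if_le1 (h1 h2 : R -> R) : measurable_fun setT h1 ->
  measurable_fun setT h2 -> measurable_fun setT (fun s : R => if s <= 1 then h1 s else h2 s).
Proof.
by move=> m1 m2; apply: measurable_fun_ifT => //; exact: measurable_fun_ler.
Qed.

Lemma measurable_deriv2_majorant : measurable_fun setT deriv2_majorant.
Proof.
apply: measurable_funM => //; apply: measurable_if_le1; last exact: measurable_invsq.
exact: measurable_powR.
Qed.

Lemma measurable_cut_total : measurable_fun setT cut_total.
Proof.
apply: measurable_funM => //; apply: measurable_if_le1; last exact: measurable_invsq.
exact: measurable_powR.
Qed.

Lemma deriv2_majorant_ge0 s : 0 <= deriv2_majorant s.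
Proof. by rewrite /deriv2_majorant mulr_ge0//; case: ifP => _; rewrite ?powR_ge0 ?invsq_ge0. Qed.

Lemma cut_radius_gt0 s : 0 < s -> 0 < cut_radius s.
Proof. by move=> s0; rewrite /cut_radius; case: ifP => // _; rewrite powR_gt0. Qed.

Lemma cut_radius_sum s : 0 < s ->
  cut_radius s * deriv2_majorant s + 4 * (D * decay s) / cut_radius s <= cut_total s.
Proof.
move=> s0; rewrite /cut_radius /deriv2_majorant /decay /cut_total; case: ifPn => s1; last first.
  by rewrite mul1r divr1 /invsq le_eqVlt; apply/orP; left; apply/eqP; ring.
have -> : s `^ (1 - b / 2) * (B * s `^ (b - 2)) = B * s `^ (b / 2 - 1).
  rewrite mulrCA -powRD; last by rewrite [s == 0]gt_eqF// implybT.
  by congr (_ * powR _ _); field.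
rewrite -powRN opprB mulr1.
by rewrite le_eqVlt; apply/orP; left; apply/eqP; ring.
Qed.

Lemma integral_cut_total :
  (\int[leb]_(s in `]0%R, +oo[) (cut_total s)%:E <= ((B + 4 * D) * (2 / b + 1))%:E)%E.
Proof.
have BD : 0 <= B + 4 * D by rewrite addr_ge0// mulr_ge0.
rewrite /cut_total; under eq_integral do rewrite EFinM.
rewrite ge0_integralZl_EFin//; last 2 first.
- by move=> s _; rewrite lee_fin; case: ifP => _; rewrite ?powR_ge0 ?invsq_ge0.
- apply/measurable_EFinP; apply: measurable_funTS.
  by apply: measurable_if_le1; [exact: measurable_powR|exact: measurable_invsq].
rewrite (EFinM (B + _)) lee_wpmul2l ?lee_fin//.
apply: (@integral_split1 R (fun s => s `^ (b / 2 - 1)) (@invsq R)).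
- exact: measurable_powR.
- exact: measurable_invsq.
- by move=> s; rewrite powR_ge0.
- exact: invsq_ge0.
- by rewrite integral_powR01 ?divr_gt0// invf_div.
- by rewrite integral_sqrV_tail// invr1.
Qed.

End SecondDerivativeDomination.

Section ShiftedPowerDomination.
Context (R : realType).
Local Notation leb := (@lebesgue_measure R).
Variables (e B y : R).
Hypothesis e0 : e < 0.
Hypothesis B0 : 0 <= B.
Hypothesis y0 : 0 < y.

Lemma measurable_powR_addr (g : R) : measurable_fun setT (fun s : R => (s + y) `^ g).
Proof.
apply: (measurableT_comp (@measurable_powR R g) (g := fun s : R => s + y)).
exact: measurable_funD.
Qed.

Lemma integral_powR_sum :
  (\int[leb]_(s in `]0%R, +oo[) (5 * B * (s + y) `^ (e - 1))%:E
    <= (5 * B * (y `^ e / - e))%:E)%E.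
Proof.
under eq_integral do rewrite EFinM.
rewrite ge0_integralZl_EFin ?mulr_ge0//; last 2 first.
- by move=> s _; rewrite lee_fin powR_ge0.
- by apply/measurable_EFinP; apply: measurable_funTS; exact: measurable_powR_addr.
rewrite (EFinM (5 * B)) lee_wpmul2l ?lee_fin ?mulr_ge0//.
have := @integral_powR_addr R y (- e); rewrite oppr_gt0 opprK => -> //.
Qed.

Lemma powR_sum (s : R) : 0 < s ->
  (s + y) * (B * (s + y) `^ (e - 2)) + 4 * (B * (s + y) `^ e) / (s + y)
    <= 5 * B * (s + y) `^ (e - 1).
Proof.
move=> s0; have sy : 0 < s + y by rewrite addr_gt0.
have E (g : R) : (s + y)^-1 * (s + y) `^ g = (s + y) `^ (g - 1) by exact: powR_pred.
have -> : e - 2 = e - 1 - 1 by ring.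
rewrite -!E; set z := (s + y) `^ e.
by rewrite le_eqVlt; apply/orP; left; apply/eqP; field; rewrite gt_eqF.
Qed.

End ShiftedPowerDomination.

Section SmoothingMultiplier.
Context d (X : measurableType d) (R : realType).
Variable mu : {sigma_finite_measure set X -> \bar R}.
Variables (K K' : R -> X -> X -> R) (c : R).
Hypothesis HK : smoothing_kernel mu K K' c.
Variable P : R -> (X -> R) -> X -> R.
Hypothesis PE : forall (y : R) f M p, 0 < y -> ess_bounded mu f M -> 0 <= M ->
  P y f p = kernel_op mu (K y) f p.
Variables (a : R -> R) (Ma : R).
Hypothesis ma : measurable_fun (`[0, +oo[ : set R) a.
Hypothesis a_le : forall s : R, 0 <= s -> `|a s| <= Ma.
Variable alpha : R.
Hypothesis alpha0 : 0 < alpha.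
Implicit Types (s t y : R) (p : X) (j : nat).
Local Notation leb := (@lebesgue_measure R).
Local Notation leb2 := (leb \x leb)%E.
Local Notation dP := (dP mu K K').
Local Notation k := (order_of alpha).
Local Notation e := (- k%:R + alpha).

Let c0 : 0 <= c. Proof. exact: sk_cst HK. Qed.
Let Ma0 : 0 <= Ma. Proof. exact: le_trans (a_le (lexx 0)). Qed.
Let e0 : e < 0.
Proof. by rewrite addrC subr_lt0 /order_of truncnS_gt. Qed.

Local Notation b := (Num.min alpha 2^-1).
Let b0 : 0 < b. Proof. by rewrite lt_min alpha0 invr_gt0 ltr0n. Qed.
Let b1 : b <= 1. Proof. by rewrite ge_min; apply/orP; right; lra. Qed.

(** The last bound involves C alone, without F: it is the estimate of the
   seminorm. *)
Definition multiplier_estimates A (f : X -> R) (F C : R) : Prop :=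
  [/\ multiplier_defined mu P a f,
      measurable_fun setT (multiplier P a f),
      (forall p, `|multiplier P a f p| <= A * (F + C)) &
      (forall y p, 0 < y -> `|dP k y (multiplier P a f) p| <= A * C * y `^ e)].

(** The double integral is dominated twice: for k derivatives with T = s + y, and
   without derivatives with T = [cut_radius]. *)
Lemma multiplier_estimatesP : exists2 A, 0 <= A & forall f F C,
  ess_bounded mu f F -> 0 <= F -> 0 <= C -> ae_growth mu K K' k e f C ->
  multiplier_estimates A f F C.
Proof.
have [A1 A10 near0] := near0_bound2 HK alpha0.
have [A2 A20 far] := dP_bound HK 2.
have [G0 G00 grow0] := dP_growth HK k e 0.
have [G2 G20 grow2] := dP_growth HK k e 2.
(* A1, A2 bound the second derivative for small and large y; G0, G2 bound the
   derivatives of order k and k + 2 at all y. *)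
pose B0 := A1 + A2; have B00 : 0 <= B0 by rewrite addr_ge0.
pose I0 := (B0 + 4 * c) * (2 / b + 1).
have b20 : 0 <= 2 / b + 1 by rewrite addr_ge0// divr_ge0// ltW.
have I00 : 0 <= I0 by rewrite mulr_ge0// addr_ge0// mulr_ge0.
pose G := G0 + G2; have GG : 0 <= G by rewrite addr_ge0.
pose I1 := 5 * G / - e.
have I10 : 0 <= I1 by rewrite divr_ge0 ?mulr_ge0// oppr_ge0 ltW.
pose A := `|(@c1 R)^-1| * (Ma * (I0 + I1)).
have A0 : 0 <= A by rewrite !mulr_ge0// addr_ge0.
exists A => // f F C fF F0 C0 Hf.
have FC : 0 <= F + C by rewrite addr_ge0.
pose B := B0 * (F + C); have BB : 0 <= B by rewrite mulr_ge0.
pose D := c * F; have D0 : 0 <= D by rewrite mulr_ge0.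
pose M0 s := D * decay s.
have mM0 : measurable_fun setT M0.
  by apply: measurable_funM => //; exact: measurable_decay.
have M00 s : 0 <= M0 s by rewrite mulr_ge0// decay_ge0.
(* The bounds near 0 and at infinity combine into one that is nonincreasing in s,
   hence valid on the whole half-line r >= s. *)
have hM2 p s r : 0 < s -> s <= r -> `|dP 2 r f p| <= deriv2_majorant b B s.
  move=> s0 sr; have r0 : 0 < r by exact: lt_le_trans sr.
  have far' : `|dP 2 r f p| <= B * invsq r.
    apply: le_trans (far _ _ _ p r0 fF F0) _; rewrite /invsq mulrAC ler_wpM2r//.
      by rewrite invr_ge0 sqr_ge0.
    by apply: ler_pM => //; rewrite ?lerDl ?lerDr.
  rewrite /deriv2_majorant; case: ifPn => s1; last first.
    apply: le_trans far' _; rewrite ler_wpM2l// /invsq lef_pV2 ?posrE ?exprn_gt0//.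
    by rewrite lerXn2r// nnegrE ltW.
  have [r1|r1] := leP r 1.
    apply: (@le_trans _ _ (A1 * (F + C) * r `^ (b - 2))).
      by apply: near0 => //; rewrite r0.
    apply: ler_pM; rewrite ?mulr_ge0 ?powR_ge0//.
      by rewrite ler_wpM2r// lerDl.
    by apply: powR_le_neg => //; have := b1; lra.
  apply: le_trans far' _; rewrite ler_wpM2l//.
  apply: (@le_trans _ _ 1).
    by rewrite /invsq invf_le1 ?exprn_gt0// exprn_ege1// ltW.
  have := @powR_le_neg R (b - 2) s 1; rewrite powR1; apply => //; have := b1; lra.
have hM0 p s r : 0 < s -> s <= r -> `|dP 0 r f p| <= M0 s.
  move=> s0 sr; apply: le_trans (phi0_decay HK fF F0 p _) _.
    exact: lt_le_trans sr.
  by rewrite ler_wpM2l// decay_le.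
have Qdom p w : `|diffq mu K K' a f 0 0 p w| <= diffq_majorant Ma M0 (deriv2_majorant b B) w.
  by apply: (diffq_le HK a_le fF F0) => // s r s0; rewrite add0r; [exact: hM0|exact: hM2].
have mdom2 := measurable_deriv2_majorant b B.
have msum2 := measurable_cut_total b B D.
have c2 s : 0 < s ->
    cut_radius b s * deriv2_majorant b B s + 4 * M0 s / cut_radius b s <= cut_total b B D s.
  exact: cut_radius_sum.
have I2 := @integral_cut_total R b B D b0 BB D0.
have BD : (B + 4 * D) * (2 / b + 1) <= I0 * (F + C).
  rewrite /I0 mulrAC ler_wpM2r//.
  rewrite /B /D [(B0 + _) * _]mulrDl lerD2l mulrA ler_wpM2l ?mulr_ge0// lerDl//.
have uN := ess_bounded_laplace_avg HK PE ma a_le fF F0.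
split.
- split.
  + apply: aeW => p; apply/integrable_mkcond => //.
    have := integrable_avg HK ma a_le fF F0 p (lexx 0).
    congr (_.-integrable _ _); apply/funext => s /=; rewrite patchE.
    case: ifPn => [|/negP]; rewrite ?inE/= in_itv/= andbT => s0.
      by rewrite cutoff_gt0// add0r (PE _ s0 fF F0) mulrC.
    by rewrite cutoff_le0 ?mul0r// leNgt; exact/negP.
  + by apply: ess_bounded_Lfun uN; rewrite !mulr_ge0.
  + apply: aeW => p.
    exact: (integrable_sqrt_integrand HK PE ma a_le fF F0 mM0 mdom2 msum2 M00
      (deriv2_majorant_ge0 b BB) (@cut_radius_gt0 _ b) c2 I2 Qdom).
- exact: (measurable_sqrt_op HK PE ma a_le fF F0 mM0 mdom2 msum2 M00
      (deriv2_majorant_ge0 b BB) (@cut_radius_gt0 _ b) c2 I2 Qdom).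
- move=> p; apply: le_trans (sqrt_op_le HK PE ma a_le fF F0 mM0 mdom2 msum2 M00
      (deriv2_majorant_ge0 b BB) (@cut_radius_gt0 _ b) c2 I2 Qdom p) _.
  rewrite /A -!mulrA ler_wpM2l// ler_wpM2l//; apply: le_trans BD _.
  by rewrite ler_wpM2r// lerDl.
move=> y p y0; rewrite /multiplier.
rewrite (dP_sqrt_op HK PE ma a_le fF F0 mM0 mdom2 msum2 M00
      (deriv2_majorant_ge0 b BB) (@cut_radius_gt0 _ b) c2 I2 Qdom _ _ y0).
rewrite normrM /A -!mulrA ler_wpM2l//.
(* The seminorm estimate: bounds on the half-line [y + s, oo), and T = s + y. *)
pose N0 s : R := G * C * (s + y) `^ e.
pose N2 s : R := G * C * (s + y) `^ (e - 2).
pose S s : R := 5 * (G * C) * (s + y) `^ (e - 1).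
have GC : 0 <= G * C by rewrite mulr_ge0.
have mN (g B' : R) : measurable_fun setT (fun s : R => B' * (s + y) `^ g).
  by apply: measurable_funM => //; exact: measurable_powR_addr.
have N00 s : 0 <= N0 s by rewrite mulr_ge0 ?powR_ge0.
have N20 s : 0 <= N2 s by rewrite mulr_ge0 ?powR_ge0.
have T0 s : 0 < s -> 0 < s + y by move=> s0; rewrite addr_gt0.
have NS s : 0 < s -> (s + y) * N2 s + 4 * N0 s / (s + y) <= S s.
  by move=> s0; exact: powR_sum.
have IS := @integral_powR_sum R e (G * C) y e0 GC y0.
have hN0 s r : 0 < s -> y + s <= r -> `|dP k r f p| <= N0 s.
  move=> s0 sr; have sy := T0 _ s0; rewrite addrC in sr.
  have r0 : 0 < r by exact: lt_le_trans sr.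
  have := grow0 _ _ _ fF F0 C0 Hf _ p r0; rewrite add0n subr0 => h.
  apply: le_trans h _; apply: ler_pM; rewrite ?mulr_ge0 ?powR_ge0//.
    by rewrite ler_wpM2r// lerDl.
  by apply: powR_le_neg => //; exact: ltW.
have hN2 s r : 0 < s -> y + s <= r -> `|dP k.+2 r f p| <= N2 s.
  move=> s0 sr; have sy := T0 _ s0; rewrite addrC in sr.
  have r0 : 0 < r by exact: lt_le_trans sr.
  have := grow2 _ _ _ fF F0 C0 Hf _ p r0 => h.
  apply: le_trans h _; apply: ler_pM; rewrite ?mulr_ge0 ?powR_ge0//.
    by rewrite ler_wpM2r// lerDr.
  by apply: powR_le_neg => //; have := e0; lra.
have Qd w : `|diffq mu K K' a f k y p w| <= diffq_majorant Ma N0 N2 w.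
  by apply: (diffq_le HK a_le fF F0) => //; exact: ltW.
have mS : measurable_fun setT S by exact: mN.
have h := Rintegral_diffq_le HK ma a_le fF (mN e (G * C)) (mN (e - 2) (G * C)) mS
  N00 N20 T0 NS IS Qd.
apply: le_trans h _; rewrite ler_wpM2l//.
rewrite (_ : 5 * (G * C) * (y `^ e / - e) = I1 * (C * y `^ e)).
  by rewrite ler_wpM2r ?mulr_ge0 ?powR_ge0// lerDr.
by rewrite /I1; ring.
Qed.

End SmoothingMultiplier.

Section SmoothingMultiplierBounded.
Context d (X : measurableType d) (R : realType).
Variable mu : {sigma_finite_measure set X -> \bar R}.
Variables (K K' : R -> X -> X -> R) (c : R).
Hypothesis HK : smoothing_kernel mu K K' c.
Variable P : R -> (X -> R) -> X -> R.
Hypothesis PE : forall (y : R) f M p, 0 < y -> ess_bounded mu f M -> 0 <= M ->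
  P y f p = kernel_op mu (K y) f p.
Variable alpha : R.
Local Notation k := (order_of alpha).
Local Notation e := (- k%:R + alpha).

Lemma Lambda_bound_ge0 f C : Lambda_bound mu P alpha f C -> 0 <= C.
Proof.
move=> /(_ 1 ltr01); rewrite powR1 mulr1 => h.
by rewrite -lee_fin; apply: le_trans h; exact: Lnorm_ge0.
Qed.

Lemma Lambda_bound_growth f F C : ess_bounded mu f F -> 0 <= F -> 0 <= C ->
  Lambda_bound mu P alpha f C <-> ae_growth mu K K' k e f C.
Proof.
move=> fF F0 C0.
have D y p : 0 < y -> derive1n k (fun s : R => P s f p : R^o) y = dP mu K K' k y f p.
  by move=> y0; apply: (derive1n_dP HK k y0 fF F0) => t t0; exact: PE fF F0.
have Cy y : 0 <= C * y `^ e by rewrite mulr_ge0 ?powR_ge0.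
split=> H y y0.
  have /(Lnorm_leP _ _ (Cy y)) := H y y0.
  by apply: filterS => p; rewrite D.
apply/(Lnorm_leP _ _ (Cy y)); have := H y y0.
by apply: filterS => p; rewrite D.
Qed.

(** The infimum in the norm is attained, so the estimate can be applied with the
   constant that enters the norm. *)
Lemma Lambda_bound_inf f C : Lambda_bound mu P alpha f C ->
  exists r, ereal_inf [set C%:E | C in [set C | Lambda_bound mu P alpha f C]] = r%:E
    /\ Lambda_bound mu P alpha f r.
Proof.
move=> HC; set S := [set C%:E | C in _].
have S0 : (0 <= ereal_inf S)%E.
  by apply: le_ereal_inf_tmp => _ [C' HC' <-]; rewrite lee_fin; exact: Lambda_bound_ge0 HC'.
have SC : (ereal_inf S <= C%:E)%E by apply: ereal_inf_lbound; exists C.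
have Sfin : ereal_inf S \is a fin_num.
  by rewrite ge0_fin_numE// (le_lt_trans SC) ?ltry.
exists (fine (ereal_inf S)); split; first by rewrite fineK.
move=> y y0; set N := Lnorm _ _ _.
have N0 : (0 <= N)%E by exact: Lnorm_ge0.
have ye : 0 < y `^ e by rewrite powR_gt0.
have Nfin : N \is a fin_num.
  by rewrite ge0_fin_numE// (le_lt_trans (HC y y0)) ?ltry.
rewrite -(fineK Nfin) lee_fin -ler_pdivrMr// -lee_fin fineK//.
apply: le_ereal_inf_tmp => _ [C' HC' <-]; rewrite lee_fin ler_pdivrMr//.
by rewrite -lee_fin fineK//; exact: HC'.
Qed.

(** Applied to the optimal constant r of f, the estimates give
   A (||f|| + r) for the sup norm and A r for the seminorm. *)
Lemma smoothing_multiplier_bounded (a : R -> R) (Ma : R) :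
  measurable_fun (`[0, +oo[ : set R) a -> (forall s : R, 0 <= s -> `|a s| <= Ma) ->
  0 < alpha -> multiplier_bounded mu P a alpha.
Proof.
move=> ma a_le alpha0.
have [A A0 H] := multiplier_estimatesP HK PE ma a_le alpha0.
have est f C : f \in Lfun mu +oo -> Lambda_bound mu P alpha f C ->
    multiplier_estimates mu K K' P a alpha A f (fine 'N[mu]_(+oo)[EFin \o f]) C.
  move=> /Lfun_ess_bounded fF HC; have C0 := Lambda_bound_ge0 HC.
  have F0 : 0 <= fine 'N[mu]_(+oo)[EFin \o f] by rewrite fine_ge0// Lnorm_ge0.
  by apply: H => //; exact/(Lambda_bound_growth fF F0 C0).
split; first by move=> f [fL [C HC]]; have [] := est f C fL HC.
exists (2 * A) => f [fL [C0 HC0]].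
have [r [rE Hr]] := Lambda_bound_inf HC0; have r0 := Lambda_bound_ge0 Hr.
have [_ mT TB TL] := est f r fL Hr.
set F := fine _ in TB TL; have F0 : 0 <= F by rewrite fine_ge0// Lnorm_ge0.
have FE : ('N[mu]_(+oo)[EFin \o f] = F%:E)%E.
  rewrite fineK// ge0_fin_numE ?Lnorm_ge0//.
  by move: fL; rewrite inE => /andP[_]; rewrite inE.
have AF : 0 <= A * (F + r) by rewrite mulr_ge0// addr_ge0.
have Ar : 0 <= A * r by rewrite mulr_ge0.
have bT : ess_bounded mu (multiplier P a f) (A * (F + r)) by exact: ess_boundedT.
have LT : Lambda_bound mu P alpha (multiplier P a f) (A * r).
  by apply/(Lambda_bound_growth bT AF Ar) => y y0; apply: aeW => p; exact: TL.
split.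
  by split; [exact: ess_bounded_Lfun bT|exists (A * r)].
have -> : (Lambda_norm mu P alpha f = (F + r)%:E)%E by rewrite /Lambda_norm rE FE.
rewrite /Lambda_norm.
apply: (@le_trans _ _ ((A * (F + r))%:E + (A * r)%:E)%E).
  apply: leeD; first by apply/Lnorm_leP => //; case: bT.
  by apply: ereal_inf_lbound; exists (A * r).
have := mulr_ge0 A0 F0; rewrite -EFinD -EFinM lee_fin; lra.
Qed.

End SmoothingMultiplierBounded.

(** * The one-sided stable density of index one half *)
Section GaussianPrimitive.
Context (R : realType).
Local Notation leb := (@lebesgue_measure R).

(** The primitive in which the integrals of [levy] are expressed. *)
Definition gauss_cdf (u : R) : R :=
  \int[leb]_(x in `]-oo, u]) normal_pdf 0 1 x.

Definition gauss_peak : R := (Num.sqrt (2 * pi))^-1.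

Lemma normal_pdf01 x : normal_pdf 0 1 x = gauss_peak * expR (- (x ^+ 2 / 2)) :> R.
Proof.
rewrite normal_pdfE ?oner_neq0// /normal_peak /normal_fun subr0 expr1n mul1r.
by rewrite /gauss_peak mulr_natl mulNr.
Qed.

Lemma is_derive_gauss_cdf (u : R) :
  is_derive u 1 (gauss_cdf : R -> R^o) (gauss_peak * expR (- (u ^+ 2 / 2))).
Proof.
have i : leb.-integrable setT (EFin \o (@normal_pdf R 0 1)).
  exact: integrable_normal_pdf.
have u1 : u < u + 1 by rewrite ltrDl.
have iu : leb.-integrable [set` Interval -oo%O (BRight (u + 1))]
    (EFin \o (@normal_pdf R 0 1)) by apply: integrableS i.
have Nyu : (-oo%O < BRight u)%E by rewrite ltNyr.
have [d1 d2] := continuous_FTC1 u1 iu Nyu (@continuous_normal_pdf R 0 1 (oner_neq0 _) u).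
by apply: DeriveDef => //; rewrite -derive1E d2 normal_pdf01.
Qed.

Let idTR : measurableTypeR R -> R := idfun.

#[local] HB.instance Definition _ :=
  @isMeasurableFun.Build _ _ _ _ idTR (@measurable_id _ _ setT).

Lemma cvg_gauss_cdf_y : gauss_cdf u @[u --> +oo] --> (1 : R).
Proof.
exact: (fine_cvg (@cvg_cdfy1 _ _ _ _ (idTR : {RV (normal_prob 0 1) >-> R}))).
Qed.

Lemma cvg_gauss_cdf_Ny : gauss_cdf u @[u --> -oo] --> (0 : R).
Proof.
exact: (fine_cvg (@cvg_cdfNy0 _ _ _ _ (idTR : {RV (normal_prob 0 1) >-> R}))).
Qed.

End GaussianPrimitive.

Section LevyDensity.
Context (R : realType).
Local Notation leb := (@lebesgue_measure R).
Implicit Types (y s t b : R).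

(** The density in t of the first hitting time of y / sqrt 2 by Brownian motion; its
   Laplace transform is lambda |-> e^(- y sqrt lambda), which is why it
   subordinates the heat semigroup to the Poisson semigroup. *)
Definition levy y t : R :=
  y / (2 * Num.sqrt pi) * expR (- (y ^+ 2 / (4 * t))) / t `^ (3 / 2).

Let kappa : R := (2 * Num.sqrt pi)^-1.

Let sqrtpi_gt0 : 0 < Num.sqrt (pi : R).
Proof. by rewrite sqrtr_gt0 pi_gt0. Qed.

Let kappa_gt0 : 0 < kappa.
Proof. by rewrite invr_gt0 mulr_gt0. Qed.

Let kappa_le1 : kappa <= 1.
Proof.
rewrite invf_le1 ?mulr_gt0//; have : 1 <= Num.sqrt (pi : R).
  rewrite -(@sqrtr1 R) ler_sqrt ?pi_gt0// (le_trans _ (pi_ge2 R))// ler1n//.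
by move=> h; lra.
Qed.

Lemma powR32 t : 0 < t -> t `^ (3 / 2) = t * Num.sqrt t.
Proof.
move=> t0; rewrite (_ : 3 / 2 = 1 + 2^-1); last by field.
rewrite powRD; last by rewrite [t == 0]gt_eqF// implybT.
by rewrite powRr1 ?powR12_sqrt ?ltW.
Qed.

Lemma levyE y t : 0 < t -> levy y t =
  kappa / (t * Num.sqrt t) * (y * expR (- (y ^+ 2 / (4 * t)))).
Proof. by move=> t0; rewrite /levy powR32// /kappa; ring. Qed.

Lemma levy_ge0 y t : 0 < y -> 0 <= levy y t.
Proof.
by move=> y0; rewrite /levy !mulr_ge0 ?expR_ge0 ?invr_ge0 ?powR_ge0 ?mulr_ge0// ltW.
Qed.

Lemma is_derive_sqr_exp (g x : R) :
  is_derive x 1 (fun z : R => z * expR (- (g * z ^+ 2)) : R^o)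
    (expR (- (g * x ^+ 2)) * (1 - 2 * g * x ^+ 2)).
Proof.
have d1 : is_derive x 1 (fun z : R => - (g * z ^+ 2) : R^o) (- (g * (2 * x))).
  have dx : is_derive x 1 (fun z : R => z : R^o) 1 by exact: is_derive_id.
  have d2 := is_deriveN (is_deriveZ g (is_deriveM dx dx)).
  rewrite (_ : (fun z : R => - (g * z ^+ 2) : R^o) =
    - (g \*: ((fun z : R => z : R^o) * (fun z : R => z : R^o)))); last first.
    by apply/funext => z; rewrite !fctE /GRing.scale/= expr2.
  by apply: is_derive_eq d2 _; rewrite /GRing.scale/=; ring.
have d3 := @is_derive1_comp R expR (fun z => - (g * z ^+ 2)) x _ _
  (is_derive_expR (- (g * x ^+ 2))) d1.
have dx : is_derive x 1 (fun z : R => z : R^o) 1 by exact: is_derive_id.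
apply: is_derive_eq (is_deriveM dx d3) _.
by rewrite /GRing.scale/=; ring.
Qed.

Lemma is_derive_levy y t : 0 < y -> 0 < t ->
  is_derive y 1 (fun z => levy z t : R^o) (levy y t * (y^-1 - y / (2 * t))).
Proof.
move=> y0 t0.
rewrite (_ : (fun z => levy z t : R^o) = (kappa / (t * Num.sqrt t)) \*:
    (fun z : R => z * expR (- ((4 * t)^-1 * z ^+ 2)) : R^o)); last first.
  by apply/funext => z; rewrite levyE// /GRing.scale/= [_^-1 * _]mulrC.
apply: is_derive_eq (is_deriveZ _ (is_derive_sqr_exp (4 * t)^-1 y)) _.
rewrite levyE// /GRing.scale/= [_^-1 * y ^+ 2]mulrC.
have s0 : Num.sqrt t != 0 by rewrite gt_eqF// sqrtr_gt0.
by field; rewrite ?s0 ?gt_eqF.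
Qed.

Lemma levy_ratio y s t : 0 < s -> 0 < t ->
  levy y t = y / s * expR ((s ^+ 2 - y ^+ 2) / (4 * t)) * levy s t.
Proof.
move=> s0 t0; rewrite !levyE//.
have -> : - (y ^+ 2 / (4 * t)) = (s ^+ 2 - y ^+ 2) / (4 * t) + - (s ^+ 2 / (4 * t)).
  by field; rewrite gt_eqF.
rewrite expRD; set E1 := expR _; set E2 := expR _; set k := kappa / _.
by field; rewrite gt_eqF.
Qed.

Lemma levy_harnack y s t : 0 < y -> 0 < t -> y / 2 < s < 2 * y ->
  levy s t <= 4 * levy (y / 2) t.
Proof.
move=> y0 t0 /andP[ys sy]; have y20 : 0 < y / 2 by rewrite divr_gt0.
have s0 : 0 < s by exact: lt_trans ys.
rewrite (levy_ratio s y20 t0) ler_wpM2r ?levy_ge0//.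
have p0 : 0 <= s / (y / 2) by rewrite divr_ge0// ltW.
rewrite -[leRHS]mulr1; apply: ler_pM; rewrite ?expR_ge0//.
  by rewrite ler_pdivrMr//; lra.
rewrite -[leRHS]expR0 ler_expR mulr_le0_ge0 ?invr_ge0 ?mulr_ge0 ?(ltW t0)//.
by rewrite subr_le0; apply: lerXn2r; rewrite ?nnegrE; exact: ltW.
Qed.

(** With v = y^2 / (4t), passing from y to y/2 gains e^(- 3v/4), which absorbs the
   factor |1 - 2v|. *)
Lemma levy_derive_le y t : 0 < y -> 0 < t ->
  `|levy y t * (y^-1 - y / (2 * t))| <= 6 / y * levy (y / 2) t.
Proof.
move=> y0 t0; have y20 : 0 < y / 2 by rewrite divr_gt0.
have L0 := levy_ge0 t y20.
rewrite (levy_ratio y y20 t0) normrM normrM (ger0_norm L0).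
rewrite normrM (ger0_norm (expR_ge0 _)).
have -> : y / (y / 2) = 2 by field; rewrite gt_eqF.
rewrite (ger0_norm (ler0n _ 2)).
pose v := y ^+ 2 / (4 * t).
have v0 : 0 <= v by rewrite /v divr_ge0 ?sqr_ge0// mulr_ge0// ltW.
have -> : (((y / 2) ^+ 2 - y ^+ 2) / (4 * t)) = - (3 / 4 * v).
  by rewrite /v; field; rewrite gt_eqF.
have -> : y^-1 - y / (2 * t) = y^-1 * (1 - 2 * v).
  by rewrite /v; field; rewrite !gt_eqF.
rewrite normrM (gtr0_norm (_ : 0 < y^-1)) ?invr_gt0//.
have n2 : `|1 - 2 * v| <= 1 + 2 * v.
  by rewrite (le_trans (ler_normB _ _))// normr1 ger0_norm// mulr_ge0.
have e1 : expR (- (3 / 4 * v)) * (1 + 2 * v) <= 3.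
  rewrite expRN mulrC ler_pdivrMr ?expR_gt0//.
  have := expR_ge1Dx (3 / 4 * v); lra.
rewrite mulrAC ler_wpM2r//.
have e2 : expR (- (3 / 4 * v)) * `|1 - 2 * v| <= 3.
  by apply: le_trans e1; rewrite ler_wpM2l ?expR_ge0.
have -> : 2 * expR (- (3 / 4 * v)) * (y^-1 * `|1 - 2 * v|) =
  (2 * (expR (- (3 / 4 * v)) * `|1 - 2 * v|)) / y by ring.
by rewrite ler_wpM2r ?invr_ge0 ?(ltW y0)//; lra.
Qed.

(** With r = y / sqrt t, the claim is a bound for r^3 e^(- r^2 / 4). *)
Lemma levy_decay y t : 0 < y -> 0 < t -> levy y t <= 12 / y ^+ 2.
Proof.
move=> y0 t0; rewrite levyE//; pose r := y / Num.sqrt t.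
have st : 0 < Num.sqrt t by rewrite sqrtr_gt0.
have r0 : 0 < r by rewrite divr_gt0.
have tE : t = Num.sqrt t ^+ 2 by rewrite sqr_sqrtr// ltW.
have -> : y ^+ 2 / (4 * t) = r ^+ 2 / 8 + r ^+ 2 / 8.
  by rewrite {1}tE /r; field; rewrite gt_eqF.
have -> : kappa / (t * Num.sqrt t) * (y * expR (- (r ^+ 2 / 8 + r ^+ 2 / 8)))
    = (kappa * r ^+ 3 * expR (- (r ^+ 2 / 8 + r ^+ 2 / 8))) / y ^+ 2.
  by rewrite {1}tE /r; field; rewrite !gt_eqF.
rewrite ler_wpM2r ?invr_ge0 ?sqr_ge0//.
rewrite expRN expRD ler_pdivrMr ?mulr_gt0 ?expR_gt0//.
apply: (@le_trans _ _ (r ^+ 3)).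
  by rewrite ler_piMl// exprn_ge0// ltW.
have h := expR_ge1Dx (r ^+ 2 / 8).
have h0 : 0 <= 1 + r ^+ 2 / 8 by rewrite addr_ge0// divr_ge0 ?sqr_ge0.
apply: (@le_trans _ _ (12 * ((1 + r ^+ 2 / 8) * (1 + r ^+ 2 / 8)))); last first.
  by rewrite ler_wpM2l//; apply: ler_pM.
(* 12 (1 + r^2 / 8)^2 - r^3 is a sum of squares, by completing the square in r. *)
have -> : 12 * ((1 + r ^+ 2 / 8) * (1 + r ^+ 2 / 8)) =
    r ^+ 3 + (12 + r ^+ 2 * (3 / 16 * (r - 8 / 3) ^+ 2 + 5 / 3)) by field.
by rewrite lerDl addr_ge0// mulr_ge0 ?sqr_ge0// addr_ge0// mulr_ge0 ?sqr_ge0.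
Qed.

Lemma measurable_levy : measurable_fun setT (fun z : R * R => levy z.1 z.2).
Proof.
have m1 : measurable_fun setT (fun z : R * R => z.1) by exact: measurable_fst.
have m2 : measurable_fun setT (fun z : R * R => z.2) by exact: measurable_snd.
apply: measurable_funM; last first.
  apply: (measurableT_comp (@measurable_invr R) (g := fun z : R * R => z.2 `^ (3 / 2))).
  exact: (measurableT_comp (@measurable_powR R (3 / 2)) m2).
apply: measurable_funM; first exact: measurable_funM.
apply: (measurableT_comp (@measurable_expR R)).
apply: (measurableT_comp (@oppr_measurable R setT)).
apply: measurable_funM; first exact: measurable_funX.
apply: (measurableT_comp (@measurable_invr R) (g := fun z : R * R => 4 * z.2)).
exact: measurable_funM.
Qed.

End LevyDensity.

Section LevyIntegrals.
Context (R : realType).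
Local Notation leb := (@lebesgue_measure R).
Implicit Types (y s t b : R).

Lemma continuous_levy y t : 0 < t -> {for t, continuous (fun z => levy y z)}.
Proof.
move=> t0; have cm (f g : R -> R) : {for t, continuous f} -> {for t, continuous g} ->
  {for t, continuous (fun z => f z * g z)} by move=> cf cg; exact: (continuousM cf cg).
have cV (f : R -> R) : f t != 0 -> {for t, continuous f} ->
  {for t, continuous (fun z => (f z)^-1)} by move=> f0 cf; exact: (continuousV f0 cf).
have cE (f : R -> R) : {for t, continuous f} -> {for t, continuous (fun z => expR (f z))}.
  by move=> cf; exact: (continuous_comp cf (@continuous_expR _ _)).
have cN (f : R -> R) : {for t, continuous f} -> {for t, continuous (fun z => - f z)}.
  by move=> cf; exact: (continuousN cf).
have cc (r : R) : {for t, continuous (fun=> r)} by exact: cvg_cst.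
have ci : {for t, continuous (fun z : R => z)} by exact: cvg_id.
apply: (cm _ (fun z => (z `^ (3 / 2))^-1)).
  apply: (cm (fun=> y / (2 * Num.sqrt pi)) (fun z => expR (- (y ^+ 2 / (4 * z))))) => //.
  apply: (cE (fun z => - (y ^+ 2 / (4 * z)))).
  apply: (cN (fun z => y ^+ 2 / (4 * z))); apply: (cm (fun=> y ^+ 2) (fun z => (4 * z)^-1)) => //.
  apply: (cV (fun z => 4 * z)); first by rewrite mulf_neq0// gt_eqF.
  exact: (cm (fun=> 4) (fun z => z)).
apply: (cV (fun z => z `^ (3 / 2))); first by rewrite gt_eqF// powR_gt0.
exact: is_derive_continuous (is_derive1_powR (3 / 2) t0).
Qed.

Lemma cvg_sqrtV_0 : (Num.sqrt x)^-1 @[x --> (0 : R)^'+] --> +oo.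
Proof.
apply/cvgryPge => A; near=> x.
have x0 : 0 < x by near: x; exact: nbhs_right_gt.
have B0 : 0 < `|A| + 1 by rewrite ltr_pwDr.
apply: (@le_trans _ _ (`|A| + 1)).
  by rewrite (le_trans (ler_norm _))// lerDl.
rewrite -[leLHS]invrK lef_pV2 ?posrE ?sqrtr_gt0 ?invr_gt0//.
rewrite -[leRHS](@ger0_norm _ _ (_ : 0 <= (`|A| + 1)^-1)) ?invr_ge0 ?(ltW B0)//.
rewrite -sqrtr_sqr ler_sqrt ?exprn_gt0 ?invr_gt0//.
near: x; apply: nbhs_right_le; rewrite exprn_gt0// invr_gt0//.
Unshelve. all: by end_near. Qed.

Lemma cvg_sqrtV_y : (Num.sqrt x)^-1 @[x --> +oo] --> (0 : R).
Proof.
apply: cvg_trans (@cvg_powRN_y R 2^-1 _); last by rewrite invr_gt0.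
apply: near_eq_cvg; near=> x.
by rewrite powRN powR12_sqrt//; near: x; exact: nbhs_pinfty_ge.
Unshelve. all: by end_near. Qed.

Lemma is_derive_sqrtV t : 0 < t ->
  is_derive t 1 (fun x : R => (Num.sqrt x)^-1 : R^o) (- (2 * t * Num.sqrt t)^-1).
Proof.
move=> t0; have s0 : Num.sqrt t != 0 by rewrite gt_eqF// sqrtr_gt0.
apply: is_derive_eq (is_deriveV s0 (is_derive1_sqrt t0)) _.
by rewrite /GRing.scale/= sqr_sqrtr ?(ltW t0)//; field; rewrite s0 gt_eqF.
Qed.

Lemma gauss_peakE : @gauss_peak R = (Num.sqrt 2 * Num.sqrt pi)^-1.
Proof. by rewrite /gauss_peak sqrtrM. Qed.

(** The function -2 gauss_cdf (y / sqrt (2 t)) is a primitive. The integral is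
   in fact 1. *)
Lemma integral_levy y : 0 < y ->
  (\int[leb]_(t in `]0%R, +oo[) (levy y t)%:E <= 2%:E)%E.
Proof.
move=> y0; have s2 : 0 < Num.sqrt (2 : R) by rewrite sqrtr_gt0.
have sp : 0 < Num.sqrt (pi : R) by rewrite sqrtr_gt0 pi_gt0.
have s2s : Num.sqrt (2 : R) ^+ 2 = 2 by rewrite sqr_sqrtr.
pose U t := y / Num.sqrt 2 * (Num.sqrt t)^-1.
pose F t := -2 * gauss_cdf (U t).
have dU t : 0 < t ->
    is_derive t 1 (U : R -> R^o) (- (y / Num.sqrt 2 / (2 * t * Num.sqrt t))).
  move=> t0; apply: is_derive_eq (is_deriveZ _ (is_derive_sqrtV t0)) _.
  by rewrite /GRing.scale/= mulrN.
suff -> : (\int[leb]_(t in `]0%R, +oo[) (levy y t)%:E = (-2 * gauss_cdf 0 - -2)%:E)%E.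
  rewrite lee_fin; have : 0 <= gauss_cdf (0 : R).
    by apply: Rintegral_ge0 => x _; exact: normal_pdf_ge0.
  by move=> h; lra.
apply: (@ge0_integral_oy R (levy y) F).
- by move=> x x0; exact: levy_ge0.
- by move=> x x0; exact: continuous_levy.
- move=> x x0.
  have h := is_deriveZ (-2) (@is_derive1_comp R (@gauss_cdf R) U x _ _
    (is_derive_gauss_cdf (U x)) (dU x x0)).
  apply: is_derive_eq h _; rewrite levyE// /GRing.scale/= gauss_peakE.
  have -> : U x ^+ 2 / 2 = y ^+ 2 / (4 * x).
    rewrite /U !exprMn exprVn s2s exprVn sqr_sqrtr ?(ltW x0)//.
    by field; rewrite gt_eqF.
  set E := expR _; have sx : 0 < Num.sqrt x by rewrite sqrtr_gt0.
  have -> : -2 * ((Num.sqrt 2 * Num.sqrt pi)^-1 * E *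
      - (y / Num.sqrt 2 / (2 * x * Num.sqrt x))) =
      (2 / Num.sqrt 2 ^+ 2) * (y * E / (2 * Num.sqrt pi * x * Num.sqrt x)).
    by field; rewrite !gt_eqF.
  by rewrite s2s; field; rewrite !gt_eqF.
- rewrite -[X in _ --> X]mulr1; apply: cvgM; first exact: cvg_cst.
  apply: (@cvg_comp _ _ _ U (@gauss_cdf R) _ (@pinfty_nbhs R));
    last exact: cvg_gauss_cdf_y.
  by apply: gt0_cvgMry; [rewrite divr_gt0|exact: cvg_sqrtV_0].
- apply: cvgM; first exact: cvg_cst.
  apply: (@cvg_comp _ _ _ U (@gauss_cdf R) _ (nbhs (0 : R))); last first.
    exact: is_derive_continuous (is_derive_gauss_cdf 0).
  have : U x @[x --> +oo] --> y / Num.sqrt 2 * 0.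
    by apply: cvgM; [exact: cvg_cst|exact: cvg_sqrtV_y].
  by rewrite mulr0; exact.
Qed.

End LevyIntegrals.

Section LevyConvolution.
Context (R : realType).
Local Notation leb := (@lebesgue_measure R).
Implicit Types (y s t b : R).

Lemma cvg_addr_invr_y (u c : R) : 0 < u -> u * x + c * x^-1 @[x --> +oo] --> +oo.
Proof.
move=> u0; apply/cvgryPge => A; near=> x.
have x0 : 0 < x by near: x; exact: nbhs_pinfty_gt.
have x1 : 1 <= x by near: x; apply: nbhs_pinfty_ge; exact: num_real.
have xA : (`|A| + `|c|) / u <= x by near: x; apply: nbhs_pinfty_ge; exact: num_real.
move: xA; rewrite ler_pdivrMr// mulrC => xA.
have cx : - `|c| <= c * x^-1.
  rewrite lerNl (le_trans (ler_norm _))// normrN normrM ler_piMr// ger0_norm.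
    by rewrite invf_le1.
  by rewrite invr_ge0 ltW.
by have := ler_norm A; lra.
Unshelve. all: by end_near. Qed.

Lemma cvg_addr_invr_0 (u c : R) : 0 <= u -> 0 < c ->
  u * x + c * x^-1 @[x --> 0^'+] --> +oo.
Proof.
move=> u0 c0; apply/cvgryPge => A; near=> x.
have x0 : 0 < x by near: x; exact: nbhs_right_gt.
have A0 : 0 < `|A| + 1 by rewrite ltr_pwDr.
have xA : x <= c / (`|A| + 1) by near: x; apply: nbhs_right_le; exact: divr_gt0.
move: xA; rewrite ler_pdivlMr// => xA.
have : `|A| + 1 <= c * x^-1 by rewrite ler_pdivlMr// mulrC.
by have := mulr_ge0 u0 (ltW x0); have := ler_norm A; lra.
Unshelve. all: by end_near. Qed.

Lemma cvg_subr_invr_0 (u c : R) : 0 <= u -> 0 < c ->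
  u * x - c * x^-1 @[x --> 0^'+] --> -oo.
Proof.
move=> u0 c0; apply/cvgrNyPle => A.
have A0 : 0 < `|A| + u + 1 by rewrite ltr_pwDr// addr_ge0.
near=> x.
have x0 : 0 < x by near: x; exact: nbhs_right_gt.
have x1 : x <= 1 by near: x; exact: nbhs_right_le.
have xA : x <= c / (`|A| + u + 1) by near: x; apply: nbhs_right_le; exact: divr_gt0.
move: xA; rewrite ler_pdivlMr// => xA.
have : `|A| + u + 1 <= c * x^-1 by rewrite ler_pdivlMr// mulrC.
have : u * x <= u by rewrite ler_piMr.
by have := ler_norm (- A); rewrite normrN; lra.
Unshelve. all: by end_near. Qed.

Let rho b t : R := Num.sqrt (b / t - 1).

Let rho_gt0 b t : 0 < t < b -> 0 < b / t - 1.
Proof. by move=> /andP[t0 tb]; rewrite subr_gt0 ltr_pdivlMr// mul1r. Qed.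

Let is_derive_rho b t : 0 < t < b ->
  is_derive t 1 (rho b : R -> R^o) (- (b / t ^+ 2 / (2 * rho b t))).
Proof.
move=> tb; have /andP[t0 _] := tb; have r0 := rho_gt0 tb.
have dV : is_derive t 1 (fun z : R => b / z - 1 : R^o) (- (b / t ^+ 2)).
  have dx : is_derive t 1 (fun z : R => z : R^o) 1 by exact: is_derive_id.
  have d := is_deriveB (is_deriveZ b (is_deriveV (lt0r_neq0 t0) dx)) (is_derive_cst (1 : R^o) t 1).
  by apply: is_derive_eq d _; rewrite /GRing.scale/= subr0 mulr1 mulrN.
apply: is_derive_eq (@is_derive1_comp R Num.sqrt _ t _ _ (is_derive1_sqrt r0) dV) _.
by rewrite mulrN mulrC.
Qed.

Let cvg_rho_0 b : 0 < b -> rho b t @[t --> 0^'+] --> +oo.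
Proof.
move=> b0; apply/cvgryPge => A.
have A0 : 0 < A ^+ 2 + 1 by rewrite ltr_pwDr// sqr_ge0.
near=> t.
have t0 : 0 < t by near: t; exact: nbhs_right_gt.
have tA : t <= b / (A ^+ 2 + 1) by near: t; apply: nbhs_right_le; exact: divr_gt0.
rewrite (le_trans (ler_norm A))// -sqrtr_sqr ler_wsqrtr//.
by rewrite lerBrDr ler_pdivlMr// mulrC -ler_pdivlMr.
Unshelve. all: by end_near. Qed.

Let cvg_rho_b b : 0 < b -> rho b t @[t --> b^'-] --> 0^'+.
Proof.
move=> b0; have c : {for b, continuous (rho b)}.
  have cc (r : R) : {for b, continuous (fun=> r)} by exact: cvg_cst.
  have ci : {for b, continuous (fun z : R => z)} by exact: cvg_id.
  have cV : {for b, continuous (fun z : R => b * z^-1)}.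
    by apply: (continuousM (cc _)); apply: (continuousV _ ci); exact: lt0r_neq0.
  exact: (continuous_comp (continuousB cV (cc 1)) (@sqrt_continuous _ _)).
move=> A [e /= e0 Ae].
have h : rho b t @[t --> b^'-] --> rho b b by exact: cvg_at_left_filter.
have rb : rho b b = 0 by rewrite /rho divff ?lt0r_neq0// subrr sqrtr0.
rewrite rb in h; suff : \forall t \near b^'-, A (rho b t) by [].
near=> t.
have tb : 0 < t < b.
  by apply/andP; split; near: t; [exact: nbhs_left_gt|exact: nbhs_left_lt].
apply: Ae; last by rewrite sqrtr_gt0 rho_gt0.
by near: t; exact: (h _ (nbhsx_ballx _ _ e0)).
Unshelve. all: by end_near. Qed.

(** The integrand has the primitive
     G = - (al * gauss_cdf U + be' * gauss_cdf V),
   where U = (y x - s / x) / sqrt (2 b), V = (y x + s / x) / sqrt (2 b) and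
   x = sqrt (b / t - 1). Indeed, U^2 / 2 = y^2 / (4 t) + s^2 / (4 (b - t))
   - (y + s)^2 / (4 b), and V^2 / 2 = U^2 / 2 + y s / b, so that both terms of the
   derivative carry the same exponential; al and be are then determined by
   the two powers of x which occur. When t goes to 0, x goes to +oo and so do
   U and V; when t goes to b, x goes to 0, U to -oo and V to +oo. The terms in V
   cancel and the integral is al. *)
Lemma levy_convolution y s b : 0 < y -> 0 < s -> 0 < b ->
  (\int[leb]_(t in `]0%R, b[) (levy y t * levy s (b - t))%:E = (levy (y + s) b)%:E)%E.
Proof.
move=> y0 s0 b0; pose d : R := Num.sqrt (2 * b).
have d0 : 0 < d by rewrite sqrtr_gt0 mulr_gt0.
have dE : d ^+ 2 = 2 * b by rewrite sqr_sqrtr// mulr_ge0// ltW.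
have dV0 : 0 < d^-1 by rewrite invr_gt0.
have pk0 : 0 < @gauss_peak R by rewrite invr_gt0 sqrtr_gt0 mulr_gt0// pi_gt0.
have sp : 0 < Num.sqrt (pi : R) by rewrite sqrtr_gt0 pi_gt0.
have spE : Num.sqrt (pi : R) ^+ 2 = pi by rewrite sqr_sqrtr// pi_ge0.
pose E := expR (- ((y + s) ^+ 2 / (4 * b))).
(* k is the value for which the derivative of the primitive is the integrand;
   al + be = k / y and al - be = k / s match the powers of x. *)
pose k := y * s * E * d / (2 * Num.sqrt pi ^+ 2 * @gauss_peak R * b ^+ 2).
pose al := k / 2 * (y^-1 + s^-1); pose be := k / 2 * (y^-1 - s^-1).
pose be' := be * expR (y * s / b).
pose U (x : R) : R := (y * x + - s * x^-1) * d^-1.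
pose V (x : R) : R := (y * x + s * x^-1) * d^-1.
pose G x := - (al * gauss_cdf (U x) + be' * gauss_cdf (V x)).
have dw (c x : R) : 0 < x ->
    is_derive x 1 (fun x : R => (y * x + c * x^-1) * d^-1 : R^o) ((y - c / x ^+ 2) / d).
  move=> x0; have dx : is_derive x 1 (fun z : R => z : R^o) 1 by exact: is_derive_id.
  have h := is_deriveZ d^-1 (is_deriveD (is_deriveZ y dx)
    (is_deriveZ c (is_deriveV (lt0r_neq0 x0) dx))).
  rewrite (_ : (fun x : R => _ : R^o) = d^-1 \*: (y \*: (fun z : R => z : R^o) +
    (c \*: (fun z : R => z^-1 : R^o)))); last first.
    by apply/funext => z; rewrite !fctE /GRing.scale/= mulrC.
  by apply: is_derive_eq h _; rewrite /GRing.scale/= !mulr1 mulrN mulrC.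
have dG (x : R) : 0 < x -> is_derive x 1 (G : R -> R^o)
    (- (k * @gauss_peak R / d * expR (- (U x ^+ 2 / 2)) * (1 + (x ^+ 2)^-1))).
  move=> x0; have h := is_deriveN (is_deriveD
    (is_deriveZ al (@is_derive1_comp R (@gauss_cdf R) U x _ _
       (is_derive_gauss_cdf (U x)) (dw (- s) x x0)))
    (is_deriveZ be' (@is_derive1_comp R (@gauss_cdf R) V x _ _
       (is_derive_gauss_cdf (V x)) (dw s x x0)))).
  apply: is_derive_eq h _; rewrite /GRing.scale/=; congr (- _).
  have -> : - (V x ^+ 2 / 2) = - (U x ^+ 2 / 2) + - (y * s / b).
    have -> : V x ^+ 2 = U x ^+ 2 + 4 * y * s / d ^+ 2.
      by rewrite /V /U; field; rewrite !gt_eqF.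
    by rewrite dE; field; rewrite gt_eqF.
  rewrite expRD [expR (- (y * s / b))]expRN /be'.
  have := expR_gt0 (y * s / b); set e1 := expR (y * s / b).
  set e2 := expR _ => e10; rewrite /al /be.
  by field; rewrite !gt_eqF.
(* The limits of the primitive at b and at 0 are - be' and - (al + be'). *)
have GE : levy (y + s) b = - be' - - (al + be').
  rewrite levyE// /al /k gauss_peakE -/E.
  have sb : d = Num.sqrt 2 * Num.sqrt b by rewrite /d sqrtrM.
  have s2 : 0 < Num.sqrt (2 : R) by rewrite sqrtr_gt0.
  have s2s : Num.sqrt (2 : R) ^+ 2 = 2 by rewrite sqr_sqrtr.
  have rb : 0 < Num.sqrt b by rewrite sqrtr_gt0.
  have bE : b = Num.sqrt b ^+ 2 by rewrite sqr_sqrtr// ltW.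
  rewrite sb; set B := Num.sqrt b in rb bE *; rewrite bE.
  rewrite (_ : - be' - _ = y * s * E * (Num.sqrt 2 * B) / (2 * Num.sqrt pi ^+ 2 *
    (Num.sqrt 2 * Num.sqrt pi)^-1 * (B ^+ 2) ^+ 2) / 2 * (y^-1 + s^-1)); last by ring.
  rewrite (_ : _ * (y^-1 + s^-1) = (Num.sqrt 2 ^+ 2 / 2) *
    (2 * Num.sqrt pi)^-1 / (B ^+ 2 * B) * ((y + s) * E)); last first.
    by field; rewrite !gt_eqF.
  by rewrite s2s; field; rewrite !gt_eqF.
have dF (t : R) : 0 < t < b ->
    is_derive t 1 ((fun t => G (rho b t)) : R -> R^o) (levy y t * levy s (b - t)).
  move=> tb; have /andP[t0 tb'] := tb; have r0 : 0 < rho b t by rewrite sqrtr_gt0 rho_gt0.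
  have r2 : rho b t ^+ 2 = b / t - 1 by rewrite sqr_sqrtr// ltW// rho_gt0.
  apply: is_derive_eq (@is_derive1_comp R G (rho b) t _ _ (dG _ r0) (is_derive_rho tb)) _.
  have bt0 : 0 < b - t by rewrite subr_gt0.
  have st0 : 0 < Num.sqrt t by rewrite sqrtr_gt0.
  have tE : Num.sqrt t ^+ 2 = t by rewrite sqr_sqrtr// ltW.
  have btE : b - t = (rho b t * Num.sqrt t) ^+ 2.
    by rewrite exprMn r2 tE; field; rewrite gt_eqF.
  rewrite !levyE//.
  have -> : Num.sqrt (b - t) = rho b t * Num.sqrt t.
    by rewrite btE sqrtr_sqr ger0_norm// mulr_ge0// ltW.
  have -> : - (U (rho b t) ^+ 2 / 2) = - (y ^+ 2 / (4 * t)) + - (s ^+ 2 / (4 * (b - t)))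
      + ((y + s) ^+ 2 / (4 * b)).
    have -> : U (rho b t) ^+ 2 = (y * rho b t - s / rho b t) ^+ 2 / (2 * b).
      by rewrite /U exprMn exprVn dE mulNr.
    have b1 : b = t * (1 + rho b t ^+ 2) by rewrite r2; field; rewrite gt_eqF.
    move: b1 r0; move: (rho b t) => r b1 r0.
    have -> : b - t = t * r ^+ 2 by rewrite b1; ring.
    rewrite b1.
    have r1 : 0 < 1 + r ^+ 2 by rewrite ltr_pwDl// sqr_ge0.
    by field; rewrite ?mulf_neq0 ?gt_eqF.
  rewrite expRD expRD -[expR ((y + s) ^+ 2 / _)]invrK -expRN -/E.
  move: btE; have : b = Num.sqrt t ^+ 2 * (1 + rho b t ^+ 2).
    by rewrite r2 tE; field; rewrite gt_eqF.
  have E0 : 0 < E by exact: expR_gt0.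
  rewrite /k; move: tE d0 pk0 sp r0 st0 E0; clear.
  move: (rho b t) (Num.sqrt t) E (expR _) (expR _) d gauss_peak (Num.sqrt pi).
  move=> r w E e1 e2 d g p <- d0 g0 p0 r0 w0 E0 bE ->.
  have r1 : 0 < 1 + r ^+ 2 by rewrite ltr_pwDl// sqr_ge0.
  by rewrite bE; field; rewrite ?mulf_neq0 ?gt_eqF.
rewrite GE; apply: (ge0_integral_oo b0 _ _ dF).
- move=> t /andP[t0 tb]; apply: mulr_ge0; apply: levy_ge0 => //.
- move=> t /andP[t0 tb].
  have cb : {for t, continuous (fun t : R => b - t)}.
    by apply: continuousB; [exact: cvg_cst|exact: cvg_id].
  apply: continuousM; first exact: continuous_levy.
  by apply: (continuous_comp cb); apply: continuous_levy; rewrite subr_gt0.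
- have -> : - (al + be') = - (al * 1 + be' * 1) by rewrite !mulr1.
  apply: (@cvg_comp _ _ _ (rho b) G _ (@pinfty_nbhs R)); first exact: cvg_rho_0.
  apply: cvgN; apply: cvgD; apply: cvgM; try exact: cvg_cst.
    apply: (@cvg_comp _ _ _ U (@gauss_cdf R) _ (@pinfty_nbhs R)); last exact: cvg_gauss_cdf_y.
    by apply: gt0_cvgMly => //; exact: cvg_addr_invr_y.
  apply: (@cvg_comp _ _ _ V (@gauss_cdf R) _ (@pinfty_nbhs R)); last exact: cvg_gauss_cdf_y.
  by apply: gt0_cvgMly => //; exact: cvg_addr_invr_y.
- have -> : - be' = - (al * 0 + be' * 1) by rewrite mulr0 mulr1 add0r.
  apply: (@cvg_comp _ _ _ (rho b) G _ (0 : R)^'+); first exact: cvg_rho_b.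
  apply: cvgN; apply: cvgD; apply: cvgM; try exact: cvg_cst.
    apply: (@cvg_comp _ _ _ U (@gauss_cdf R) _ (@ninfty_nbhs R)); last exact: cvg_gauss_cdf_Ny.
    apply: gt0_cvgMlNy => //; under eq_fun do rewrite mulNr; apply: cvg_subr_invr_0 => //.
    exact: ltW.
  apply: (@cvg_comp _ _ _ V (@gauss_cdf R) _ (@pinfty_nbhs R)); last exact: cvg_gauss_cdf_y.
  by apply: gt0_cvgMly => //; apply: cvg_addr_invr_0 => //; exact: ltW.
Qed.

End LevyConvolution.

(** * The Mehler kernel *)
Section MehlerOneDim.
Context (R : realType).
Local Notation leb := (@lebesgue_measure R).
Implicit Types (s t a b d : R).

(** Completing the square: the integrand is a multiple of the normal density with
   mean q / p and variance 1 / p. *)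
Lemma ge0_integral_gauss (p q r : R) : 0 < p ->
  (\int[leb]_b (expR (- (p / 2 * b ^+ 2) + q * b + r))%:E =
   (Num.sqrt (2 * pi / p) * expR (q ^+ 2 / (2 * p) + r))%:E)%E.
Proof.
move=> p0; pose v := Num.sqrt p^-1.
have v0 : 0 < v by rewrite sqrtr_gt0 invr_gt0.
have v2 : v ^+ 2 = p^-1 by rewrite sqr_sqrtr// invr_ge0 ltW.
have pk0 : 0 < normal_peak v.
  by rewrite invr_gt0 sqrtr_gt0 pmulrn_lgt0// mulr_gt0 ?pi_gt0 ?exprn_gt0.
set C := (_ * _ in RHS).
have C0 : 0 <= C by rewrite mulr_ge0 ?sqrtr_ge0 ?expR_ge0.
have -> : (fun b => (expR (- (p / 2 * b ^+ 2) + q * b + r))%:E) =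
    (fun b => C%:E * (normal_pdf (q / p) v b)%:E)%E.
  apply/funext => b; rewrite -EFinM; congr (_%:E).
  rewrite normal_pdfE ?lt0r_neq0//= /normal_peak /normal_fun v2.
  have -> : p^-1 * pi *+ 2 = 2 * pi / p by rewrite -mulr_natl; ring.
  rewrite /C [RHS]mulrACA mulfV ?mul1r; last first.
    by rewrite gt_eqF// sqrtr_gt0 divr_gt0// mulr_gt0// pi_gt0.
  rewrite -expRD; congr expR; rewrite -[p^-1 *+ 2]mulr_natl.
  by field; rewrite gt_eqF.
rewrite ge0_integralZl//.
- by rewrite integral_normal_pdf mule1.
- by apply/measurable_EFinP; exact: measurable_normal_pdf.
- by move=> b _; rewrite lee_fin normal_pdf_ge0.
Qed.

Lemma sinh_gt0 t : 0 < t -> 0 < sinh t.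
Proof.
by move=> t0; rewrite divr_gt0// subr_gt0 ltr_expR gtrN.
Qed.

Lemma cosh_gt0 t : 0 < cosh t.
Proof. by rewrite divr_gt0// addr_gt0 ?expR_gt0. Qed.

Lemma sqr_cosh t : cosh t ^+ 2 = 1 + sinh t ^+ 2.
Proof.
have := expRxMexpNx_1 t; rewrite /cosh /sinh => h.
have -> : ((expR t + expR (- t)) / 2) ^+ 2 =
  expR t * expR (- t) + ((expR t - expR (- t)) / 2) ^+ 2 by field.
by rewrite h.
Qed.

Lemma sinhD s t : sinh (s + t) = sinh s * cosh t + cosh s * sinh t.
Proof. by rewrite /sinh /cosh opprD !expRD; field. Qed.

Lemma coshD s t : cosh (s + t) = cosh s * cosh t + sinh s * sinh t.
Proof. by rewrite /sinh /cosh opprD !expRD; field. Qed.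

(** The factor of [mehler] in one coordinate. *)
Definition mehler1 t a b : R :=
  expR (- ((a - b) ^+ 2 / 4) * coth t) * expR (- ((a + b) ^+ 2 / 4) * tanh t)
  / (2 * pi * sinh (2 * t)) `^ 2^-1.

(** In terms of 2t the exponent becomes a quadratic form, since
   coth t + tanh t = 2 coth (2t) and coth t - tanh t = 2 / sinh (2t). *)
Lemma mehler1E t a b : 0 < t -> mehler1 t a b =
  expR (- (cosh (2 * t) / sinh (2 * t) / 2 * (a ^+ 2 + b ^+ 2))
        + a * b / sinh (2 * t)) / Num.sqrt (2 * pi * sinh (2 * t)).
Proof.
move=> t0; have s0 := sinh_gt0 t0; have c0 := cosh_gt0 t.
have t20 : 0 < 2 * t by rewrite mulr_gt0.
rewrite /mehler1 powR12_sqrt; last first.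
  by apply: ltW; apply: mulr_gt0; rewrite ?sinh_gt0 ?mulr_gt0 ?pi_gt0.
rewrite -expRD; congr (expR _ / _).
have -> : 2 * t = t + t by ring.
rewrite sinhD coshD /coth /tanh.
have -> : cosh t * cosh t + sinh t * sinh t = cosh t ^+ 2 + sinh t ^+ 2 by ring.
(* Written so that cosh^2 - sinh^2 = 1 can be used in the coefficient of a b. *)
transitivity (- (((a ^+ 2 + b ^+ 2) * (cosh t ^+ 2 + sinh t ^+ 2)
     - 2 * a * b * (cosh t ^+ 2 - sinh t ^+ 2)) / (4 * sinh t * cosh t))).
  by field; rewrite !gt_eqF.
rewrite sqr_cosh; field; rewrite ?gt_eqF//.
by rewrite mulrC -mulr2n pmulrn_lgt0// mulr_gt0.
Qed.

(** A Gaussian integral, where C^2 - S^2 = 1 simplifies the exponent. *)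
Lemma integral_mehler1 t a : 0 < t ->
  (\int[leb]_b (mehler1 t a b)%:E =
   ((Num.sqrt (cosh (2 * t)))^-1 * expR (- (a ^+ 2 / 2 * (sinh (2 * t) / cosh (2 * t)))))%:E)%E.
Proof.
move=> t0; have t20 : 0 < 2 * t by rewrite mulr_gt0.
have s0 := sinh_gt0 t20; have c0 := cosh_gt0 (2 * t).
have w0 : 0 < 2 * pi * sinh (2 * t) by rewrite mulr_gt0 ?s0// mulr_gt0 ?pi_gt0.
set S := sinh _ in s0 w0 *; set C := cosh _ in c0 *.
have p0 : 0 < C / S by rewrite divr_gt0.
have -> : (fun b => (mehler1 t a b)%:E) = (fun b => ((Num.sqrt (2 * pi * S))^-1)%:E *
    (expR (- (C / S / 2 * b ^+ 2) + a / S * b + - (C / S / 2 * a ^+ 2)))%:E)%E.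
  apply/funext => b; rewrite -EFinM mehler1E// mulrC -/S -/C; congr ((_ * expR _)%:E).
  by field; rewrite gt_eqF.
rewrite ge0_integralZl//; last first.
- apply/measurable_EFinP; apply: (measurableT_comp (@measurable_expR R)).
  apply: measurable_funD => //; apply: measurable_funD.
    by apply: (measurableT_comp (@oppr_measurable R setT)); apply: measurable_funM.
  exact: measurable_funM.
rewrite ge0_integral_gauss// -EFinM; congr (_%:E).
rewrite [LHS]mulrA; congr (_ * expR _).
  rewrite -!sqrtrV ?(ltW w0) ?(ltW c0)// -sqrtrM ?invr_ge0 ?(ltW w0)//; congr Num.sqrt.
  by move: (pi : R) (pi_gt0 R) => P P0; field; rewrite !gt_eqF.
have -> : (a / S) ^+ 2 / (2 * (C / S)) - C / S / 2 * a ^+ 2 =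
    a ^+ 2 / 2 * ((1 - C ^+ 2) / (C * S)) by field; rewrite !gt_eqF.
by rewrite sqr_cosh -/S; field; rewrite !gt_eqF.
Qed.

(** A Gaussian integral; the addition formulas of cosh and sinh together with
   C^2 = 1 + S^2 identify the result. *)
Lemma mehler1_semigroup s t a d : 0 < s -> 0 < t ->
  (\int[leb]_b (mehler1 s a b * mehler1 t b d)%:E = (mehler1 (s + t) a d)%:E)%E.
Proof.
move=> s0 t0; have s20 : 0 < 2 * s by rewrite mulr_gt0.
have t20 : 0 < 2 * t by rewrite mulr_gt0.
have S10 := sinh_gt0 s20; have C10 := cosh_gt0 (2 * s).
have S20 := sinh_gt0 t20; have C20 := cosh_gt0 (2 * t).
have C1E := sqr_cosh (2 * s); have C2E := sqr_cosh (2 * t).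
rewrite (mehler1E _ _ (addr_gt0 s0 t0)) (mulrDr 2 s t) sinhD coshD.
under eq_integral => b _ do rewrite mehler1E// mehler1E//.
move: C1E C2E S10 C10 S20 C20.
set S1 := sinh (2 * s); set C1 := cosh (2 * s).
set S2 := sinh (2 * t); set C2 := cosh (2 * t).
clearbody S1 C1 S2 C2 => C1E C2E S10 C10 S20 C20.
have D0 : 0 < S1 * C2 + C1 * S2 by rewrite addr_gt0// mulr_gt0.
have pi0 := pi_gt0 R.
have w1 : 0 < 2 * pi * S1 by rewrite !mulr_gt0.
have w2 : 0 < 2 * pi * S2 by rewrite !mulr_gt0.
have w3 : 0 < 2 * pi * (S1 * C2 + C1 * S2) by rewrite !mulr_gt0.
pose p := (S1 * C2 + C1 * S2) / (S1 * S2).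
have p0 : 0 < p by rewrite divr_gt0// mulr_gt0.
have -> : (fun b => (expR (- (C1 / S1 / 2 * (a ^+ 2 + b ^+ 2)) + a * b / S1) /
      Num.sqrt (2 * pi * S1) *
      (expR (- (C2 / S2 / 2 * (b ^+ 2 + d ^+ 2)) + b * d / S2) /
       Num.sqrt (2 * pi * S2)))%:E) =
    (fun b => ((Num.sqrt (2 * pi * S1))^-1 * (Num.sqrt (2 * pi * S2))^-1)%:E *
    (expR (- (p / 2 * b ^+ 2) + (a / S1 + d / S2) * b
      + - (C1 / S1 / 2 * a ^+ 2 + C2 / S2 / 2 * d ^+ 2)))%:E)%E.
  apply/funext => b; rewrite -EFinM mulrACA mulrC -expRD; congr ((_ * expR _)%:E).
  by rewrite /p; field; rewrite !gt_eqF.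
rewrite ge0_integralZl//; last first.
- apply/measurable_EFinP; apply: (measurableT_comp (@measurable_expR R)).
  apply: measurable_funD => //; apply: measurable_funD.
    by apply: (measurableT_comp (@oppr_measurable R setT)); apply: measurable_funM.
  exact: measurable_funM.
rewrite ge0_integral_gauss// -EFinM; congr (_%:E).
rewrite [LHS]mulrA [LHS]mulrC; congr (_ * _); [congr expR|]; last first.
  rewrite -!sqrtrV ?(ltW w1) ?(ltW w2) ?(ltW w3)//.
  rewrite -!sqrtrM ?mulr_ge0 ?invr_ge0 ?(ltW w1) ?(ltW w2)//; congr Num.sqrt.
  by rewrite /p; move: (pi : R) (pi_gt0 R) => P P0; field; rewrite !gt_eqF.
(* The minus ones are S1^2 = C1^2 - 1 and S2^2 = C2^2 - 1, to be cancelled against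
   the squared denominators. *)
transitivity (- ((a ^+ 2 * S2 * (C1 * C2 * S1 + (C1 ^+ 2 - 1) * S2)
    + d ^+ 2 * S1 * (C1 * C2 * S2 + (C2 ^+ 2 - 1) * S1)) / (2 * S1 * S2 * (S1 * C2 + C1 * S2)))
    + a * d / (S1 * C2 + C1 * S2)).
  by rewrite /p; field; rewrite !gt_eqF.
by rewrite C1E C2E; field; rewrite !gt_eqF.
Qed.

End MehlerOneDim.

Section Tensor.
Context (R : realType).
Local Notation leb := (@lebesgue_measure R).

(** Tonelli's theorem, by induction on the dimension. *)
Lemma ge0_integral_tensor n (h : 'I_n -> R -> R) (J : 'I_n -> R) :
  (forall i, measurable_fun setT (h i)) -> (forall i x, 0 <= h i x) ->
  (forall i, (\int[leb]_x (h i x)%:E = (J i)%:E)%E) ->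
  (\int[lebesgue_tuple R n]_z (\prod_(i < n) h i (tnth z i))%:E =
   (\prod_(i < n) J i)%:E)%E.
Proof.
elim: n h J => [|n IH] h J mh h0 hJ.
  rewrite (eq_integral (cst 1%E)) => [|z _]; last by rewrite big_ord0.
  rewrite integral_cst// mul1e big_ord0.
  by rewrite [X in X = _]diracE in_setT.
have mprod m (g : 'I_m -> R -> R) : (forall i, measurable_fun setT (g i)) ->
    measurable_fun setT (fun z : Defs.space R m => \prod_(i < m) g i (tnth z i)).
  move=> mg; apply: measurable_prod => i _.
  exact: measurableT_comp (mg i) (@measurable_tnth _ _ _ i).
have J0 i : 0 <= J i.
  by rewrite -lee_fin -hJ; apply: integral_ge0 => x _; rewrite lee_fin.
rewrite /= (@ge0_integral_pushforward _ _ _ _ _ _ (@measurable_tuple_cons R n)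
  (leb \x lebesgue_tuple R n)%E setT)//; last 2 first.
- by apply/measurable_EFinP; exact: mprod.
- by move=> z _; rewrite lee_fin; apply: prodr_ge0 => i _.
rewrite preimage_setT.
pose h' (i : 'I_n) := h (lift ord0 i).
pose f (p : spacetime R n) := (h ord0 p.1 * \prod_(i < n) h' i (tnth p.2 i))%:E.
have f0 p : (0 <= f p)%E by rewrite lee_fin mulr_ge0//; apply: prodr_ge0 => i _; exact: h0.
rewrite (eq_integral f) => [|p _]; last first.
  by rewrite /f/= big_ord_recl/=; congr ((_ * _)%:E); apply: eq_bigr => i _; rewrite tnthS.
rewrite (@fubini_tonelli1 _ _ _ _ _ leb (lebesgue_tuple R n) f)//; last first.
  apply/measurable_EFinP; apply: measurable_funM.
    exact: measurableT_comp (mh ord0) measurable_fst.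
  by apply: (measurableT_comp (f := fun z : Defs.space R n => \prod_(i < n) h' i (tnth z i))
    _ measurable_snd); apply: mprod => i; exact: mh.
transitivity (\int[leb]_x ((\prod_(i < n) J (lift ord0 i))%:E * (h ord0 x)%:E))%E; last first.
  rewrite ge0_integralZl//.
  - by rewrite hJ -EFinM big_ord_recl mulrC.
  - by apply/measurable_EFinP; exact: mh.
  - by move=> x _; rewrite lee_fin.
  - by rewrite lee_fin; apply: prodr_ge0 => i _.
apply: eq_integral => x _; rewrite /fubini_F /f/=; under eq_integral do rewrite EFinM.
rewrite ge0_integralZl//.
- by rewrite (IH h' (fun i => J (lift ord0 i)) (fun i => mh _) (fun i => h0 _) (fun i => hJ _)) muleC.
- by apply/measurable_EFinP; apply: mprod => i; exact: mh.
- by move=> z _; rewrite lee_fin; apply: prodr_ge0 => i _; exact: h0.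
- by rewrite lee_fin.
Qed.

End Tensor.

Section Mehler.
Context (R : realType) (n : nat).
Local Notation leb := (@lebesgue_measure R).
Local Notation mu := (lebesgue_tuple R n).
Implicit Types (x z w : Defs.space R n) (s t : R).

Lemma mehler_prod t x z : mehler t x z = \prod_(i < n) mehler1 t (tnth x i) (tnth z i).
Proof.
rewrite /mehler /mehler1 /sqdist /sqsum !big_split/=; congr (_ * _ * _).
- by rewrite -expR_sum -mulr_suml sumrN -mulr_suml.
- by rewrite -expR_sum -mulr_suml sumrN -mulr_suml.
- by rewrite prodfV prodr_const card_ord -powR_mulrn ?powR_ge0// -powRrM [2^-1 * _]mulrC.
Qed.

Lemma mehler1_ge0 t (a b : R) : 0 <= mehler1 t a b.
Proof. by rewrite /mehler1 !mulr_ge0 ?expR_ge0// invr_ge0 powR_ge0. Qed.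

Lemma mehler_ge0 t x z : 0 <= mehler t x z.
Proof. by rewrite mehler_prod prodr_ge0// => i _; exact: mehler1_ge0. Qed.

Lemma measurable_mehler1r t (a : R) : measurable_fun setT (mehler1 t a).
Proof.
apply: measurable_funM => //; apply: measurable_funM;
  apply: (measurableT_comp (@measurable_expR R)); apply: measurable_funM => //;
  apply: (measurableT_comp (@oppr_measurable R setT)); apply: measurable_funM => //;
  apply: measurable_funX.
  exact: measurable_funB.
exact: measurable_funD.
Qed.

Lemma measurable_mehler1l t (a : R) : measurable_fun setT (mehler1 t ^~ a).
Proof.
apply: measurable_funM => //; apply: measurable_funM;
  apply: (measurableT_comp (@measurable_expR R)); apply: measurable_funM => //;
  apply: (measurableT_comp (@oppr_measurable R setT)); apply: measurable_funM => //;
  apply: measurable_funX.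
  exact: measurable_funB.
exact: measurable_funD.
Qed.

Lemma mehler_semigroup s t x w : 0 < s -> 0 < t ->
  (\int[mu]_z (mehler s x z * mehler t z w)%:E = (mehler (s + t) x w)%:E)%E.
Proof.
move=> s0 t0; under eq_integral do rewrite !mehler_prod -big_split/=.
rewrite mehler_prod.
apply: (@ge0_integral_tensor R n (fun i b => mehler1 s (tnth x i) b * mehler1 t b (tnth w i))).
- move=> i; apply: measurable_funM; first exact: measurable_mehler1r.
  exact: measurable_mehler1l.
- by move=> i b; rewrite mulr_ge0// mehler1_ge0.
- by move=> i; exact: mehler1_semigroup.
Qed.

(** The mass is at most (cosh (2t))^(-1/2), and cosh (2t) is at least 1 and at least
   e^(2t) / 2. *)
Lemma integral_mehler1_le t (a : R) : 0 < t ->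
  exists2 c : R, (\int[leb]_b (mehler1 t a b)%:E = c%:E)%E &
    0 <= c /\ c <= Num.min 1 (Num.sqrt 2 * expR (- t)).
Proof.
move=> t0; have t20 : 0 < 2 * t by rewrite mulr_gt0.
have s0 := sinh_gt0 t20; have c0 := cosh_gt0 (2 * t).
eexists; first exact: integral_mehler1.
split; first by rewrite mulr_ge0 ?expR_ge0 ?invr_ge0 ?sqrtr_ge0.
apply: (@le_trans _ _ (Num.sqrt (cosh (2 * t)))^-1).
  rewrite ler_piMr ?invr_ge0 ?sqrtr_ge0// -[leRHS]expR0 ler_expR oppr_le0.
  apply: mulr_ge0; first by rewrite divr_ge0 ?sqr_ge0.
  by apply: divr_ge0; exact: ltW.
rewrite le_min; apply/andP; split.
  rewrite invf_le1 ?sqrtr_gt0// -[leLHS]sqrtr1 ler_wsqrtr//.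
  have h1 := expR_gt0 (2 * t); have h2 := expRxMexpNx_1 (2 * t).
  rewrite /cosh ler_pdivlMr// mul1r -subr_ge0.
  move: (expR (2 * t)) (expR (- (2 * t))) h1 h2 => u v u0 uv.
  have v0 : 0 < v by rewrite -(pmulr_rgt0 _ u0) uv.
  have -> : u + v - 2 = (u - 1) ^+ 2 * v - u * (u * v - 1) + 2 * (u * v - 1) by ring.
  by rewrite uv subrr !mulr0 subr0 addr0 mulr_ge0 ?sqr_ge0 ?ltW.
have -> : Num.sqrt 2 * expR (- t) = (Num.sqrt (expR (2 * t) / 2))^-1.
  rewrite sqrtrM ?expR_ge0// sqrtrV// invfM invrK expRN.
  have -> : 2 * t = t + t by ring.
  by rewrite expRD -expr2 sqrtr_sqr ger0_norm ?expR_ge0// mulrC.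
rewrite lef_pV2 ?posrE ?sqrtr_gt0 ?divr_gt0 ?addr_gt0 ?expR_gt0//.
by rewrite ler_wsqrtr// /cosh ler_wpM2r// lerDl expR_ge0.
Qed.

(** All factors have mass at most 1, and one of them provides the exponential
   decay; there is one because n >= 1. *)
Lemma integral_mehler_le t x : 0 < t -> (1 <= n)%N ->
  (\int[mu]_z (mehler t x z)%:E <= (Num.min 1 (Num.sqrt 2 * expR (- t)))%:E)%E.
Proof.
move=> t0 n1; pose J i : R := fine (\int[leb]_b (mehler1 t (tnth x i) b)%:E)%E.
have JP i : [/\ (\int[leb]_b (mehler1 t (tnth x i) b)%:E = (J i)%:E)%E, 0 <= J i &
    J i <= Num.min 1 (Num.sqrt 2 * expR (- t))].
  by rewrite /J; have [c -> [c0 c1]] := integral_mehler1_le (tnth x i) t0.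
under eq_integral do rewrite mehler_prod.
rewrite (@ge0_integral_tensor R n (fun i => mehler1 t (tnth x i)) J).
- rewrite lee_fin (bigD1 (Ordinal n1))//=; have [_ J0 Jc] := JP (Ordinal n1).
  rewrite -[leRHS]mulr1; apply: ler_pM => //.
    by apply: prodr_ge0 => i _; have [] := JP i.
  apply: prodr_ile1 => i _; have [_ -> /=] := JP i.
  by rewrite le_min => /andP[].
- by move=> i; exact: measurable_mehler1r.
- by move=> i b; exact: mehler1_ge0.
- by move=> i; have [] := JP i.
Qed.

End Mehler.

(** * The Poisson kernel on space-time *)
Section Reflection.
Context (R : realType).
Local Notation leb := (@lebesgue_measure R).

Definition reflect_at (c : R) : measurableTypeR R -> measurableTypeR R := fun t => c - t.

Let measurable_reflect_at c : measurable_fun setT (reflect_at c).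
Proof. exact: measurable_funB. Qed.

HB.instance Definition _ c := isMeasurableFun.Build _ _ _ _ (reflect_at c)
  (measurable_reflect_at c).

(** It suffices to compare the two measures on half-open intervals. *)
Lemma lebesgue_measure_reflect (c : R) (A : set R) : measurable A ->
  pushforward leb (reflect_at c) A = leb A.
Proof.
move=> mA; apply/esym/lebesgue_measure_unique => //= _ [[a b]] _ <-.
rewrite /pushforward (_ : _ @^-1` _ = `[c - b, c - a[%classic); last first.
  by apply/seteqP; split => t; rewrite /= !in_itv/= /reflect_at => /andP[? ?]; apply/andP; split; lra.
rewrite !lebesgue_measure_itv/= !lte_fin ltrD2l ltrN2.
by case: ifP => // _; rewrite -!EFinD; congr (_%:E); ring.
Qed.

Lemma ge0_integral_subl (c : R) (f : R -> \bar R) :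
  measurable_fun setT f -> (forall t, 0 <= f t)%E ->
  (\int[leb]_t f t = \int[leb]_t f (c - t)%R)%E.
Proof.
move=> mf f0.
have h := @ge0_integral_pushforward _ _ _ _ _ _ (measurable_reflect_at c) leb setT f measurableT mf
  (fun y _ => f0 y).
rewrite preimage_setT in h; rewrite -[RHS]h.
by apply: eq_measure_integral => //= A mA AS; exact/esym/lebesgue_measure_reflect.
Qed.

Lemma Rintegral_subl (c : R) (f : R -> R) : measurable_fun setT f ->
  \int[leb]_t f t = \int[leb]_t f (c - t).
Proof.
move=> mf; have mfE : measurable_fun setT (EFin \o f) by exact/measurable_EFinP.
rewrite /Rintegral integralE [in RHS]integralE; congr (fine (_ - _)%E).
  rewrite (ge0_integral_subl c (measurable_funepos mfE) (fun _ => funepos_ge0 _ _)).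
  by apply: eq_integral => t _; rewrite !funeposE.
rewrite (ge0_integral_subl c (measurable_funeneg mfE) (fun _ => funeneg_ge0 _ _)).
by apply: eq_integral => t _; rewrite !funenegE.
Qed.

(** Holds also for f that is not integrable: for k > 0 the integrals of the positive
   and negative parts are infinite on both sides simultaneously, and the two
   sides are then the same junk value. *)
Lemma ge0_RintegralZl d (T : measurableType d) (mu : {measure set T -> \bar R})
    (k : R) (f : T -> R) : 0 <= k -> measurable_fun setT f ->
  \int[mu]_x (k * f x) = k * \int[mu]_x f x.
Proof.
move=> k0 mf; have mfE : measurable_fun setT (EFin \o f) by exact/measurable_EFinP.
have [->|kn0] := eqVneq k 0.
  rewrite mul0r (_ : (fun x => 0 * f x) = cst 0) ?Rintegral_cst ?mul0r//.
  by apply/funext => x; rewrite mul0r.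
have k1 : 0 < k by rewrite lt_def kn0.
rewrite /Rintegral integralE [X in k * fine X]integralE.
have -> : (\int[mu]_x ((fun x => (k * f x)%:E)^\+ x) = k%:E * \int[mu]_x ((EFin \o f)^\+ x))%E.
  rewrite -ge0_integralZl//; last exact: measurable_funepos.
  by apply: eq_integral => x _; rewrite !funeposE/= maxe_pMr// ?lee_fin// mule0.
have -> : (\int[mu]_x ((fun x => (k * f x)%:E)^\- x) = k%:E * \int[mu]_x ((EFin \o f)^\- x))%E.
  rewrite -ge0_integralZl//; last exact: measurable_funeneg.
  by apply: eq_integral => x _; rewrite !funenegE/= -mulrN maxe_pMr// ?lee_fin// mule0.
have : (0 <= \int[mu]_x ((EFin \o f)^\+ x))%E by apply: integral_ge0 => x _; exact: funepos_ge0.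
have : (0 <= \int[mu]_x ((EFin \o f)^\- x))%E by apply: integral_ge0 => x _; exact: funeneg_ge0.
case: (integral mu _ _) => [a||]; case: (integral mu _ _) => [b||] // _ _.
all: rewrite ?[(_ * +oo)%E]gt0_muley ?lte_fin//=.
- by rewrite mulrBr.
all: by rewrite mulr0.
Qed.

End Reflection.

Section PoissonKernel.
Context (R : realType) (n : nat).
Local Notation leb := (@lebesgue_measure R).
Local Notation mH := (lebesgue_tuple R n).
Local Notation X := (spacetime R n).
Local Notation mu := (sigma_finite_prod leb mH : {sigma_finite_measure set X -> \bar R}).
Implicit Types (p q r : X) (y s t : R).

(** Convolution in time by [levy] on positive times, combined with the Mehler
   kernel in space: only the past t' < t of a point contributes. *)
Definition poisson_kernel y p q : R :=
  if (q.1 : R) < p.1 then levy y ((p.1 : R) - q.1) * mehler ((p.1 : R) - q.1) p.2 q.2 else 0.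

Definition poisson_kernel' y p q : R :=
  poisson_kernel y p q * (y^-1 - y / (2 * ((p.1 : R) - q.1))).

Lemma poisson_kernel_ge0 y p q : 0 < y -> 0 <= poisson_kernel y p q.
Proof.
move=> y0; rewrite /poisson_kernel; case: ifP => // _.
by rewrite mulr_ge0 ?levy_ge0 ?mehler_ge0.
Qed.

Lemma is_derive_poisson_kernel y p q : 0 < y ->
  is_derive y 1 (fun t => poisson_kernel t p q : R^o) (poisson_kernel' y p q).
Proof.
move=> y0; rewrite /poisson_kernel' /poisson_kernel; case: ifP => qp; last first.
  by rewrite mul0r; exact: is_derive_cst.
have t0 : 0 < (p.1 : R) - q.1 by rewrite subr_gt0.
rewrite (_ : (fun t => _) = (mehler ((p.1 : R) - q.1) p.2 q.2) \*:
  (fun t => levy t ((p.1 : R) - q.1) : R^o)); last first.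
  by apply/funext => z; rewrite /GRing.scale/= mulrC.
apply: is_derive_eq (is_deriveZ _ (is_derive_levy y0 t0)) _.
by rewrite /GRing.scale/=; ring.
Qed.

Lemma poisson_kernel_derive_le y p q : 0 < y ->
  `|poisson_kernel' y p q| <= 6 / y * poisson_kernel (y / 2) p q.
Proof.
move=> y0; rewrite /poisson_kernel' /poisson_kernel; case: ifP => qp; last first.
  by rewrite mul0r mulr0 normr0.
have t0 : 0 < (p.1 : R) - q.1 by rewrite subr_gt0.
rewrite mulrAC normrM (ger0_norm (mehler_ge0 _ _ _)) [leRHS]mulrA.
by rewrite ler_wpM2r ?mehler_ge0// levy_derive_le.
Qed.

Lemma poisson_kernel_harnack y s p q : 0 < y -> y / 2 < s < 2 * y ->
  poisson_kernel s p q <= 4 * poisson_kernel (y / 2) p q.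
Proof.
move=> y0 ys; rewrite /poisson_kernel; case: ifP => qp; last by rewrite mulr0.
have t0 : 0 < (p.1 : R) - q.1 by rewrite subr_gt0.
by rewrite mulrA ler_wpM2r ?mehler_ge0// levy_harnack.
Qed.

Lemma poisson_kernel_reflect y p t z : poisson_kernel y p ((p.1 : R) - t, z) =
  if 0 < t then levy y t * mehler t p.2 z else 0.
Proof. by rewrite /poisson_kernel/= gtrBl subKr. Qed.

End PoissonKernel.

Section PoissonKernelMeasurable.
Context (R : realType) (n : nat).
Local Notation X := (spacetime R n).

Lemma measurable_levy_comp d (T : measurableType d) (f g : T -> R) :
  measurable_fun setT f -> measurable_fun setT g ->
  measurable_fun setT (fun x => levy (f x) (g x)).
Proof.
move=> mf mg; apply: (measurableT_comp (@measurable_levy R) (g := fun x => (f x, g x))).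
exact/measurable_fun_pair.
Qed.

Lemma measurable_sinh : measurable_fun setT (@sinh R).
Proof.
apply: measurable_funM => //; apply: measurable_funB; first exact: measurable_expR.
exact: (measurableT_comp (@measurable_expR R) (@oppr_measurable R setT)).
Qed.

Lemma measurable_cosh : measurable_fun setT (@cosh R).
Proof.
apply: measurable_funM => //; apply: measurable_funD; first exact: measurable_expR.
exact: (measurableT_comp (@measurable_expR R) (@oppr_measurable R setT)).
Qed.

Lemma measurable_mehler_comp d (T : measurableType d) (f : T -> R) (g h : T -> Defs.space R n) :
  measurable_fun setT f -> measurable_fun setT g -> measurable_fun setT h ->
  measurable_fun setT (fun x => mehler (f x) (g x) (h x)).
Proof.
move=> mf mg mh.
have mt (i : 'I_n) (k : T -> Defs.space R n) : measurable_fun setT k ->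
    measurable_fun setT (fun x => tnth (k x) i : R).
  by move=> mk; exact: (measurableT_comp (@measurable_tnth _ _ _ i) mk).
have mV (k : T -> R) : measurable_fun setT k -> measurable_fun setT (fun x => (k x)^-1).
  by move=> mk; exact: (measurableT_comp (@measurable_invr R) mk).
have mE (k : T -> R) : measurable_fun setT k -> measurable_fun setT (fun x => expR (k x)).
  by move=> mk; exact: (measurableT_comp (@measurable_expR R) mk).
have mN (k : T -> R) : measurable_fun setT k -> measurable_fun setT (fun x => - k x).
  by move=> mk; exact: (measurableT_comp (@oppr_measurable R setT) mk).
have mS (k : T -> R) : measurable_fun setT k -> measurable_fun setT (fun x => sinh (k x)).
  by move=> mk; exact: (measurableT_comp measurable_sinh mk).
have mC (k : T -> R) : measurable_fun setT k -> measurable_fun setT (fun x => cosh (k x)).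
  by move=> mk; exact: (measurableT_comp measurable_cosh mk).
have mcst (k : R) : measurable_fun setT (fun _ : T => k) by exact: measurable_cst.
apply: measurable_funM.
  apply: measurable_funM; apply: mE; apply: measurable_funM.
  - apply: (mN (fun x => sqdist (g x) (h x) / 4)); apply: measurable_funM => //.
    apply: measurable_sum => i; apply: measurable_funX.
    by apply: measurable_funB; exact: mt.
  - by apply: measurable_funM; [exact: mC|apply: mV; exact: mS].
  - apply: (mN (fun x => sqsum (g x) (h x) / 4)); apply: measurable_funM => //.
    apply: measurable_sum => i; apply: measurable_funX.
    by apply: measurable_funD; exact: mt.
  - by apply: measurable_funM; [exact: mS|apply: mV; exact: mC].
apply: (mV (fun x => (2 * pi * sinh (2 * f x)) `^ (n%:R / 2))).
apply: (measurableT_comp (@measurable_powR R (n%:R / 2))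
  (g := fun x => 2 * pi * sinh (2 * f x))).
by apply: measurable_funM => //; apply: mS; exact: measurable_funM.
Qed.

Lemma measurable_poisson_kernel_comp d (T : measurableType d) (f : T -> R) (g h : T -> X) :
  measurable_fun setT f -> measurable_fun setT g -> measurable_fun setT h ->
  measurable_fun setT (fun x => poisson_kernel (f x) (g x) (h x)).
Proof.
move=> mf mg mh.
have mg1 : measurable_fun setT (fun x => (g x).1 : R) := measurableT_comp measurable_fst mg.
have mh1 : measurable_fun setT (fun x => (h x).1 : R) := measurableT_comp measurable_fst mh.
have mg2 : measurable_fun setT (fun x => (g x).2) := measurableT_comp measurable_snd mg.
have mh2 : measurable_fun setT (fun x => (h x).2) := measurableT_comp measurable_snd mh.
have md : measurable_fun setT (fun x => ((g x).1 : R) - (h x).1) by exact: measurable_funB.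
apply: measurable_fun_ifT => //.
- exact: measurable_fun_ltr.
- by apply: measurable_funM; [exact: measurable_levy_comp|exact: measurable_mehler_comp].
Qed.

Lemma measurable_poisson_kernel'_comp d (T : measurableType d) (f : T -> R) (g h : T -> X) :
  measurable_fun setT f -> measurable_fun setT g -> measurable_fun setT h ->
  measurable_fun setT (fun x => poisson_kernel' (f x) (g x) (h x)).
Proof.
move=> mf mg mh.
have mg1 : measurable_fun setT (fun x => (g x).1 : R) := measurableT_comp measurable_fst mg.
have mh1 : measurable_fun setT (fun x => (h x).1 : R) := measurableT_comp measurable_fst mh.
have mV (k : T -> R) : measurable_fun setT k -> measurable_fun setT (fun x => (k x)^-1).
  by move=> mk; exact: (measurableT_comp (@measurable_invr R) mk).
apply: measurable_funM; first exact: measurable_poisson_kernel_comp.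
apply: measurable_funB; first exact: mV.
apply: measurable_funM => //; apply: (mV (fun x => 2 * (((g x).1 : R) - (h x).1))).
by apply: measurable_funM => //; exact: measurable_funB.
Qed.

End PoissonKernelMeasurable.

Section PoissonKernelIntegrals.
Context (R : realType) (n : nat).
Local Notation leb := (@lebesgue_measure R).
Local Notation mH := (lebesgue_tuple R n).
Local Notation X := (spacetime R n).
Local Notation mu := (sigma_finite_prod leb mH : {sigma_finite_measure set X -> \bar R}).
Implicit Types (p q r : X) (y s t : R).

(** Tonelli's theorem in the elapsed time c - t. *)
Lemma ge0_integral_spacetime (c : R) (F : X -> \bar R) :
  measurable_fun setT F -> (forall q, 0 <= F q)%E ->
  (\int[mu]_q F q = \int[leb]_t \int[mH]_z F ((c - t)%R, z))%E.
Proof.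
move=> mF F0; rewrite [LHS](@fubini_tonelli1 _ _ _ _ _ leb mH F)//.
have mG : measurable_fun setT (fubini_F mH F).
  exact: (@measurable_fun_fubini_tonelli_F _ _ _ _ _ mH F).
apply: (ge0_integral_subl c mG) => t; exact: integral_ge0.
Qed.

Lemma ge0_integral_if (D : R -> bool) (B : set R) (g : R -> \bar R) :
  B = [set t | D t] ->
  (\int[leb]_t (if D t then g t else 0) = \int[leb]_(t in B) g t)%E.
Proof.
move=> ->; rewrite [RHS]integral_mkcond; apply: eq_integral => t _.
rewrite patchE; case: ifPn => Dt; case: ifPn => //.
  by rewrite notin_setE.
by rewrite inE /= (negbTE Dt).
Qed.

Let measurable_section y p : measurable_fun setT (poisson_kernel y p).
Proof. by apply: measurable_poisson_kernel_comp. Qed.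

Lemma ge0_integral_poisson_kernel y p : 0 < y ->
  (\int[mu]_q (poisson_kernel y p q)%:E =
   \int[leb]_(t in `]0%R, +oo[) ((levy y t)%:E * \int[mH]_z (mehler t p.2 z)%:E))%E.
Proof.
move=> y0; rewrite (@ge0_integral_spacetime p.1); last 2 first.
- exact/measurable_EFinP.
- by move=> q; rewrite lee_fin poisson_kernel_ge0.
rewrite -(@ge0_integral_if (fun t => 0 < t) `]0, +oo[%classic); last first.
  by apply/seteqP; split => t; rewrite /= in_itv/= andbT.
apply: eq_integral => t _.
under eq_integral do rewrite poisson_kernel_reflect.
case: ifP => t0; last by rewrite integral0.
under eq_integral do rewrite EFinM.
rewrite ge0_integralZl//.
- apply/measurable_EFinP; exact: measurable_mehler_comp.
- by move=> z _; rewrite lee_fin mehler_ge0.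
- by rewrite lee_fin levy_ge0.
Qed.

Lemma integral_expRN : (\int[leb]_(t in `]0%R, +oo[) (expR (- t))%:E = 1%:E)%E.
Proof.
pose F t : R := - expR (- t).
have dF t : 0 < t -> is_derive t 1 (F : R -> R^o) (expR (- t)).
  move=> _; have dx : is_derive t 1 (fun z : R => - z : R^o) (-1).
    by have := @is_deriveN R R R^o id t 1 1 (is_derive_id _ _).
  apply: is_derive_eq (is_deriveN (@is_derive1_comp R expR _ t _ _ (is_derive_expR _) dx)) _.
  by rewrite mulrN1 opprK.
rewrite (_ : 1 = 0 - F 0); last by rewrite /F oppr0 expR0 sub0r opprK.
apply: (ge0_integral_oy _ _ dF).
- by move=> t _; exact: expR_ge0.
- move=> t _; have cN : {for t, continuous (fun z : R => - z)} by apply: cvgN; exact: cvg_id.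
  exact: (continuous_comp cN (@continuous_expR _ _)).
- apply: cvg_at_right_filter; apply: cvgN.
  have cN : {for 0, continuous (fun z : R => - z)} by apply: cvgN; exact: cvg_id.
  exact: (continuous_comp cN (@continuous_expR _ _)).
- by rewrite -oppr0; apply: cvgN; exact: cvgr_expR.
Qed.

Hypothesis n1 : (1 <= n)%N.

Lemma poisson_kernel_mass y p : 0 < y ->
  (\int[mu]_q (poisson_kernel y p q)%:E <= 2%:E)%E.
Proof.
move=> y0; rewrite ge0_integral_poisson_kernel//; apply: le_trans (integral_levy y0).
apply: ge0_le_integral => //.
- move=> t _; rewrite mule_ge0 ?lee_fin ?levy_ge0// integral_ge0// => z _.
  by rewrite lee_fin mehler_ge0.
- apply: measurable_funTS; apply: emeasurable_funM.
    by apply/measurable_EFinP; exact: measurable_levy_comp.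
  apply: (@measurable_fun_fubini_tonelli_F _ _ _ _ _ mH
    (fun w : measurableTypeR R * Defs.space R n => (mehler w.1 p.2 w.2)%:E)).
    by apply/measurable_EFinP; exact: measurable_mehler_comp.
  by move=> w; rewrite lee_fin mehler_ge0.
- apply: measurable_funTS; apply/measurable_EFinP; exact: measurable_levy_comp.
- move=> t; rewrite /= in_itv/= andbT => t0; rewrite -[leRHS]mule1.
  rewrite lee_wpmul2l ?lee_fin ?levy_ge0//.
  by apply: le_trans (integral_mehler_le p.2 t0 n1) _; rewrite lee_fin ge_min lexx.
Qed.

Lemma poisson_kernel_decay y p : 0 < y ->
  (\int[mu]_q (poisson_kernel y p q)%:E <= (24 / y ^+ 2)%:E)%E.
Proof.
move=> y0; rewrite ge0_integral_poisson_kernel//.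
have s2 : Num.sqrt (2 : R) <= 2.
  rewrite -[leRHS]ger0_norm// -sqrtr_sqr ler_wsqrtr//; lra.
apply: (@le_trans _ _ (\int[leb]_(t in `]0%R, +oo[) ((24 / y ^+ 2)%:E * (expR (- t))%:E))%E).
  apply: ge0_le_integral => //.
  - move=> t _; rewrite mule_ge0 ?lee_fin ?levy_ge0// integral_ge0// => z _.
    by rewrite lee_fin mehler_ge0.
  - apply: measurable_funTS; apply: emeasurable_funM.
      by apply/measurable_EFinP; exact: measurable_levy_comp.
    apply: (@measurable_fun_fubini_tonelli_F _ _ _ _ _ mH
      (fun w : measurableTypeR R * Defs.space R n => (mehler w.1 p.2 w.2)%:E)).
      by apply/measurable_EFinP; exact: measurable_mehler_comp.
    by move=> w; rewrite lee_fin mehler_ge0.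
  - apply: measurable_funTS; apply/measurable_EFinP; apply: measurable_funM => //.
    exact: (measurableT_comp (@measurable_expR R) (@oppr_measurable R setT)).
  - move=> t; rewrite /= in_itv/= andbT => t0.
    apply: (@le_trans _ _ ((12 / y ^+ 2)%:E * (2 * expR (- t))%:E)%E); last first.
      by rewrite -!EFinM lee_fin le_eqVlt; apply/orP; left; apply/eqP; field; rewrite gt_eqF.
    apply: lee_pmul; rewrite ?lee_fin ?levy_ge0 ?levy_decay//.
      by apply: integral_ge0 => z _; rewrite lee_fin mehler_ge0.
    apply: le_trans (integral_mehler_le p.2 t0 n1) _; rewrite lee_fin ge_min.
    by apply/orP; right; rewrite ler_wpM2r ?expR_ge0.
rewrite ge0_integralZl//.
- by rewrite integral_expRN mule1.
- apply: measurable_funTS; apply/measurable_EFinP.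
  exact: (measurableT_comp (@measurable_expR R) (@oppr_measurable R setT)).
- by rewrite lee_fin divr_ge0// sqr_ge0.
Qed.

(** In the elapsed time t, the integral in space is the semigroup law of the
   Mehler kernel and no longer depends on t; what is left is the convolution
   of two [levy] densities on (0, b). *)
Lemma poisson_kernel_semigroup y s p r : 0 < y -> 0 < s ->
  (\int[mu]_q (poisson_kernel y p q * poisson_kernel s q r)%:E =
   (poisson_kernel (y + s) p r)%:E)%E.
Proof.
move=> y0 s0; rewrite (@ge0_integral_spacetime p.1); last 2 first.
- apply/measurable_EFinP; apply: measurable_funM => //.
  exact: measurable_poisson_kernel_comp.
- by move=> q; rewrite lee_fin mulr_ge0 ?poisson_kernel_ge0.
pose b : R := (p.1 : R) - r.1.
transitivity (\int[leb]_t (if (0 < (t : R) < b)%R then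
    (mehler b p.2 r.2)%:E * (levy y t * levy s (b - t))%:E else 0))%E; last first.
  rewrite (@ge0_integral_if _ `]0%R, b[%classic); last first.
    by apply/seteqP; split => t; rewrite /= in_itv.
  rewrite /poisson_kernel -/b; case: ifPn => rp.
    have b0 : 0 < b by rewrite subr_gt0.
    rewrite ge0_integralZl//.
    - by rewrite levy_convolution// -EFinM mulrC.
    - apply: measurable_funTS; apply/measurable_EFinP; apply: measurable_funM.
        exact: measurable_levy_comp.
      by apply: measurable_levy_comp => //; exact: measurable_funB.
    - by move=> t _; rewrite lee_fin mulr_ge0 ?levy_ge0.
    - by rewrite lee_fin mehler_ge0.
  rewrite (_ : `]0%R, b[%classic = set0) ?integral_set0//.
  apply/seteqP; split => t //=; rewrite in_itv/= => /andP[t0 tb].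
  by move: rp; rewrite -leNgt -subr_le0 -/b leNgt (lt_trans t0 tb).
apply: eq_integral => t _.
under eq_integral do rewrite poisson_kernel_reflect.
case: ltP => t0 /=; last by under eq_integral do rewrite mul0r; rewrite integral0.
have E z : poisson_kernel s ((p.1 : R) - t, z) r =
    if t < b then levy s (b - t) * mehler (b - t) z r.2 else 0.
  rewrite /poisson_kernel/= ltrBrDl -ltrBrDr -/b (_ : (p.1 : R) - t - r.1 = b - t)//.
  by rewrite /b; ring.
under eq_integral do rewrite E.
case: ltP => tb; last by under eq_integral do rewrite mulr0; rewrite integral0.
under eq_integral do rewrite mulrACA EFinM.
rewrite ge0_integralZl//; last 3 first.
- apply/measurable_EFinP; apply: measurable_funM; exact: measurable_mehler_comp.
- by move=> z _; rewrite lee_fin mulr_ge0 ?mehler_ge0.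
- by rewrite lee_fin mulr_ge0 ?levy_ge0.
by rewrite mehler_semigroup ?subr_gt0// (addrC t) subrK muleC.
Qed.

Lemma smoothing_poisson_kernel :
  smoothing_kernel mu (@poisson_kernel R n) (@poisson_kernel' R n) 24.
Proof.
have m1 : measurable_fun setT (fun z : R * (X * X) => z.1) by exact: measurable_fst.
have m2 : measurable_fun setT (fun z : R * (X * X) => z.2.1).
  exact: (measurableT_comp measurable_fst measurable_snd).
have m3 : measurable_fun setT (fun z : R * (X * X) => z.2.2).
  exact: (measurableT_comp measurable_snd measurable_snd).
split.
- by [].
- exact: measurable_poisson_kernel_comp.
- exact: measurable_poisson_kernel'_comp.
- by move=> y p q y0; exact: poisson_kernel_ge0.
- move=> y p y0; apply: le_trans (poisson_kernel_mass p y0) _.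
  by rewrite lee_fin; lra.
- by move=> y p y0; exact: poisson_kernel_decay.
- by move=> y s p r y0 s0; exact: poisson_kernel_semigroup.
- by move=> y p q y0; exact: is_derive_poisson_kernel.
- move=> y p q y0; apply: le_trans (poisson_kernel_derive_le p q y0) _.
  have y20 : 0 < y / 2 by rewrite divr_gt0.
  rewrite ler_wpM2r ?poisson_kernel_ge0// ler_wpM2r ?invr_ge0 ?(ltW y0)//.
  lra.
- move=> y s p q y0 ys; apply: le_trans (poisson_kernel_harnack p q y0 ys) _.
  have y20 : 0 < y / 2 by rewrite divr_gt0.
  by rewrite ler_wpM2r ?poisson_kernel_ge0//; lra.
Qed.

End PoissonKernelIntegrals.

(** * The two Poisson semigroups of the theorem *)
Section PoissonOperator.
Context (R : realType) (n : nat).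
Local Notation leb := (@lebesgue_measure R).
Local Notation mH := (lebesgue_tuple R n).
Local Notation X := (spacetime R n).
Local Notation mu := (sigma_finite_prod leb mH : {sigma_finite_measure set X -> \bar R}).
Hypothesis n1 : (1 <= n)%N.

(** The integral over past times and space is the iterated integral of the
   definition after reflecting time. The inner integral may diverge for a null
   set of times; [ge0_RintegralZl] moves constants across it all the same. *)
Lemma poissonLE (y : R) (f : X -> R) (M : R) (p : X) : 0 < y -> ess_bounded mu f M -> 0 <= M ->
  poissonL y f p = kernel_op mu (@poisson_kernel R n y) f p.
Proof.
move=> y0 fM M0; have [mf _] := fM.
have HK := smoothing_poisson_kernel R n1.
have i := kernel_le_integrable p (kernel_le_mass HK y0) fM M0.
rewrite /kernel_op -(@Rintegral12 _ _ _ _ _ leb mH _ i).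
have mk : measurable_fun setT (fun q : X => poisson_kernel y p q * f q).
  by apply: measurable_funM => //; exact: measurable_poisson_kernel_comp.
rewrite (Rintegral_subl p.1 (@measurable_Rintegral _ _ _ _ _ mH _ mk)).
have mfs : measurable_fun setT (fun w : X => f ((p.1 : R) - w.1, w.2)).
  apply: (measurableT_comp mf (g := fun w : X => (((p.1 : R) - w.1, w.2) : X))).
  apply/measurable_fun_pair; last exact: measurable_snd.
  by apply: measurable_funB; [exact: measurable_cst|exact: measurable_fst].
have mV (k : X -> R) : measurable_fun setT k -> measurable_fun setT (fun x => (k x)^-1).
  by move=> mk'; exact: (measurableT_comp (@measurable_invr R) mk').
have mF : measurable_fun setT (fun w : X => expR (- (y ^+ 2 / (4 * (w.1 : R)))) *
    mehler w.1 p.2 w.2 * f ((p.1 : R) - w.1, w.2)).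
  apply: measurable_funM => //; apply: measurable_funM; last first.
    exact: measurable_mehler_comp.
  apply: (measurableT_comp (@measurable_expR R)).
  apply: (measurableT_comp (@oppr_measurable R setT)); apply: measurable_funM => //.
  by apply: (mV (fun w : X => 4 * (w.1 : R))); exact: measurable_funM.
rewrite /poissonL /poisson_integral Rintegral_mkcond -ge0_RintegralZl.
- apply: eq_Rintegral => t _; rewrite patchE; case: ifPn; rewrite ?inE ?notin_setE /= in_itv/= andbT.
    move=> t0; have k0 : 0 <= y / (2 * Num.sqrt pi) / (t : R) `^ (3 / 2).
      by rewrite !mulr_ge0 ?invr_ge0 ?powR_ge0 ?mulr_ge0 ?sqrtr_ge0 ?(ltW y0).
    rewrite [LHS]mulrA [LHS]mulrAC.
    rewrite -(@ge0_RintegralZl _ _ _ mH _ _ k0 (measurableT_comp mF (measurable_pair1 t))).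
    apply: eq_Rintegral => z _; rewrite poisson_kernel_reflect t0 /levy/= -!mulrA.
    by congr (_ * (_ * _)); rewrite mulrCA !mulrA.
  move=> /negP/negbTE t0; rewrite mulr0 (_ : (fun z => _) = cst 0) ?Rintegral_cst ?mul0r//.
  by apply/funext => z; rewrite poisson_kernel_reflect t0 mul0r.
- by rewrite divr_ge0 ?mulr_ge0 ?sqrtr_ge0 ?(ltW y0).
- apply: (measurable_restrictT _ _).1 => //; apply: measurable_funTS.
  apply: measurable_funM; first exact: (@measurable_Rintegral _ _ _ _ _ mH _ mF).
  apply: (measurableT_comp (@measurable_invr R) (g := fun t : R => t `^ (3 / 2))).
  exact: measurable_powR.
Qed.
End PoissonOperator.

Section Lifting.
Context (R : realType) (n : nat).
Local Notation leb := (@lebesgue_measure R).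
Local Notation mH := (lebesgue_tuple R n).
Local Notation X := (spacetime R n).
Local Notation mL := (@spacetime_measure R n).
Implicit Types (g u : Defs.space R n -> R) (a : R -> R).

(** Time does not occur in any of the integrals, so that the two sides are the same
   by computation. *)
Lemma multiplier_lift a g : multiplier (@poissonL R n) a (g \o snd) =
  multiplier (@poissonH R n) a g \o snd.
Proof. by apply/funext => p. Qed.

(** A set of the form R * B is null if and only if B is null: a null set
   containing it has null sections, by Fubini, and a section contains B. *)
Lemma ae_lift (Q : Defs.space R n -> Prop) :
  {ae mL, forall p, Q p.2} <-> {ae mH, forall x, Q x}.
Proof.
split=> [[N [mN N0 QN]]|[N [mN N0 QN]]]; last first.
  exists (setT `*` N); split.
  - exact: measurableX.
  - have -> : mL (setT `*` N) = (leb setT * mH N)%E by exact: product_measure1E.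
    by rewrite N0 mule0.
  - by move=> p /= Qp; split => //; exact: QN.
(* Almost every section of N is null, and R is not: pick one null section. *)
have N0' : (\int[leb]_t mH (xsection N t) = 0)%E by exact: N0.
have mNx : measurable_fun setT (fun t : measurableTypeR R => mH (xsection N t)).
  exact: measurable_fun_xsection.
have [B [mB B0 sub]] : {ae leb, forall t, setT t -> mH (xsection N t) = 0%E}.
  apply/(ae_eq_integral_abs leb measurableT mNx).
  by rewrite -[RHS]N0'; apply: eq_integral => t _; rewrite gee0_abs.
have [t Bt] : exists t, ~ B t.
  apply: contrapT => /forallNP h.
  have BT : B = setT by apply/seteqP; split => // t _; exact: contrapT (h t).
  move: B0; rewrite BT -set_itvNyy lebesgue_measure_itv/=.
  by move=> /eqP.
exists (xsection N t); split.
- exact: measurable_xsection.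
- by apply: contrapT => h; apply: Bt; apply: sub => /(_ I).
- by move=> x Qx; apply: mem_set; exact: (QN (t, x)).
Qed.

Lemma Lnorm_lift g : ('N[mL]_(+oo)[EFin \o (g \o snd)] = 'N[mH]_(+oo)[EFin \o g])%E.
Proof.
have h (C : R) : 0 <= C -> ('N[mL]_(+oo)[EFin \o (g \o snd)] <= C%:E)%E <->
    ('N[mH]_(+oo)[EFin \o g] <= C%:E)%E.
  move=> C0; split=> [/(Lnorm_leP _ _ C0)|/(Lnorm_leP _ _ C0)] H; apply/(Lnorm_leP _ _ C0).
    exact: (ae_lift (fun x => `|g x| <= C)).1.
  exact: (ae_lift (fun x => `|g x| <= C)).2.
have := Lnorm_ge0 mL +oo%E (EFin \o (g \o snd)); have := Lnorm_ge0 mH +oo%E (EFin \o g).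
move: h; move: ('N[mL]_(+oo)[_])%E ('N[mH]_(+oo)[_])%E => x y h y0 x0.
apply/eqP; rewrite eq_le; apply/andP; split.
  by move: y h y0 => [r| |] h y0 //; [exact: (h r y0).2|rewrite leey].
by move: x h x0 => [r| |] h x0 //; [exact: (h r x0).1|rewrite leey].
Qed.

Lemma Lfun_lift g : g \o snd \in Lfun mL +oo <-> g \in Lfun mH +oo.
Proof.
split=> /Lfun_ess_bounded [mg gM].
  have M0 := fine_ge0 (Lnorm_ge0 mL +oo%E (EFin \o (g \o snd))).
  apply: (ess_bounded_Lfun M0); split.
    by have := measurableT_comp mg (@measurable_pair1 _ _ (measurableTypeR R) (Defs.space R n) (0 : R)).
  exact: (ae_lift (fun x => `|g x| <= _)).1.
have M0 := fine_ge0 (Lnorm_ge0 mH +oo%E (EFin \o g)).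
apply: (ess_bounded_Lfun M0); split; first exact: measurableT_comp.
exact: (ae_lift (fun x => `|g x| <= _)).2.
Qed.

Lemma Lambda_bound_lift (alpha : R) g (C : R) :
  Lambda_bound mL (@poissonL R n) alpha (g \o snd) C <->
  Lambda_bound mH (@poissonH R n) alpha g C.
Proof.
have h y := Lnorm_lift (fun x => derive1n (order_of alpha)
  (fun s : R => poissonH s g x : R^o) y).
by split => H y y0; [rewrite -[leLHS]h|rewrite [leLHS]h]; exact: H.
Qed.

Lemma Lambda_lift (alpha : R) g : Lambda mL (@poissonL R n) alpha (g \o snd) <->
  Lambda mH (@poissonH R n) alpha g.
Proof.
by split=> -[/Lfun_lift gL [C /Lambda_bound_lift HC]]; split => //; exists C.
Qed.

Lemma Lambda_norm_lift (alpha : R) g :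
  Lambda_norm mL (@poissonL R n) alpha (g \o snd) = Lambda_norm mH (@poissonH R n) alpha g.
Proof.
rewrite /Lambda_norm Lnorm_lift; congr (_ + ereal_inf _)%E.
by apply/seteqP; split => _ [C /= HC <-]; exists C => //=; exact/Lambda_bound_lift.
Qed.

Lemma multiplier_bounded_lift a (alpha : R) :
  multiplier_bounded mL (@poissonL R n) a alpha ->
  multiplier_bounded mH (@poissonH R n) a alpha.
Proof.
move=> [Ldef [K HK]]; split=> [g /Lambda_lift /Ldef [i1 i2 i3]|].
  split.
  - exact: (ae_lift (fun x => leb.-integrable `]0, +oo[
      (fun s => (poissonH s g x * a s)%:E))).1.
  - exact: (Lfun_lift (laplace_avg (@poissonH R n) a g)).1.
  - exact: (ae_lift (fun x => leb.-integrable `]0, +oo[ (fun tau =>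
      (sqrt_integrand (@poissonH R n) (laplace_avg (@poissonH R n) a g) x tau)%:E))).1.
exists K => g /Lambda_lift /HK; rewrite multiplier_lift => -[/Lambda_lift mg].
by rewrite !Lambda_norm_lift.
Qed.

End Lifting.

Theorem theorem7 (R : realType) (n : nat) (hn : (1 <= n)%N) (a : R -> R)
    (ma : measurable_fun (`[0, +oo[ : set R) a)
    (ba : exists M : R, forall s : R, 0 <= s -> `|a s| <= M)
    (alpha : R) (halpha : 0 < alpha) :
  multiplier_bounded (@spacetime_measure R n) (@poissonL R n) a alpha /\
  multiplier_bounded (lebesgue_tuple R n) (@poissonH R n) a alpha.
Proof.
have [M aM] := ba.
have L : multiplier_bounded (@spacetime_measure R n) (@poissonL R n) a alpha.
  have HK := smoothing_poisson_kernel R hn.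
  exact: (smoothing_multiplier_bounded HK (poissonLE hn) ma aM halpha).
by split => //; exact: multiplier_bounded_lift.
Qed.
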